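(* For any odd integer $m\ge 1$, $$\sum_{n\in\mathbb{Z}}\Phi^{(m)}_n u^{nm}=\left(1+\sum_{\substack{i,j\in\mathbb{Z}\\ i\equiv-2,\ j\equiv 2}}\mathcal{B}_{i,j}u^{i+j}\right)\left(1+\sum_{\substack{i,j\in\mathbb{Z}\\ i\equiv-4,\ j\equiv 4}}\mathcal{B}_{i,j}u^{i+j}\right)\cdots\left(1+\sum_{\substack{i,j\in\mathbb{Z}\\ i\equiv-(m-1),\ j\equiv m-1}}\mathcal{B}_{i,j}u^{i+j}\right)\left(\sum_{\substack{k\in\mathbb{Z}\\ k\equiv 0}}\mathcal{B}_k u^k\right),$$ where all congruences are modulo $m$, the first $\frac{m-1}{2}$ factors correspond to $2,4,\ldots,m-1$ in this order, and $$\mathcal{B}_{i,j}=\begin{cases}\mathcal{B}_i\mathcal{B}_j & (i>j)\\ -\mathcal{B}_j\mathcal{B}_i & (i<j)\\ 0&(i=j).\end{cases}$$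
   Context: $\Lambda$ is the ring of symmetric functions over $\mathbb{Z}$ in variables $X_1,X_2,\ldots$, with complete and elementary symmetric functions $h_r,e_r$ ($h_0=e_0=1$, zero for $r<0$). Put $q_n=\sum_i h_{n-i}e_i$ (so $\sum_{n\ge0}q_nu^n=\prod_i\frac{1+X_iu}{1-X_iu}$, $q_0=1$, $q_n=0$ for $n<0$), and let $\Gamma\subset\Lambda$ be the subring generated by $q_1,q_2,\ldots$. $\Gamma$ has the basis of Schur $Q$-functions $Q_\lambda$, $\lambda$ running over strict partitions ($\lambda_1>\cdots>\lambda_l>0$). An inner product on $\Gamma$ is given by $\langle Q_\lambda,Q_\mu\rangle=\delta_{\lambda\mu}2^{\ell(\lambda)}$, where $\ell(\lambda)$ is the number of parts; for $f\in\Gamma$, $f^\perp$ denotes the adjoint of multiplication by $f$ (all extended linearly to $\Gamma\otimes\mathbb{Q}$ where needed). For $n\in\mathbb{Z}$, $$\mathcal{B}_n=\sum_{i\ge0}(-1)^i q_{n+i}q_i^\perp,$$ where $q_{n+i}$ acts by multiplication; it is known that $Q_\lambda=\mathcal{B}_{\lambda_1}\cdots\mathcal{B}_{\lambda_l}(1)$ for strict $\lambda$, and $\mathcal{B}_r\mathcal{B}_s+\mathcal{B}_s\mathcal{B}_r=2(-1)^r\delta_{r,-s}$. For $m\ge1$ odd and $n\in\mathbb{Z}$, $$\Phi^{(m)}_n=\sum_{i\ge0}(-1)^i(q_{n+i}\circ p_m)(q_i\circ p_m)^\perp:\Gamma\to\Gamma,$$ where $(f\circ p_m)(X_1,X_2,\ldots)=f(X_1^m,X_2^m,\ldots)$.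 Infinite sums of operators here have only finitely many nonzero terms when applied to any given element. The identity is an equality of formal two-sided series in $u$ with coefficients operators on $\Gamma$; on the right-hand side the coefficient of each $u^d$ is well defined in the sense that only finitely many terms are nonzero when applied to a given element. *)

(* Defs.v *)
From HB Require Import structures.
From mathcomp Require Import all_boot all_order all_algebra.
From mathcomp Require Import boolp classical_sets functions cardinality fsbigop.
From mathcomp Require Import fingroup perm mpoly.
Set Implicit Arguments.
Unset Strict Implicit.
Unset Printing Implicit Defensive.
Import Order.TTheory GRing.Theory Num.Theory.
Local Open Scope ring_scope.

(* Symmetric functions are encoded as in the graded inverse limit: an element
   of Lambda is a family f with f n in Z[X_1, ..., X_n] symmetric, f n obtained
   from f n.+1 by X_(n+1) := 0, and the degrees of the f n bounded.            *)

Definition mpolyseq := forall n : nat, {mpoly int[n]}.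

HB.instance Definition _ := Choice.on mpolyseq.

Section MpolyseqRing.
Implicit Types f g h : mpolyseq.

Let add f g : mpolyseq := fun n => f n + g n.
Let opp f : mpolyseq := fun n => - f n.
Let zero : mpolyseq := fun n => 0.
Let one : mpolyseq := fun n => 1.
Let mul f g : mpolyseq := fun n => f n * g n.

Fact mpolyseq_addA : associative add.
Proof. by move=> f g h; apply: functional_extensionality_dep => n; exact: addrA. Qed.
Fact mpolyseq_addC : commutative add.
Proof. by move=> f g; apply: functional_extensionality_dep => n; exact: addrC. Qed.
Fact mpolyseq_add0 : left_id zero add.
Proof. by move=> f; apply: functional_extensionality_dep => n; exact: add0r. Qed.
Fact mpolyseq_addN : left_inverse zero opp add.
Proof. by move=> f; apply: functional_extensionality_dep => n; exact: addNr. Qed.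

HB.instance Definition _ := GRing.isZmodule.Build mpolyseq
  mpolyseq_addA mpolyseq_addC mpolyseq_add0 mpolyseq_addN.

Fact mpolyseq_mulA : associative mul.
Proof. by move=> f g h; apply: functional_extensionality_dep => n; exact: mulrA. Qed.
Fact mpolyseq_mulC : commutative mul.
Proof. by move=> f g; apply: functional_extensionality_dep => n; exact: mulrC. Qed.
Fact mpolyseq_mul1 : left_id one mul.
Proof. by move=> f; apply: functional_extensionality_dep => n; exact: mul1r. Qed.
Fact mpolyseq_mulD : left_distributive mul +%R.
Proof. by move=> f g h; apply: functional_extensionality_dep => n; exact: mulrDl. Qed.
Fact mpolyseq_1neq0 : one != 0.
Proof.
apply/eqP => /(congr1 (fun f : mpolyseq => f 0%N)) /eqP.
by rewrite /one /= oner_eq0.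
Qed.

HB.instance Definition _ := GRing.Zmodule_isComNzRing.Build mpolyseq
  mpolyseq_mulA mpolyseq_mulC mpolyseq_mul1 mpolyseq_mulD mpolyseq_1neq0.

End MpolyseqRing.

Definition mrestr_tuple (n : nat) : n.+1.-tuple {mpoly int[n]} :=
  [tuple if unlift ord_max i is Some j then 'X_j else 0 | i < n.+1].

(* p(X_1, ..., X_n, 0) *)
Definition mrestr (n : nat) (p : {mpoly int[n.+1]}) : {mpoly int[n]} :=
  p \mPo mrestr_tuple n.

HB.instance Definition _ n := GRing.RMorphism.copy (@mrestr n)
  (comp_mpoly (mrestr_tuple n)).

Definition symfun_axiom (f : mpolyseq) : Prop :=
  [/\ forall n, f n \is symmetric,
      forall n, mrestr (f n.+1) = f n
    & exists d, forall n, (msize (f n) <= d)%N].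

Definition symfun_pred : {pred mpolyseq} := fun f => `[< symfun_axiom f >].

Lemma symfunP f : reflect (symfun_axiom f) (f \in symfun_pred).
Proof. exact: asboolP. Qed.

Fact symfun_subring : subring_closed symfun_pred.
Proof.
split=> [|f g|f g].
- apply/symfunP; split=> [n|n|]; [exact: rpred1 | exact: rmorph1 |].
  by exists 1%N => n; rewrite msize1.
- move=> /symfunP[fS fR [d fd]] /symfunP[gS gR [e ge]].
  apply/symfunP; split=> [n|n|].
  + exact: (rpredB (fS n) (gS n)).
  + rewrite -[RHS]/(f n - g n) -(fR n) -(gR n).
    exact: (raddfB (@mrestr n)).
  + exists (maxn d e) => n; apply: leq_trans (msizeD_le (f n) (- g n)) _.
    by rewrite (@msizeN _ _ (g n)) geq_max !leq_max fd ge orbT.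
- move=> /symfunP[fS fR [d fd]] /symfunP[gS gR [e ge]].
  apply/symfunP; split=> [n|n|].
  + exact: (rpredM (fS n) (gS n)).
  + rewrite -[RHS]/(f n * g n) -(fR n) -(gR n).
    exact: (rmorphM (@mrestr n)).
  + exists (d + e).+1 => n; apply: leq_trans (msizeM_le (f n) (g n)) _.
    by rewrite ltnS leq_add.
Qed.

HB.instance Definition _ :=
  GRing.isSubringClosed.Build mpolyseq symfun_pred symfun_subring.

Record symfun := SymFun { sf_val :> mpolyseq; _ : sf_val \in symfun_pred }.

HB.instance Definition _ := [isSub for sf_val].
HB.instance Definition _ := [Choice of symfun by <:].
HB.instance Definition _ := [SubChoice_isSubComNzRing of symfun by <:].

Lemma mcoeff_mrestr n (p : {mpoly int[n.+1]}) m :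
  (mrestr p)@_m = p@_(mnmwiden m).
Proof.
rewrite /mrestr comp_mpolyE [p in RHS]mpolyE !raddf_sum /=.
apply: eq_bigr => k _; rewrite !mcoeffZ mcoeffX; congr (_ * _).
rewrite big_ord_recr /= tnth_mktuple unlift_none.
rewrite (eq_bigr (fun i : 'I_n => 'X_i ^+ k (widen_ord (leqnSn n) i))); last first.
  move=> i _; rewrite tnth_mktuple.
  have -> : widen_ord (leqnSn n) i = lift ord_max i.
    by apply: val_inj; rewrite /= /bump leqNgt ltn_ord.
  by rewrite liftK.
pose k' := [multinom k (widen_ord (leqnSn n) i) | i < n].
rewrite (eq_bigr (fun i : 'I_n => 'X_i ^+ k' i)); last by move=> i _; rewrite mnmE.
rewrite -mpolyXE_id expr0n.
have -> : (k == mnmwiden m) = (k ord_max == 0%N) && (k' == m).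
  apply/eqP/andP => [kE|[/eqP k0 /eqP <-]].
    rewrite {1}kE mnmwiden_ordmax; split=> //; apply/eqP/mnmP => i.
    by rewrite mnmE kE mnmwiden_widen.
  apply/mnmP => i; case: (unliftP ord_max i) => [j ->|->].
    have -> : lift ord_max j = widen_ord (leqnSn n) j.
      by apply: val_inj; rewrite /= /bump leqNgt ltn_ord.
    by rewrite mnmwiden_widen mnmE.
  by rewrite mnmwiden_ordmax k0.
case: eqP => _ /=; first by rewrite mulr1 mcoeffX.
by rewrite mulr0 mcoeff0.
Qed.

Lemma mdeg_mnmwiden n (m : 'X_{1..n}) : mdeg (mnmwiden m) = mdeg m.
Proof.
rewrite !mdegE big_ord_recr /= mnmwiden_ordmax addn0.
by apply: eq_bigr => i _; rewrite mnmwiden_widen.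
Qed.

Fact mesym_symfun k : (fun n => mesym n int k) \in symfun_pred.
Proof.
apply/symfunP; split=> [n|n|]; first exact: mesym_sym.
  apply/mpolyP => m; rewrite mcoeff_mrestr !mcoeff_mesym /mechar mdeg_mnmwiden.
  congr (_ && _)%:R; apply/forallP/forallP => [mP i|mP i].
    by rewrite -mnmwiden_widen.
  case: (unliftP ord_max i) => [j ->|->]; last by rewrite mnmwiden_ordmax.
  have -> : lift ord_max j = widen_ord (leqnSn n) j.
    by apply: val_inj; rewrite /= /bump leqNgt ltn_ord.
  by rewrite mnmwiden_widen.
exists k.+1 => n; rewrite msizeE; apply/bigmax_leqP_seq => m.
by rewrite mem_msupp_mesym => /andP[/eqP ->].
Qed.

Definition esymf (k : nat) : symfun := SymFun (mesym_symfun k).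

Definition mhsym (n k : nat) : {mpoly int[n]} :=
  \sum_(m : 'X_{1..n < k.+1} | mdeg m == k) 'X_[m].

Lemma mcoeff_mhsym n k m : (mhsym n k)@_m = (mdeg m == k)%:R.
Proof.
rewrite /mhsym raddf_sum /=; case: eqP => [mk|mk].
  have mb : (mdeg m < k.+1)%N by rewrite mk.
  rewrite (bigD1 (BMultinom mb)) /= ?mk // mcoeffX eqxx big1 ?addr0 // => l.
  move=> /andP[_ /eqP lm]; rewrite mcoeffX; case: eqP => // lE.
  by case: lm; apply: val_inj.
by rewrite big1 // => l /eqP lk; rewrite mcoeffX; case: eqP => // lm; case: mk; rewrite -lm.
Qed.

Fact mhsym_symfun k : (fun n => mhsym n k) \in symfun_pred.
Proof.
apply/symfunP; split=> [n|n|].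
- by apply/issymP => s; apply/mpolyP => m; rewrite mcoeff_sym !mcoeff_mhsym mdeg_mperm.
- by apply/mpolyP => m; rewrite mcoeff_mrestr !mcoeff_mhsym mdeg_mnmwiden.
- exists k.+1 => n; rewrite msizeE; apply/bigmax_leqP_seq => m.
  rewrite mcoeff_msupp mcoeff_mhsym; case: (mdeg m =P k) => [->|] //=.
Qed.

Definition hsymf (k : nat) : symfun := SymFun (mhsym_symfun k).

Definition qsymf (n : nat) : symfun := \sum_(i < n.+1) hsymf (n - i) * esymf i.

Definition gamma_pred : {pred symfun} := fun f =>
  `[< forall S : {pred symfun},
        subring_closed S -> (forall n, qsymf n \in S) -> f \in S >].

Lemma gammaP f : reflect
  (forall S : {pred symfun},
     subring_closed S -> (forall n, qsymf n \in S) -> f \in S)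
  (f \in gamma_pred).
Proof. exact: asboolP. Qed.

Fact gamma_subring : subring_closed gamma_pred.
Proof.
split=> [|f g /gammaP fG /gammaP gG|f g /gammaP fG /gammaP gG];
  apply/gammaP => S Sring Sq; have [S1 SB SM] := Sring => //.
- by apply: SB; [exact: fG | exact: gG].
- by apply: SM; [exact: fG | exact: gG].
Qed.

HB.instance Definition _ :=
  GRing.isSubringClosed.Build symfun gamma_pred gamma_subring.

Record Gamma := GammaElt { gamma_val :> symfun; _ : gamma_val \in gamma_pred }.

HB.instance Definition _ := [isSub for gamma_val].
HB.instance Definition _ := [Choice of Gamma by <:].
HB.instance Definition _ := [SubChoice_isSubComNzRing of Gamma by <:].

Fact qsymf_gamma n : qsymf n \in gamma_pred.
Proof. by apply/gammaP => S _; apply. Qed.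

Definition qfun (n : int) : Gamma :=
  if n is Posz k then GammaElt (qsymf_gamma k) else 0.

Local Open Scope classical_set_scope.

(* q_(a,b) for a > b >= 0 *)
Definition schurQ2 (a b : nat) : Gamma :=
  qfun a * qfun b
  + 2%:R * \sum_(1 <= i < b.+1) (-1) ^+ i * qfun (a + i)%N * qfun (b - i)%N.

(* Pfaffian of the skew-symmetric matrix with entries a (s_i) (s_j), i < j, for
   s of size 2k, by expansion along the first row. *)
Fixpoint pfaffian (T : Type) (x0 : T) (R : comNzRingType) (a : T -> T -> R)
    (k : nat) (s : seq T) : R :=
  if k is k'.+1 then
    if s is x :: s' then
      \sum_(j < size s')
        (-1) ^+ j * a x (nth x0 s' j) * pfaffian x0 a k' (take j s' ++ drop j.+1 s')
    else 0
  else 1.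

Definition strict_partition (la : seq nat) := sorted gtn la && (0%N \notin la).

(* Schur's definition: the Pfaffian of the Q_(la_i, la_j), where la is completed
   by a part 0 if its length is odd. *)
Definition schurQ (la : seq nat) : Gamma :=
  pfaffian 0%N schurQ2 (uphalf (size la))
    (if odd (size la) then rcons la 0%N else la).

(* Bilinearity and the values on the basis of Schur Q-functions determine the
   form, and f^perp is determined by nondegeneracy. *)
Definition is_gamma_form (ip : Gamma -> Gamma -> int) : Prop :=
  [/\ forall f g h, ip (f + g) h = ip f h + ip g h,
      forall f g h, ip f (g + h) = ip f g + ip f h
    & forall la mu, strict_partition la -> strict_partition mu ->
        ip (schurQ la) (schurQ mu) = if la == mu then 2%:R ^+ size la else 0].

Definition gamma_form : Gamma -> Gamma -> int :=
  xget (fun _ _ => 0) [set ip | is_gamma_form ip].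

Definition perp (f : Gamma) : Gamma -> Gamma :=
  xget (fun _ => 0)
    [set T | forall g h, gamma_form (T g) h = gamma_form g (f * h)].

(* \sum_(i \in A) is 0 when the terms have infinite support, which does not
   occur here because perp (qfun i) g = 0 for large i. *)
Definition Bop (n : int) (g : Gamma) : Gamma :=
  \sum_(i \in [set: nat]) (-1) ^+ i * qfun (n + i%:Z) * perp (qfun i) g.

Definition Bop2 (i j : int) (g : Gamma) : Gamma :=
  if j < i then Bop i (Bop j g) else
  if i < j then - Bop j (Bop i g) else 0.

Definition pow_vars (m : nat) (f : mpolyseq) : mpolyseq :=
  fun n => f n \mPo [tuple 'X_i ^+ m | i < n].

Lemma pow_vars_symfun (m : nat) (f : mpolyseq) :
  (0 < m)%N -> f \in symfun_pred -> pow_vars m f \in symfun_pred.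
Proof.
move=> m0 /symfunP[fS fR [d fd]].
apply/symfunP; split=> [n|n|].
- apply: msym_comp_poly => // s; apply/tuple_permP; exists s^-1%g.
  congr (tval _); apply: eq_from_tnth => i.
  rewrite !tnth_mktuple -tnth_nth !tnth_mktuple rmorphXn /= msymX.
  congr ('X_[ _] ^+ _); apply/mnmP => j.
  by rewrite mnmE !mnm1E (inj_eq perm_inj).
- rewrite /pow_vars -[in RHS]fR.
  set p := f n.+1; rewrite /mrestr !(comp_mpolyEX p) !raddf_sum /=.
  apply: eq_bigr => k _; rewrite !comp_mpolyZ; congr (_ *: _).
  rewrite !comp_mpolyX !rmorph_prod; apply: eq_bigr => i _; rewrite !rmorphXn; congr (_ ^+ _).
  rewrite tnth_mktuple rmorphXn /= comp_mpolyXU -tnth_nth tnth_mktuple.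
  case: unliftP => [j _|_]; first by rewrite comp_mpolyXU -tnth_nth tnth_mktuple.
  by rewrite rmorph0 expr0n eqn0Ngt m0.
- exists (d * m).+1 => n; rewrite /pow_vars comp_mpolyEX.
  rewrite big_seq; apply: (big_ind (fun p => msize p <= (d * m).+1)%N) => //.
  + by rewrite msize0.
  + move=> p q pd qd; apply: leq_trans (msizeD_le p q) _.
    by rewrite geq_max pd.
  + move=> k kf; apply: leq_trans (msizeZ_le _ _) _.
    rewrite comp_mpolyX (eq_bigr (fun i => 'X_i ^+ (k *+ m)%MM i)); last first.
      by move=> i _; rewrite tnth_mktuple -exprM mulmnE mulnC.
    rewrite -mpolyXE_id msizeX ltnS mdegMn leq_mul2r.
    by rewrite (leq_trans (ltnW (msize_mdeg_lt kf)) (fd n)) orbT.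
Qed.

(* q_n \circ p_m. It lies in Gamma for odd m: the series of the q_n \circ p_m in
   u^m is the product over the m-th roots of unity z of the series of the q_n in
   z u. For even m it need not, and insubd then returns 0. *)
Definition qfun_pow (m : nat) (n : int) : Gamma :=
  insubd 0 (insubd 0 (pow_vars m (qfun n)) : symfun).

Definition Phi (m : nat) (n : int) (g : Gamma) : Gamma :=
  \sum_(i \in [set: nat])
     (-1) ^+ i * qfun_pow m (n + i%:Z) * perp (qfun_pow m i) g.

(* A formal sum of terms os_op t * u ^ os_deg t over the t in os_dom, with
   operators on Gamma as coefficients. Products are expanded into terms, so that
   summability means that for every d only finitely many terms of degree d are
   nonzero on any given element. *)
Record opseries := OpSeries {
  os_idx : choiceType;
  os_dom : set os_idx;
  os_deg : os_idx -> int;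
  os_op : os_idx -> Gamma -> Gamma }.

Definition os_terms (S : opseries) (d : int) : set (os_idx S) :=
  [set t | os_dom t /\ os_deg t = d].

Arguments os_terms S d : clear implicits.

Definition os_coef (S : opseries) (d : int) (g : Gamma) : Gamma :=
  \sum_(t \in os_terms S d) os_op t g.

Definition os_summable (S : opseries) : Prop :=
  forall d g, finite_set (os_terms S d `&` [set t | os_op t g != 0]).

Definition os_one : opseries :=
  @OpSeries unit setT (fun=> 0) (fun _ g => g).

Definition os_add (S T : opseries) : opseries :=
  @OpSeries (os_idx S + os_idx T)%type
    [set t | match t with inl s => os_dom s | inr s => os_dom s end]
    (fun t => match t with inl s => os_deg s | inr s => os_deg s end)
    (fun t => match t with inl s => os_op s | inr s => os_op s end).

Definition os_mul (S T : opseries) : opseries :=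
  @OpSeries (os_idx S * os_idx T)%type
    [set t | os_dom t.1 /\ os_dom t.2]
    (fun t => os_deg t.1 + os_deg t.2)
    (fun t g => os_op t.1 (os_op t.2 g)).

Definition os_eq (S T : opseries) : Prop :=
  [/\ os_summable S, os_summable T & forall d g, os_coef S d g = os_coef T d g].

(* Main.v *)
From HB Require Import structures.
From mathcomp Require Import all_boot all_order all_algebra.
From mathcomp Require Import boolp classical_sets functions cardinality fsbigop.
From mathcomp Require Import mpoly.
From mathcomp Require Import zify ring.
Require Import Defs.
Set Implicit Arguments.
Unset Strict Implicit.
Unset Printing Implicit Defensive.
Import Order.TTheory GRing.Theory Num.Theory.
Local Open Scope ring_scope.

(** Write B(u) for the series of the B_n u^n.

    The idea.  Both sides are series of operators on Gamma, and such a series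
    R = sum R_d u^d is determined by two data: its value on 1, and the fact that
    (-1)^k (R B_k u^k + B_k u^k R) depends only on k modulo m.  Indeed the difference
    of two solutions kills 1; if it kills f then, by the second property, it sends
    B_k f, up to sign and a power of u, to the same element as B_(k - m t) f for every
    t, and B_j f = 0 for j very negative; since Gamma is reached from 1 by the
    operators B_k ([Bv_ind]), the difference is 0 ([limprod_powvop]).

    The left side.  It is a vertex operator built from the z_n = q_n o p_m.  All that
    is needed of z(u) = sum z_n u^(mn) is that a new variable w multiplies it by
    (1 + (uw)^m) / (1 - (uw)^m).  Commuting the adjoints past the multiplications then
    gives the relation above by a computation with one rational function ([vop_Bv]);
    the case m = 1 is the Clifford relation for the B_n ([cliff]).

    The right side.  For the factor attached to a, the commutator of the normally
    ordered sum with B_k vanishes unless k is congruent to a or -a ([pairsum_comm]).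
    As m is odd, the classes 0, 2, -2, 4, -4, ..., m - 1, -(m - 1) are exactly the
    residues modulo m, once each, so B_k meets a single factor and the relation follows
    ([boxprod_anticomm]).

    The value on 1.  For k > 0 the product applied to 1 is killed by
    Z_k = B_(-k) + 2 sum_(n > -k, n = -k mod m) B_n ([Zop_boxprod]): for each
    residue this is a computation with one factor, and it is here that the
    representatives a must be even.  Since q(v) q(-v) = 1, the relations B(v) = q(v)
    q(-1/v)^perp can be solved for the operators q_j^perp ([skew_from_Bv]), and the
    equations Z_k = 0 become the statement that a new variable w multiplies the image
    of 1 by (1 + (uw)^m) / (1 - (uw)^m) ([skew_vacprod]).  As its constant term is 1
    ([chi_vacprod]), the image of 1 is sum_n (q_n o p_m) u^(nm).  This also shows, over
    the integers and without roots of unity, that the q_n o p_m lie in Gamma.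

    The data of the statement.  Everything above uses only the operators q_n and the
    coefficients of f(X, w) in w.  That the latter are the q_n^perp follows from the
    anti-involution B_n -> (-1)^n B_(-n) of the Clifford algebra: the constant term of
    a word in the B_n is invariant under it, which defines a form for which the
    B_(la_1) ... B_(la_l) 1 have the prescribed products ([ip_strict]) and q_n is
    adjoint to the coefficient of w^n ([ip_skew]).  That these words are the Pfaffians
    defining the Q_la is [Xw_pfaffian].  Finally, a term of the expanded product which
    does not kill a given g has all its indices bounded below, hence in a fixed
    degree only finitely many terms act on g ([term_bound]); so the product is
    the limit of its truncations to indices in [-N, N], where all sums are finite. *)

(** * Splitting off the last variable of a polynomial *)

Definition mnmrcons N (k : 'X_{1..N}) i : 'X_{1..N.+1} := [multinom of rcons k i].

Lemma mnmrcons_max N (k : 'X_{1..N}) i : mnmrcons k i ord_max = i.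
Proof. by rewrite /mnmrcons /fun_of_multinom (tnth_nth 0%N) /= nth_rcons size_tuple ltnn eqxx. Qed.

Lemma mnmrcons_widen N (k : 'X_{1..N}) i (j : 'I_N) : mnmrcons k i (widen_ord (leqnSn N) j) = k j.
Proof. by rewrite /mnmrcons /fun_of_multinom !(tnth_nth 0%N) /= nth_rcons size_tuple ltn_ord. Qed.

Lemma mnmrconsP N (l : 'X_{1..N.+1}) (k : 'X_{1..N}) i :
  l = mnmrcons k i <->
  l ord_max = i /\ forall j : 'I_N, l (widen_ord (leqnSn N) j) = k j.
Proof.
split=> [->|[lm lw]]; first by rewrite mnmrcons_max; split=> // j; rewrite mnmrcons_widen.
apply/mnmP => j; case: (unliftP ord_max j) => [j' ->|->]; last by rewrite mnmrcons_max.
have -> : lift ord_max j' = widen_ord (leqnSn N) j'.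
  by apply: val_inj; rewrite /= /bump leqNgt ltn_ord.
by rewrite mnmrcons_widen.
Qed.

Lemma mcoeff_muni N (p : {mpoly int[N.+1]}) i (k : 'X_{1..N}) :
  ((muni p)`_i)@_k = p@_(mnmrcons k i).
Proof.
rewrite muniE coef_sum raddf_sum /=.
rewrite [p in RHS]mpolyE raddf_sum /=; apply: eq_bigr => l _.
rewrite coefZ coefXn mulr_natr mcoeffMn !mcoeffZ !mcoeffX -mulrnAr; congr (_ * _).
have -> : (l == mnmrcons k i) =
   (i == l ord_max) && ([multinom l (widen_ord (leqnSn N) j) | j < N] == k).
  apply/eqP/andP => [/mnmrconsP[<- lw]|[/eqP -> /eqP <-]].
    by split=> //; apply/eqP/mnmP => j; rewrite mnmE lw.
  by apply/mnmrconsP; split=> // j; rewrite mnmE.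
by case: (i == l ord_max); rewrite /= ?mulr1n ?mulr0n.
Qed.

Lemma muni_inj N : injective (@muni N int).
Proof.
move=> p q pq; apply/mpolyP => k.
pose k' := [multinom k (widen_ord (leqnSn N) j) | j < N].
have kE : k = mnmrcons k' (k ord_max).
  by apply/mnmrconsP; split=> [//|j]; rewrite [RHS]mnmE.
by rewrite kE -!mcoeff_muni pq.
Qed.

Lemma muni_mwiden N (p : {mpoly int[N]}) : muni (mwiden p) = p%:P.
Proof.
apply/polyP => i; apply/mpolyP => k; rewrite mcoeff_muni coefC.
case: i => [|i] /=; first exact: (mwiden_mnmwiden p k).
rewrite mcoeff0 (mwidenE (leqnn _)) raddf_sum big1 //= => l _.
rewrite mcoeffZ mcoeffX; case: eqP => [/mnmrconsP[]|]; last by rewrite mulr0.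
by rewrite mnmwiden_ordmax.
Qed.

Lemma muni_Xmax N : muni ('X_ord_max : {mpoly int[N.+1]}) = 'X.
Proof.
apply/polyP => i; apply/mpolyP => k; rewrite mcoeff_muni coefX mcoeffX.
have -> : (U_(ord_max)%MM == mnmrcons k i) = (i == 1%N) && (k == 0%MM).
  have Uw (j : 'I_N) : U_(@ord_max N)%MM (widen_ord (leqnSn N) j) = 0%N.
    by rewrite mnm1E; case: eqP => // /(congr1 val) /= E; move: (ltn_ord j); rewrite -E ltnn.
  apply/eqP/andP => [/mnmrconsP[<- E]|[/eqP -> /eqP ->]].
    by rewrite mnm1E eqxx; split=> //; apply/eqP/mnmP => j; rewrite -E Uw mnm0E.
  by apply/mnmrconsP; rewrite mnm1E eqxx; split=> // j; rewrite Uw mnm0E.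
case: eqP => _ /=; last by rewrite mcoeff0.
by rewrite mcoeff1.
Qed.

(** Sequences stand for power series in u: [delay] is multiplication by u and
    [convol] is the product. *)
Section Convolution.
Variable R : comNzRingType.
Implicit Types f g : nat -> R.

Definition delay f n := if n is n'.+1 then f n' else 0.
Definition convol f g n := \sum_(i < n.+1) f (n - i)%N * g i.

Lemma convol_delayl f g n : convol (delay f) g n = delay (convol f g) n.
Proof.
case: n => [|n]; first by rewrite /convol big_ord1 /= mul0r.
rewrite /convol big_ord_recr /= subnn mul0r addr0.
by apply: eq_bigr => i _; rewrite subSn // -ltnS.
Qed.

Lemma convol_delayr f g n : convol f (delay g) n = delay (convol f g) n.
Proof.
case: n => [|n]; first by rewrite /convol big_ord1 /= mulr0.
by rewrite /convol big_ord_recl /= mulr0 add0r; apply: eq_bigr.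
Qed.

Lemma convol_linl f1 f2 g a n :
  convol (fun k => f1 k + a * f2 k) g n = convol f1 g n + a * convol f2 g n.
Proof.
by rewrite /convol mulr_sumr -big_split; apply: eq_bigr => i _; rewrite mulrDl mulrA.
Qed.

Lemma convol_linr f g1 g2 a n :
  convol f (fun k => g1 k + a * g2 k) n = convol f g1 n + a * convol f g2 n.
Proof.
rewrite /convol mulr_sumr -big_split; apply: eq_bigr => i _.
by rewrite mulrDr mulrCA.
Qed.

Lemma eq_convol f1 f2 g1 g2 n : f1 =1 f2 -> g1 =1 g2 -> convol f1 g1 n = convol f2 g2 n.
Proof. by move=> ef eg; apply: eq_bigr => i _; rewrite ef eg. Qed.

End Convolution.

(** The series of the h_n has the factor 1 / (1 - wu) for the variable w, that of
    the e_n the factor 1 + wu. *)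
Lemma muni_mhsym N n :
  muni (mhsym N.+1 n) + (-'X) * delay (fun k => muni (mhsym N.+1 k)) n = (mhsym N n)%:P.
Proof.
apply/polyP => i; apply/mpolyP => k.
rewrite coefD mulNr coefN coefXM mcoeffD mcoeff_muni mcoeff_mhsym coefC.
have degE j : mdeg (mnmrcons k j) = (mdeg k + j)%N.
  rewrite !mdegE big_ord_recr /= mnmrcons_max; congr (_ + _)%N.
  by apply: eq_bigr => l _; rewrite mnmrcons_widen.
case: i => [|i] /=; first by rewrite mcoeffN !mcoeff0 subr0 degE addn0 mcoeff_mhsym.
rewrite degE mcoeffN mcoeff0.
case: n => [|n] /=; first by rewrite coef0 mcoeff0 addnS subr0.
by rewrite mcoeff_muni mcoeff_mhsym degE addnS eqSS subrr.
Qed.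

Lemma muni_mesym N n :
  muni (mesym N.+1 int n) = (mesym N int n)%:P + 'X * delay (fun k => (mesym N int k)%:P) n.
Proof.
case: n => [|n] /=; first by rewrite !mesym0E muni1 mulr0 addr0.
by rewrite mesymSS muniD muniM muni_mwiden muni_Xmax muni_mwiden mulrC.
Qed.

(** * Gamma and the addition of a variable *)

HB.lock Definition evalN (N : nat) (f : Gamma) : {mpoly int[N]} := sf_val (gamma_val f) N.

Lemma evalN_zmod N : zmod_morphism (evalN N).
Proof. by move=> f g; rewrite unlock. Qed.
HB.instance Definition _ N := GRing.isZmodMorphism.Build Gamma {mpoly int[N]} (evalN N) (evalN_zmod N).
Lemma evalN_monoid N : monoid_morphism (evalN N).
Proof. by rewrite unlock. Qed.
HB.instance Definition _ N := GRing.isMonoidMorphism.Build Gamma {mpoly int[N]} (evalN N) (evalN_monoid N).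

Lemma evalN_inj f g : (forall N, evalN N f = evalN N g) -> f = g.
Proof.
rewrite unlock => fg; do 2!apply: val_inj.
by apply: functional_extensionality_dep => N; exact: fg.
Qed.

HB.lock Definition qpoly N n : {mpoly int[N]} :=
  convol (mhsym N) (mesym N int) n.

Lemma evalN_q N (n : nat) : evalN N (qfun n) = qpoly N n.
Proof.
rewrite !unlock /= /qsymf /convol.
have E (I : finType) (F : I -> symfun) : sf_val (\sum_i F i) N = \sum_i sf_val (F i) N.
  by apply: (big_morph (fun f : symfun => sf_val f N)).
by rewrite E.
Qed.

Lemma muni_qpoly N n :
  muni (qpoly N.+1 n) - 'X * delay (fun k => muni (qpoly N.+1 k)) n =
  (qpoly N n)%:P + 'X * delay (fun k => (qpoly N k)%:P) n.
Proof.
pose h k := muni (mhsym N.+1 k); pose e k := muni (mesym N.+1 int k).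
have qE k : muni (qpoly N.+1 k) = convol h e k.
  by rewrite unlock /convol rmorph_sum; apply: eq_bigr => i _; rewrite rmorphM.
have qE' k : (qpoly N k)%:P = convol (fun k => (mhsym N k)%:P) (fun k => (mesym N int k)%:P) k.
  by rewrite unlock /convol rmorph_sum; apply: eq_bigr => i _; rewrite rmorphM.
have -> : delay (fun k => muni (qpoly N.+1 k)) n = convol (delay h) e n.
  by rewrite convol_delayl; case: n => [|n] //=.
rewrite qE -mulNr -convol_linl.
have -> : delay (fun k => (qpoly N k)%:P) n = convol (fun k => (mhsym N k)%:P) (delay (fun k => (mesym N int k)%:P)) n.
  by rewrite convol_delayr; case: n => [|n] //=.
rewrite qE' -convol_linr; apply: eq_convol => k; first exact: muni_mhsym.
exact: muni_mesym.
Qed.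

Lemma Gamma_ring_ind (P : Gamma -> Prop) :
  P 1 -> (forall f g, P f -> P g -> P (f - g)) ->
  (forall f g, P f -> P g -> P (f * g)) ->
  (forall n : nat, P (qfun n)) -> forall f, P f.
Proof.
move=> P1 PB PM Pq f.
pose S : {pred symfun} := fun g => `[< exists2 h, gamma_val h = g & P h >].
have SP g : reflect (exists2 h, gamma_val h = g & P h) (g \in S) by exact: asboolP.
have Sring : subring_closed S.
  split=> [|g g' /SP[h <- Ph] /SP[h' <- Ph']|g g' /SP[h <- Ph] /SP[h' <- Ph']]; apply/SP.
  - by exists 1.
  - by exists (h - h'); last exact: PB.
  - by exists (h * h'); last exact: PM.
have Sq n : qsymf n \in S by apply/SP; exists (qfun n).
case: f => f fG; have /SP[h hf Ph] := elimT (gammaP f) fG S Sring Sq.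
by suff -> : GammaElt fG = h by []; apply: val_inj.
Qed.

Lemma qfun0 : qfun 0 = 1.
Proof.
apply: evalN_inj => N; rewrite evalN_q unlock /convol big_ord1 mesym0E mulr1 rmorph1.
by apply/mpolyP => k; rewrite mcoeff_mhsym mcoeff1 mdeg_eq0.
Qed.

Lemma qfun_lt0 n : n < 0 -> qfun n = 0.
Proof. by case: n. Qed.

Definition addvar_spec (f : Gamma) (P : {poly Gamma}) :=
  forall N, muni (evalN N.+1 f) = map_poly (evalN N) P.

Lemma addvar_uniq f P Q : addvar_spec f P -> addvar_spec f Q -> P = Q.
Proof.
move=> fP fQ; apply/polyP => i; apply: evalN_inj => N.
by have := congr1 (fun p : {poly _} => p`_i) (etrans (esym (fP N)) (fQ N)); rewrite !coef_map.
Qed.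

Lemma addvar_spec1 : addvar_spec 1 1.
Proof. by move=> N; rewrite !rmorph1. Qed.

Lemma addvar_specB f g P Q :
  addvar_spec f P -> addvar_spec g Q -> addvar_spec (f - g) (P - Q).
Proof. by move=> fP gQ N; rewrite raddfB muniB fP gQ rmorphB. Qed.

Lemma addvar_specM f g P Q :
  addvar_spec f P -> addvar_spec g Q -> addvar_spec (f * g) (P * Q).
Proof. by move=> fP gQ N; rewrite rmorphM muniM fP gQ rmorphM. Qed.

Lemma muni_evalN_q N (n : nat) :
  muni (evalN N.+1 (qfun n.+1)) =
  'X * muni (evalN N.+1 (qfun n)) + ((evalN N (qfun n.+1))%:P + 'X * (evalN N (qfun n))%:P).
Proof.
have /= E := muni_qpoly N n.+1.
have -> : evalN N.+1 (qfun n.+1) = qpoly N.+1 n.+1 := evalN_q _ _.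
have -> : evalN N.+1 (qfun n) = qpoly N.+1 n := evalN_q _ _.
have -> : evalN N (qfun n.+1) = qpoly N n.+1 := evalN_q _ _.
have -> : evalN N (qfun n) = qpoly N n := evalN_q _ _.
by rewrite -E addrC subrK.
Qed.

Lemma addvar_spec_qS (n : nat) P :
  addvar_spec (qfun n) P ->
  addvar_spec (qfun n.+1) ('X * P + ((qfun n.+1)%:P + 'X * (qfun n)%:P)).
Proof.
move=> qP N; rewrite muni_evalN_q qP.
by rewrite !rmorphD !rmorphM /= map_polyX !map_polyC.
Qed.

(** A new variable is added to q_n by a recursion with coefficients in Gamma, and
    the q_n generate Gamma; hence f(X, w) is a polynomial in w over Gamma. *)
Lemma addvar_ex f : exists P, addvar_spec f P.
Proof.
elim/Gamma_ring_ind: f => [|f g [P fP] [Q gQ]|f g [P fP] [Q gQ]|n].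
- by exists 1; exact: addvar_spec1.
- by exists (P - Q); exact: addvar_specB.
- by exists (P * Q); exact: addvar_specM.
- elim: n => [|n [P qP]]; first by exists 1; rewrite qfun0; exact: addvar_spec1.
  by eexists; apply: addvar_spec_qS qP.
Qed.

HB.lock Definition addvar (f : Gamma) : {poly Gamma} := projT1 (cid (addvar_ex f)).

Lemma addvarP f : addvar_spec f (addvar f).
Proof. by rewrite unlock; exact: projT2 (cid (addvar_ex f)). Qed.

Lemma addvar_zmod : zmod_morphism addvar.
Proof.
by move=> f g; apply: (addvar_uniq (addvarP _)); apply: addvar_specB; exact: addvarP.
Qed.
HB.instance Definition _ := GRing.isZmodMorphism.Build Gamma {poly Gamma} addvar addvar_zmod.

Lemma addvar_monoid : monoid_morphism addvar.
Proof.
split; first exact: (addvar_uniq (addvarP _) addvar_spec1).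
by move=> f g; apply: (addvar_uniq (addvarP _)); apply: addvar_specM; exact: addvarP.
Qed.
HB.instance Definition _ :=
  GRing.isMonoidMorphism.Build Gamma {poly Gamma} addvar addvar_monoid.

Lemma addvar_q (n : int) :
  addvar (qfun n) - 'X * addvar (qfun (n - 1)) = (qfun n)%:P + 'X * (qfun (n - 1))%:P.
Proof.
case: n => [[|n]|n].
- by rewrite qfun0 (qfun_lt0 (n := 0 - 1)) // !rmorph0 !mulr0 rmorph1 subr0 addr0.
- have -> : (n.+1%:Z - 1) = n by lia.
  have /(addvar_uniq (addvarP _)) -> := addvar_spec_qS (addvarP (qfun n)).
  by rewrite addrC addrA addNr add0r.
- have n1 : Negz n - 1 < 0 by lia.
  by rewrite (qfun_lt0 n1) (qfun_lt0 (n := Negz n)) // !rmorph0 !mulr0 subr0 addr0.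
Qed.

HB.lock Definition chi (f : Gamma) : int := (evalN 0 f)@_0%MM.

Lemma chi_zmod : zmod_morphism chi.
Proof. by move=> f g; rewrite unlock rmorphB mcoeffB. Qed.
HB.instance Definition _ := GRing.isZmodMorphism.Build Gamma int chi chi_zmod.

Lemma chi_monoid : monoid_morphism chi.
Proof.
split; first by rewrite unlock rmorph1 mcoeff1 eqxx.
by move=> f g; rewrite unlock rmorphM; exact: (rmorphM (mcoeff 0%MM : {mpoly int[0]} -> int)).
Qed.
HB.instance Definition _ := GRing.isMonoidMorphism.Build Gamma int chi chi_monoid.

Lemma mpoly0E (p : {mpoly int[0]}) : p = (p@_0%MM)%:MP.
Proof.
apply/mpolyP => k; rewrite mcoeffC.
have -> : k = 0%MM by apply/mnmP; case.
by rewrite eqxx mulr1.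
Qed.

Lemma chi_q (n : int) : chi (qfun n) = (n == 0)%:R.
Proof.
case: n => n; last by rewrite raddf0.
rewrite unlock evalN_q unlock /convol raddf_sum /= (eq_bigr (fun i : 'I_n.+1 => ((n - i)%N == 0%N)%:R * (val i == 0%N)%:R)).
  case: n => [|n]; first by rewrite big_ord1.
  rewrite big1 // => i _; case: (i =P 0%N :> nat) => [->|]; last by rewrite mulr0.
  by rewrite mul0r.
move=> i _; rewrite rmorphM /= mcoeff_mhsym mcoeff_mesym /mechar mdeg0.
have -> : [forall j : 'I_0, (0%MM : 'X_{1..0}) j <= 1]%N by apply/forallP; case.
by rewrite andbT !(eq_sym 0%N).
Qed.

(** An element is determined by the constant terms of the elements obtained from it
    by repeatedly taking coefficients of new variables. *)
Lemma Gamma_eq0 (P : Gamma -> Prop) :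
  (forall f k, P f -> P (addvar f)`_k) -> (forall f, P f -> chi f = 0) ->
  forall f, P f -> f = 0.
Proof.
move=> Pvar Pchi f Pf; apply: evalN_inj => N; rewrite raddf0.
elim: N f Pf => [|N IHN] f Pf.
  by rewrite [LHS]mpoly0E; move: (Pchi f Pf); rewrite unlock => ->.
apply: muni_inj; rewrite addvarP raddf0; apply/polyP => k.
by rewrite coef_map coef0; apply/IHN/Pvar.
Qed.

Lemma Gamma_torsion (n : nat) (f : Gamma) : f *+ n.+1 = 0 -> f = 0.
Proof.
move=> nf; apply: evalN_inj => N; apply/mpolyP => k.
have := congr1 (fun g => (evalN N g)@_k) nf.
rewrite raddfMn mcoeffMn raddf0 mcoeff0 => /eqP; rewrite mulrn_eq0 /= => /eqP.
by [].
Qed.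

(** The properties of Gamma on which the operator calculus rests: generators q_n,
    the morphism f |-> f(X, w) given on them by the factor (1 + wu) / (1 - wu), the
    constant term, and the principle [sk_eq0] that these detect 0. *)
Record skewRing := SkewRing {
  sk_ring :> comNzRingType;
  sk_q : int -> sk_ring;
  sk_addvar : {rmorphism sk_ring -> {poly sk_ring}};
  sk_chi : {rmorphism sk_ring -> int};
  sk_q0 : sk_q 0 = 1;
  sk_q_lt0 : forall n, n < 0 -> sk_q n = 0;
  sk_addvar_q : forall n : int,
    sk_addvar (sk_q n) - 'X * sk_addvar (sk_q (n - 1)) =
    (sk_q n)%:P + 'X * (sk_q (n - 1))%:P;
  sk_ring_ind : forall P : sk_ring -> Prop,
    P 1 -> (forall f g, P f -> P g -> P (f - g)) ->
    (forall f g, P f -> P g -> P (f * g)) ->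
    (forall n : nat, P (sk_q n)) -> forall f, P f;
  sk_chi_q : forall n : int, sk_chi (sk_q n) = (n == 0)%:R;
  sk_eq0 : forall P : sk_ring -> Prop,
    (forall f k, P f -> P (sk_addvar f)`_k) -> (forall f, P f -> sk_chi f = 0) ->
    forall f, P f -> f = 0;
  sk_torsion : forall (n : nat) (f : sk_ring), f *+ n.+1 = 0 -> f = 0 }.

Arguments sk_q {s}.
Arguments sk_q0 {s}.
Arguments sk_q_lt0 {s} [n].

Definition Gamma_skewRing : skewRing :=
  @SkewRing Gamma qfun addvar chi qfun0 qfun_lt0 addvar_q Gamma_ring_ind chi_q Gamma_eq0 Gamma_torsion.

Lemma int_strong_ind (P : int -> Prop) :
  (forall n, n < 0 -> P n) -> (forall n, (forall k, k < n -> P k) -> P n) -> forall n, P n.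
Proof.
move=> Pneg Pind n; apply: (Pind); case: n => [n|n]; last by move=> k kn; apply: Pneg; lia.
elim: n => [|n IHn] k kn; first by apply: Pneg.
case: (ltrP k n) => [/IHn //|nk]; have -> : k = n by lia.
exact: Pind.
Qed.

(** * Skewing operators *)

Section Skewing.
Variable G : skewRing.
Implicit Types (f g : G) (i j n : int).
Local Notation q := (sk_q : int -> G).
Local Notation addvar := (sk_addvar G).
Local Notation chi := (sk_chi G).

Lemma sk_ind (P : G -> Prop) :
  P 1 -> (forall f g, P f -> P g -> P (f - g)) ->
  (forall n f, P f -> P (q n * f)) -> forall f, P f.
Proof.
move=> P1 PB Pq f.
suff : forall g, P g -> P (f * g) by move=> /(_ 1 P1); rewrite mulr1.
elim/sk_ring_ind: f => [g|f g IHf IHg h Ph|f g IHf IHg h Ph|n g Pg].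
- by rewrite mul1r.
- by rewrite mulrBl; apply: PB; [exact: IHf | exact: IHg].
- by rewrite -mulrA; apply/IHf/IHg.
- exact: Pq.
Qed.

(** The coefficient of w^i in f(X, w); it is the adjoint of multiplication by
    q_i. Integer indices make the shifted recursions below uniform. *)
Definition skew i f : G := if i is Posz k then (addvar f)`_k else 0.

Arguments skew : simpl never.

Lemma skewE (k : nat) f : skew k f = (addvar f)`_k.
Proof. by []. Qed.

Lemma skew_lt0 i f : i < 0 -> skew i f = 0.
Proof. by case: i. Qed.

Lemma skew_zmod i : zmod_morphism (skew i).
Proof. by move=> f g; case: i => k; rewrite /skew ?subr0 // rmorphB coefB. Qed.
HB.instance Definition _ i := GRing.isZmodMorphism.Build G G (skew i) (skew_zmod i).

Lemma skew_ge f i : (size (addvar f))%:Z <= i -> skew i f = 0.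
Proof. by case: i => k // ?; apply: nth_default. Qed.

Lemma skew_1 i : skew i 1 = (i == 0)%:R.
Proof. by case: i => [k|k] //; rewrite skewE rmorph1 coef1. Qed.

Lemma skew_qM i n f : skew i (q n * f) =
  skew (i - 1) (q (n - 1) * f) + (q n * skew i f + q (n - 1) * skew (i - 1) f).
Proof.
apply/eqP; rewrite addrC -subr_eq; apply/eqP.
case: i => [[|i]|i].
- rewrite !(skew_lt0 (i := _ - 1)) // !mulr0 subr0 addr0 !skewE rmorphM coef0M.
  have := congr1 (fun p : {poly _} => p`_0) (sk_addvar_q G n).
  by rewrite coefB coefD !coef0M !coefX !mul0r subr0 addr0 coefC => /= ->.
- have -> : (i.+1%:Z - 1) = i by lia.
  have := congr1 (fun p => (p * addvar f)`_i.+1) (sk_addvar_q G n).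
  rewrite mulrBl mulrDl -!mulrA coefB coefD !coefXM !coefCM /= !skewE => <-.
  by rewrite !rmorphM.
- rewrite !skew_lt0 ?mulr0 ?subr0 ?addr0 //; lia.
Qed.

Lemma skew_q i n : skew i (q n) =
  skew (i - 1) (q (n - 1)) + (q n * (i == 0)%:R + q (n - 1) * (i == 1)%:R).
Proof. by have := skew_qM i n 1; rewrite !mulr1 !skew_1 subr_eq0. Qed.

(** Adding the variables w and w' in either order gives the same result. *)
Lemma skew_skewC i j f : skew i (skew j f) = skew j (skew i f).
Proof.
elim/sk_ind: f i j => [|f g IHf IHg|n f IHf] i j.
- by rewrite !skew_1 !raddfMn /= !skew_1 -!mulrnA mulnC.
- by rewrite !raddfB /= IHf IHg.
elim/int_strong_ind: n i j => [n n0|n IHn] i j; first by rewrite (sk_q_lt0 n0) mul0r !raddf0.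
have E k l : skew k (skew l (q n * f)) =
  skew k (skew (l - 1) (q (n - 1) * f)) + skew (k - 1) (skew l (q (n - 1) * f))
  - skew (k - 1) (skew (l - 1) (q (n - 1 - 1) * f))
  + (q n * skew k (skew l f) + q (n - 1) * skew (k - 1) (skew l f)
  + (q (n - 1) * skew k (skew (l - 1) f) + q (n - 1 - 1) * skew (k - 1) (skew (l - 1) f))).
  have E1 := congr1 (skew (k - 1)) (skew_qM l (n - 1) f); rewrite !raddfD /= in E1.
  have E2 := congr1 (skew k) (skew_qM l n f); rewrite !raddfD /= in E2.
  by rewrite E2 (skew_qM k n) (skew_qM k (n - 1)) E1; ring.
have n1 : n - 1 < n by lia.
have n2 : n - 1 - 1 < n by lia.
have E1 := IHn _ n1 i (j - 1); have E2 := IHn _ n1 (i - 1) j; have E3 := IHn _ n2 (i - 1) (j - 1).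
rewrite (E i j) (E j i) E1 E2 E3 (IHf i j) (IHf (i - 1) j) (IHf i (j - 1)) (IHf (i - 1) (j - 1)).
by ring.
Qed.

Lemma skew0 f : skew 0 f = f.
Proof.
elim/sk_ind: f => [|f g IHf IHg|n f IHf]; first by rewrite skew_1.
- by rewrite raddfB /= IHf IHg.
- by rewrite skew_qM !(skew_lt0 (i := 0 - 1)) // mulr0 addr0 add0r IHf.
Qed.

(** The variables w and -w contribute inverse factors (1 + wu) / (1 - wu) and
    (1 - wu) / (1 + wu), hence nothing. *)
Lemma addvar_cancel f : (map_poly addvar (addvar f)).[-'X] = f%:P.
Proof.
elim/sk_ring_ind: f => [|f g IHf IHg|f g IHf IHg|n].
- by rewrite !rmorph1 hornerC.
- by rewrite !rmorphB !hornerE IHf IHg.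
- by rewrite !rmorphM !hornerE IHf IHg.
elim/int_strong_ind: (n%:Z) => [k k0|k IH]; first by rewrite (sk_q_lt0 k0) !rmorph0 horner0.
have Ak := sk_addvar_q G k.
have := congr1 (fun p => (map_poly addvar p).[-'X]) Ak.
rewrite rmorphB rmorphD !rmorphM /= !map_polyX !map_polyC /= !hornerE (IH (k - 1)); last lia.
by move/eqP; rewrite subr_eq => /eqP ->; move/eqP: Ak; rewrite subr_eq => /eqP ->; ring.
Qed.

Lemma skew_const f : (forall k : nat, skew k.+1 f = 0) -> f = (chi f)%:~R.
Proof.
move=> fc; apply/eqP; rewrite -subr_eq0; apply/eqP.
pose P (g : G) := g = f - (chi f)%:~R \/ g = 0.
apply: (sk_eq0 (P := P)); last by left.
- move=> g k [->|->]; last by right; rewrite rmorph0 coef0.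
  rewrite rmorphB rmorph_int coefB.
  have -> : ((chi f)%:~R : {poly G})`_k = (chi f)%:~R *+ (k == 0)%N.
    by rewrite -polyC1 -raddfMz /= coefC; case: k.
  case: k => [|k]; first by left; rewrite -skewE skew0 mulr1n.
  by right; rewrite -skewE fc subr0.
- by move=> g [->|->]; rewrite ?rmorph0 // rmorphB rmorph_int /= intz subrr.
Qed.

(** The relation q(u) q(-u) = 1: the coefficients of the left side do not see a new
    variable, hence are constants. *)
Lemma sk_q_rel (n : nat) :
  \sum_(i < n.+1) q (n - i)%N * ((-1) ^+ i * q i) = (n == 0%N)%:R.
Proof.
pose q' (k : nat) := (-1) ^+ k * q k.
pose r := convol (fun k : nat => q k) q'.
pose A (k : nat) := addvar (q k); pose A' (k : nat) := addvar (q' k).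
have rE k : addvar (r k) = convol A A' k.
  by rewrite /r /convol rmorph_sum; apply: eq_bigr => i _; rewrite rmorphM.
have AE k : A k + - 'X * delay A k = (q k)%:P + 'X * delay (fun k : nat => (q k)%:P) k.
  case: k => [|k] /=; last by have := sk_addvar_q G k.+1; rewrite mulNr subzSS subr0.
  by rewrite /A sk_q0 rmorph1 !mulr0.
have A'E k : A' k + 'X * delay A' k = (q' k)%:P + - 'X * delay (fun k : nat => (q' k)%:P) k.
  case: k => [|k] /=; first by rewrite /A' /q' sk_q0 expr0 mul1r rmorph1 !mulr0.
  have := sk_addvar_q G k.+1; rewrite subzSS subr0 /A' /q' exprS => E.
  rewrite !(rmorphM, rmorphXn, rmorphN1) /=.
  by move/eqP: E; rewrite subr_eq => /eqP ->; ring.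
have linE (B B' : nat -> {poly G}) c k : c ^+ 2 = 'X ^+ 2 ->
    convol (fun k => B k + - c * delay B k) (fun k => B' k + c * delay B' k) k =
    convol B B' k - 'X ^+ 2 * delay (delay (convol B B')) k.
  move=> c2; rewrite convol_linl !convol_linr convol_delayl !convol_delayr.
  have -> : delay (convol (delay B) B') k = delay (delay (convol B B')) k.
    by case: k => //= k; rewrite convol_delayl.
  by rewrite -c2; ring.
have main k : addvar (r k) - 'X ^+ 2 * delay (delay (convol A A')) k =
    (r k)%:P - 'X ^+ 2 * delay (delay (fun k => (r k)%:P)) k.
  rewrite rE -(linE _ _ 'X) // (eq_convol _ AE A'E).
  have -> : (r k)%:P = convol (fun k : nat => (q k)%:P) (fun k => (q' k)%:P) k.
    by rewrite /r /convol rmorph_sum; apply: eq_bigr => i _; rewrite rmorphM.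
  have -> : delay (delay (fun k => (r k)%:P)) k = delay (delay (convol (fun k : nat => (q k)%:P) (fun k => (q' k)%:P))) k.
    case: k => [|[|k]] //=.
    by rewrite /r /convol rmorph_sum; apply: eq_bigr => i _; rewrite rmorphM.
  rewrite -(linE _ _ (- 'X)) ?sqrrN //.
  by apply: eq_convol => l; rewrite ?opprK.
have rC k : addvar (r k) = (r k)%:P.
  elim/ltn_ind: k => k IHk; apply: (addIr (- ('X ^+ 2 * delay (delay (convol A A')) k))).
  rewrite main; congr (_ - _ * _); case: k IHk => [|[|k]] //= IHk.
  by rewrite -rE IHk.
change (r n = (n == 0%N)%:R).
rewrite [LHS]skew_const => [|k]; last by rewrite skewE rC coefC.
rewrite /r /convol rmorph_sum /= (eq_bigr (fun i : 'I_n.+1 => (n == val i)%:R * (val i == 0%N)%:R)).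
  rewrite (bigD1 ord0) //= big1 ?addr0 ?mulr1 ?rmorph_nat //.
  by move=> i; rewrite -val_eqE /= => /negbTE ->; rewrite mulr0.
move=> i _; rewrite /q' !rmorphM !sk_chi_q rmorphXn rmorphN1 /=.
rewrite eqz_nat; case: (val i =P 0%N) => [->|/eqP i0]; first by rewrite subn0 expr0 mul1r.
by rewrite eqz_nat (negbTE i0) !mulr0.
Qed.

(** The derivation obtained by varying w in f(X, w, -w') at w' = w.  Up to scalars
    its coefficients are the adjoints of the odd power sums; they separate the elements
    of Gamma up to constants and act on the B_n by a shift of the index, which makes
    them suited to identities between words in the B_n. *)
Definition dpoly f : {poly G} := ((map_poly addvar (addvar f))^`()).[-'X].
Definition pder (k : nat) f : G := (dpoly f)`_k.

Lemma dpoly_zmod : zmod_morphism dpoly.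
Proof. by move=> f g; rewrite /dpoly !rmorphB derivB !hornerE. Qed.
HB.instance Definition _ := GRing.isZmodMorphism.Build G {poly G} dpoly dpoly_zmod.

Lemma pder_zmod k : zmod_morphism (pder k).
Proof. by move=> f g; rewrite /pder raddfB coefB. Qed.
HB.instance Definition _ k := GRing.isZmodMorphism.Build G G (pder k) (pder_zmod k).

Lemma dpolyM f g : dpoly (f * g) = dpoly f * g%:P + f%:P * dpoly g.
Proof. by rewrite /dpoly !rmorphM derivM !hornerE !addvar_cancel. Qed.

Lemma pderM k f g : pder k (f * g) = pder k f * g + f * pder k g.
Proof. by rewrite /pder dpolyM coefD coefMC coefCM. Qed.

Lemma dpoly_q1 n :
  dpoly (q n) = - ('X * dpoly (q (n - 1))) + addvar (q (n - 1)) + (q (n - 1))%:P.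
Proof.
have := congr1 (fun p => ((map_poly addvar p)^`()).[-'X]) (sk_addvar_q G n).
rewrite rmorphB rmorphD !rmorphM /= !map_polyX !map_polyC /= derivB derivD !derivM derivX !derivC.
rewrite !hornerE !addvar_cancel -!/(dpoly _) => E.
by move/eqP: E; rewrite subr_eq => /eqP ->; ring.
Qed.

Lemma dpoly_q n : dpoly (q n) = 'X ^+ 2 * dpoly (q (n - 1 - 1)) + (q (n - 1))%:P *+ 2.
Proof.
have := sk_addvar_q G (n - 1) => /eqP; rewrite subr_eq => /eqP E.
by rewrite dpoly_q1 (dpoly_q1 (n - 1)) E; ring.
Qed.

Lemma pder_q k n : pder k (q n) = q (n - k.+1%:Z) *+ (~~ odd k).*2.
Proof.
have [m] := ubnP k; elim: m k n => // m IHm [|[|k]] n km; rewrite /pder dpoly_q coefD coefXnM /=.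
- by rewrite add0r coefMn coefC.
- by rewrite add0r coefMn coefC /= mul0rn mulr0n.
- rewrite coefMn coefC /= mul0rn addr0 subSS subSS subn0 -/(pder _ _) IHm ?negbK; last by lia.
  by congr (q _ *+ _); lia.
Qed.

Lemma pder_skewC k j f : pder k (skew j f) = skew j (pder k f).
Proof.
elim/sk_ind: f j => [|f g IHf IHg|n f IHf] j.
- have pder1 : pder k 1 = 0.
    by have := pderM k 1 1; rewrite !mulr1 mul1r => E; apply: (addrI (pder k 1)); rewrite -E addr0.
  by rewrite skew_1 raddfMn /= pder1 mul0rn raddf0.
- by rewrite !raddfB /= IHf IHg.
elim/int_strong_ind: n j => [n n0|n IHn] j; first by rewrite (sk_q_lt0 n0) mul0r !raddf0.
have IH1 : pder k (skew (j - 1) (q (n - 1) * f)) = skew (j - 1) (pder k (q (n - 1) * f)).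
  by apply: IHn; lia.
rewrite skew_qM !raddfD /= IH1 !pderM !pder_q !IHf.
rewrite !raddfD /= (skew_qM j n) !mulrnAl !raddfMn /= (skew_qM j (n - k.+1%:Z)).
have -> : n - 1 - k.+1%:Z = n - k.+1%:Z - 1 by lia.
by ring.
Qed.

(** Once skew 1 f, ..., skew n f vanish, the coefficient n of [dpoly f] is, up to sign,
    (n + 1) times skew (n + 1) f, and there is no torsion. *)
Lemma pder_const f : (forall k, pder k f = 0) -> f = (chi f)%:~R.
Proof.
move=> fc; apply: skew_const; elim/ltn_ind => n IHn.
have := fc n; rewrite /pder /dpoly.
set g := map_poly _ _; pose m := maxn n.+1 (size g^`()).
have nm : (n < m)%N by rewrite leq_max leqnn.
rewrite (horner_coef_wide (n := m)) ?leq_maxr // coef_sum (bigD1 (Ordinal nm)) //=.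
have gE (i : nat) : g^`()`_i = addvar (skew i.+1 f) *+ i.+1 by rewrite coef_deriv coef_map.
rewrite big1 => [|i]; last first.
  rewrite -val_eqE /= gE (exprNn 'X) mulrA coefMXn; case: ltngtP => //= iltn _.
  by rewrite IHn // raddf0 mul0rn mul0r coef0.
rewrite addr0 gE (exprNn 'X) mulrA coefMXn ltnn subnn -signr_odd.
have E h : (addvar h *+ n.+1)`_0 = h *+ n.+1 by rewrite coefMn -skewE skew0.
case: (odd n); rewrite ?expr1 ?mulrN1 ?expr0 ?mulr1 ?coefN E => /eqP; rewrite ?oppr_eq0 => /eqP.
all: exact: sk_torsion.
Qed.

End Skewing.
Arguments skew {G} i f : simpl never.
Arguments pder {G} k f : simpl never.

(** * Vertex operators and the Clifford relations *)

Section IntSign.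
Variable R : nzRingType.
Implicit Types a b : int.

Definition isign a : R := (-1) ^+ absz a.

Lemma isignE a : isign a = if odd (absz a) then -1 else 1.
Proof. by rewrite /isign -signr_odd; case: (odd _). Qed.

Lemma isignD a b : isign (a + b) = isign a * isign b.
Proof.
rewrite !isignE; have -> : odd (absz (a + b)) = odd (absz a) (+) odd (absz b) by lia.
by case: (odd _); case: (odd _); rewrite /= ?mul1r ?mulr1 ?mulN1r ?opprK.
Qed.

Lemma isignN a : isign (- a) = isign a.
Proof. by rewrite /isign abszN. Qed.

Lemma isign_nat (n : nat) : isign n = (-1) ^+ n.
Proof. by []. Qed.

Lemma isignB a b : isign (a - b) = isign a * isign b.
Proof. by rewrite isignD isignN. Qed.

Lemma isign1 : isign 1 = -1.
Proof. by rewrite isignE. Qed.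

Lemma isign_odd (n : nat) : odd n -> isign n = -1.
Proof. by rewrite isignE absz_nat => ->. Qed.

Lemma isign_sq a : isign a * isign a = 1.
Proof. by rewrite isignE; case: (odd _); rewrite ?mulr1 ?mulN1r ?opprK. Qed.

End IntSign.

(** For m odd, (1 + (uv)^m) / (1 - (uv)^m) is the product of the factors
    (1 + xuv) / (1 - xuv) over the m-th roots of unity x.  The series sum z_n u^(mn)
    and sum E_n u^(mn) stand for the products of the q(xu) and of the q(xu)^perp, but
    the roots of unity are avoided: only the exchange relations with the
    skewing operators and with the q_k, which have this multiplier, are recorded. *)
Record vertexPair (G : skewRing) := VertexPair {
  vp_m : nat;
  vp_z : int -> G;
  vp_E : int -> {additive G -> G};
  vp_odd : odd vp_m;
  vp_z_lt0 : forall n, n < 0 -> vp_z n = 0;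
  vp_E_lt0 : forall n f, n < 0 -> vp_E n f = 0;
  vp_bound : forall f, exists N : nat, forall n : int, N%:Z <= n -> vp_E n f = 0;
  vp_comm : forall i j f, vp_E i (skew j f) = skew j (vp_E i f);
  vp_Eq : forall i k f, vp_E i (sk_q k * f) =
    vp_E (i - 1) (sk_q (k - vp_m%:Z) * f)
    + (sk_q k * vp_E i f + sk_q (k - vp_m%:Z) * vp_E (i - 1) f);
  vp_Dz : forall k n f, skew k (vp_z n * f) =
    skew (k - vp_m%:Z) (vp_z (n - 1) * f)
    + (vp_z n * skew k f + vp_z (n - 1) * skew (k - vp_m%:Z) f) }.

Section VertexOperators.
Variable G : skewRing.
Implicit Types (f g : G) (P : vertexPair G).
Local Notation q := (sk_q : int -> G).

Definition vop P (n : int) f : G :=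
  \sum_(i \in [set: nat]) (-1) ^+ i * vp_z P (n + i%:Z) * vp_E P i f.

Lemma vopE P n f (N : nat) : (forall k : int, N%:Z <= k -> vp_E P k f = 0) ->
  vop P n f = \sum_(i < N) (-1) ^+ i * vp_z P (n + i%:Z) * vp_E P i f.
Proof.
move=> fN; rewrite /vop -(big_mkord xpredT (fun i => (-1) ^+ i * vp_z P (n + i%:Z) * vp_E P i f)).
rewrite (fsbigE (iota 0 N)) ?iota_uniq //; last first.
  by move=> i _; rewrite mem_iota /= add0n -leqNgt => Ni; rewrite fN ?mulr0.
by rewrite /index_iota subn0; apply: eq_bigl => i; rewrite in_setT.
Qed.

Lemma vop_zmod P n : zmod_morphism (vop P n).
Proof.
move=> f g; have [N fN] := vp_bound P f; have [M gM] := vp_bound P g.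
rewrite !(@vopE P n _ (maxn N M)) => [|k Nk|k Nk|k Nk]; first last.
- by rewrite raddfB fN ?gM ?subr0 //; lia.
- by apply: fN; lia.
- by apply: gM; lia.
rewrite -sumrB; apply: eq_bigr => i _; by rewrite raddfB mulrBr.
Qed.
HB.instance Definition _ P n := GRing.isZmodMorphism.Build G G (vop P n) (vop_zmod P n).

Lemma vop_shift P n (d N : nat) f : (forall k : int, N%:Z <= k -> vp_E P k f = 0) ->
  \sum_(i < d + N) (-1) ^+ i * vp_z P (n + i%:Z) * vp_E P (i%:Z - d%:Z) f =
  (-1) ^+ d * vop P (n + d%:Z) f.
Proof.
move=> fN; rewrite big_split_ord /= big1 ?add0r => [|i _]; last first.
  by rewrite vp_E_lt0 ?mulr0 //; move: (ltn_ord i); lia.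
rewrite (vopE _ fN) mulr_sumr; apply: eq_bigr => i _.
rewrite exprD -!mulrA; congr (_ * (_ * (vp_z _ _ * vp_E _ _ _))); lia.
Qed.

Lemma skew_vop P k n f : skew k (vop P n f) =
  skew (k - (vp_m P)%:Z) (vop P (n - 1) f) + (vop P n (skew k f) + vop P (n - 1) (skew (k - (vp_m P)%:Z) f)).
Proof.
have [N fN] := vp_bound P f.
have fN' j : forall k : int, N%:Z <= k -> vp_E P k (skew j f) = 0.
  by move=> i Ni; rewrite vp_comm fN ?raddf0.
rewrite !(vopE _ fN) !(vopE _ (fN' _)) !raddf_sum -!big_split; apply: eq_bigr => i _ /=.
have sg h j : skew j ((-1) ^+ i * h) = (-1) ^+ i * skew j h.
  by rewrite -signr_odd; case: (odd i); rewrite ?expr0 ?expr1 ?mulN1r ?mul1r ?raddfN.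
rewrite -!mulrA !sg !vp_comm vp_Dz -!mulrDr.
by have -> : n + i%:Z - 1 = n - 1 + i%:Z by lia.
Qed.

Lemma vop_qM P n k f : vop P n (q k * f) =
  - vop P (n + 1) (q (k - (vp_m P)%:Z) * f)
  + (q k * vop P n f - q (k - (vp_m P)%:Z) * vop P (n + 1) f).
Proof.
set k' := k - _.
have [N0 H0] := vp_bound P f; have [N1 H1] := vp_bound P (q k' * f).
have [N2 H2] := vp_bound P (q k * f).
pose N := (N0 + N1 + N2)%N.
have s0 := @vop_shift P n 1 N f; have s1 := @vop_shift P n 1 N (q k' * f).
rewrite expr1 in s0 s1.
rewrite (@vopE P n _ (1 + N)) => [|l Nl]; last by apply: H2; lia.
rewrite (eq_bigr (fun i : 'I_(1 + N) => (-1) ^+ i * vp_z P (n + i%:Z) * vp_E P (i%:Z - 1%:Z) (q k' * f) +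
  (q k * ((-1) ^+ i * vp_z P (n + i%:Z) * vp_E P i f) + q k' * ((-1) ^+ i * vp_z P (n + i%:Z) * vp_E P (i%:Z - 1%:Z) f)))); last first.
  by move=> i _; rewrite vp_Eq -/k'; ring.
rewrite !big_split /= -!mulr_sumr s0; last by move=> l Nl; apply: H0; lia.
rewrite s1; last by move=> l Nl; apply: H1; lia.
rewrite -vopE; last by move=> l Nl; apply: H0; lia.
by ring.
Qed.

Lemma skew_bound f : exists N : nat, forall n : int, N%:Z <= n -> skew n f = 0.
Proof. by eexists => n; exact: skew_ge. Qed.

Definition std_pair : vertexPair G :=
  @VertexPair G 1 q (fun i => skew i : {additive G -> G}) isT (@sk_q_lt0 G) (fun n f => @skew_lt0 G n f) skew_bound
    (@skew_skewC G) (fun i k => @skew_qM G i k) (fun k n => @skew_qM G k n).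

Definition Bv (n : int) : G -> G := vop std_pair n.

HB.instance Definition _ n := GRing.Additive.on (Bv n).

Lemma Bv_zM P k n f : Bv k (vp_z P n * f) =
  - Bv (k + (vp_m P)%:Z) (vp_z P (n - 1) * f)
  + (vp_z P n * Bv k f - vp_z P (n - 1) * Bv (k + (vp_m P)%:Z) f).
Proof.
have [N0 H0] := skew_bound f; have [N1 H1] := skew_bound (vp_z P (n - 1) * f).
have [N2 H2] := skew_bound (vp_z P n * f).
pose N := (N0 + N1 + N2)%N.
have s0 := @vop_shift std_pair k (vp_m P) N f.
have s1 := @vop_shift std_pair k (vp_m P) N (vp_z P (n - 1) * f).
have sm : (-1) ^+ vp_m P = -1 :> G by rewrite -signr_odd vp_odd.
rewrite {}sm in s0 s1.
rewrite /Bv (@vopE std_pair k _ (vp_m P + N)) => [|l Nl]; last by apply: H2; lia.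
rewrite (eq_bigr (fun i : 'I_(vp_m P + N) => (-1) ^+ i * q (k + i%:Z) * skew (i%:Z - (vp_m P)%:Z) (vp_z P (n - 1) * f) +
  (vp_z P n * ((-1) ^+ i * q (k + i%:Z) * skew i f) + vp_z P (n - 1) * ((-1) ^+ i * q (k + i%:Z) * skew (i%:Z - (vp_m P)%:Z) f)))); last first.
  by move=> i _ /=; rewrite vp_Dz; ring.
rewrite !big_split /= -!mulr_sumr s0; last by move=> l Nl; apply: H0; lia.
rewrite s1; last by move=> l Nl; apply: H1; lia.
rewrite -(vopE (P := std_pair)); last by move=> l Nl; apply: H0; lia.
by ring.
Qed.

(** Let V(u) be the series of the [vop P n] u^(mn).  Up to the expansion of the
    multiplier, V(u) B(v) and - B(v) V(u) are both
    (u^m - v^m) / (u^m + v^m) times the normally ordered product; multiplying by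
    u^m + v^m removes the denominator. *)
Lemma vop_Bv P n k f :
  vop P n (Bv k f) + vop P (n + 1) (Bv (k - (vp_m P)%:Z) f)
  + (Bv k (vop P n f) + Bv (k - (vp_m P)%:Z) (vop P (n + 1) f)) = 0.
Proof.
have [N0 H0] := vp_bound P f; have [N1 H1] := skew_bound f.
pose N := (N0 + N1)%N; set m := vp_m P.
have fE : forall l : int, N%:Z <= l -> vp_E P l f = 0 by move=> l Nl; apply: H0; lia.
have fD : forall l : int, N%:Z <= l -> skew l f = 0 by move=> l Nl; apply: H1; lia.
have fED j : forall l : int, N%:Z <= l -> vp_E P l (skew j f) = 0.
  by move=> l Nl; rewrite vp_comm fE ?raddf0.
have fDE j : forall l : int, N%:Z <= l -> skew l (vp_E P j f) = 0.
  by move=> l Nl; rewrite -vp_comm fD ?raddf0.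
have vsg n' i h : vop P n' ((-1) ^+ i * h) = (-1) ^+ i * vop P n' h.
  by rewrite -signr_odd; case: (odd i); rewrite ?expr0 ?expr1 ?mulN1r ?mul1r ?raddfN.
have Bsg n' i h : Bv n' ((-1) ^+ i * h) = (-1) ^+ i * Bv n' h.
  by rewrite -signr_odd; case: (odd i); rewrite ?expr0 ?expr1 ?mulN1r ?mul1r ?raddfN.
have E1 : vop P n (Bv k f) + vop P (n + 1) (Bv (k - m%:Z) f) =
  \sum_(j < N) (-1) ^+ j * (q (k + j%:Z) * vop P n (skew j f))
  - \sum_(j < N) (-1) ^+ j * (q (k - m%:Z + j%:Z) * vop P (n + 1) (skew j f)).
  rewrite /Bv !(vopE (P := std_pair) _ fD) /= !raddf_sum /= -!big_split /=.
  apply: eq_bigr => j _; rewrite -!mulrA !vsg.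
  rewrite vop_qM -/m; have -> : k + j%:Z - m%:Z = k - m%:Z + j%:Z by lia.
  by ring.
have E2 : Bv k (vop P n f) + Bv (k - m%:Z) (vop P (n + 1) f) =
  \sum_(i < N) (-1) ^+ i * (vp_z P (n + 1 + i%:Z) * Bv (k - m%:Z) (vp_E P i f))
  - \sum_(i < N) (-1) ^+ i * (vp_z P (n + i%:Z) * Bv k (vp_E P i f)).
  rewrite !(vopE _ fE) /= !raddf_sum /= -!big_split /=.
  apply: eq_bigr => i _; rewrite -!mulrA !Bsg.
  rewrite (Bv_zM P (k - m%:Z)) -/m; have -> : k - m%:Z + m%:Z = k by lia.
  have -> : n + 1 + i%:Z - 1 = n + i%:Z by lia.
  by ring.
have E3 k' n' : \sum_(j < N) (-1) ^+ j * (q (k' + j%:Z) * vop P n' (skew j f)) =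
  \sum_(i < N) (-1) ^+ i * (vp_z P (n' + i%:Z) * Bv k' (vp_E P i f)).
  under eq_bigr => j _ do rewrite (vopE _ (fED _)) 2!mulr_sumr.
  rewrite exchange_big /=; apply: eq_bigr => i _.
  rewrite /Bv (vopE (P := std_pair) _ (fDE _)) 2!mulr_sumr; apply: eq_bigr => j _ /=.
  by rewrite vp_comm; ring.
by rewrite E1 E2 !E3; ring.
Qed.

Lemma skew_Bv k n f :
  skew k (Bv n f) = skew (k - 1) (Bv (n - 1) f) + (Bv n (skew k f) + Bv (n - 1) (skew (k - 1) f)).
Proof. exact: (skew_vop std_pair). Qed.

Lemma Bv_qM n k f :
  Bv n (q k * f) = - Bv (n + 1) (q (k - 1) * f) + (q k * Bv n f - q (k - 1) * Bv (n + 1) f).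
Proof. exact: (vop_qM std_pair). Qed.

Lemma BvE n f (N : nat) : (forall k : int, N%:Z <= k -> skew k f = 0) ->
  Bv n f = \sum_(i < N) (-1) ^+ i * q (n + i%:Z) * skew i f.
Proof. exact: (vopE (P := std_pair)). Qed.

Lemma Bv_1 n : Bv n 1 = q n.
Proof.
rewrite (@BvE _ _ 1) => [|k k1]; last by rewrite skew_1; case: eqP => //; lia.
by rewrite big_ord1 expr0 mul1r skew_1 addr0 mulr1.
Qed.

Lemma Bv_low f : exists e : nat, forall k : int, k < - e%:Z -> Bv k f = 0.
Proof.
have [N fN] := skew_bound f; exists N => k kN; rewrite (BvE _ fN) big1 // => i _.
by rewrite sk_q_lt0 ?mulr0 ?mul0r //; move: (ltn_ord i); lia.
Qed.

Lemma chi_Bv n f : 0 <= n -> sk_chi G (Bv n f) = (if n == 0 then sk_chi G f else 0).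
Proof.
move=> n0; have [N fN] := skew_bound f.
have fN1 : forall k : int, N.+1%:Z <= k -> skew k f = 0 by move=> k Nk; apply: fN; lia.
rewrite (BvE _ fN1) big_ord_recl rmorphD rmorph_sum big1 => [|i _]; last first.
  by rewrite !rmorphM sk_chi_q lift0; case: eqP => [|_]; [lia | rewrite mulr0 mul0r].
rewrite expr0 mul1r addr0 skew0 rmorphM sk_chi_q addr0; case: eqP => _; by rewrite ?mul1r ?mul0r.
Qed.

Inductive Bspan : G -> Prop :=
| Bspan_one : Bspan 1
| Bspan_sub f g : Bspan f -> Bspan g -> Bspan (f - g)
| Bspan_op n f : Bspan f -> Bspan (Bv n f).

(** The exchange relation of q_k with B_n lets q_k move to the right through a word in
    the B_n, at the cost of terms with smaller k. *)
Lemma Bspan_q k f : Bspan f -> Bspan (q k * f).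
Proof.
have Bspan_0 : Bspan 0 by rewrite -(subrr 1); apply: Bspan_sub; exact: Bspan_one.
have Bspan_add g h : Bspan g -> Bspan h -> Bspan (g + h).
  by move=> Bg Bh; rewrite -[h]opprK -[- h]sub0r; do !apply: Bspan_sub => //.
move=> Bf; elim: Bf k => [|g h _ IHg _ IHh|n g Bg IHg] k.
- by rewrite mulr1 -Bv_1; do 2!constructor.
- by rewrite mulrBr; apply: Bspan_sub.
- elim/int_strong_ind: k n => [k k0|k IHk] n; first by rewrite sk_q_lt0 ?mul0r.
  have -> : q k * Bv n g = Bv n (q k * g) + Bv (n + 1) (q (k - 1) * g) + q (k - 1) * Bv (n + 1) g.
    by rewrite Bv_qM; ring.
  apply: (Bspan_add); last by apply: IHk; lia.
  by apply: Bspan_add; apply: Bspan_op; exact: IHg.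
Qed.

Lemma Bv_ind (P : G -> Prop) :
  P 1 -> (forall f g, P f -> P g -> P (f - g)) ->
  (forall n f, P f -> P (Bv n f)) -> forall f, P f.
Proof.
move=> P1 PB PO f; have : Bspan f.
  by elim/sk_ind: f => [|f g|n f]; [constructor | exact: Bspan_sub | exact: Bspan_q].
by elim=> // *; auto.
Qed.

Definition clif (a b : int) : int := if a + b == 0 then isign int a *+ 2 else 0.

Lemma clif_shift a b : clif (a + 1) (b - 1) = - clif a b.
Proof.
rewrite /clif; have -> : a + 1 + (b - 1) = a + b by lia.
by case: eqP => _; rewrite ?oppr0 // isignD isign1 mulrN1 mulNrn.
Qed.

Lemma clifC a b : clif a b = clif b a.
Proof.
rewrite /clif (addrC b a); case: eqP => // ab.
have -> : b = - a by lia.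
by rewrite isignN.
Qed.

Lemma skew_qS (i : nat) n : skew i.+1 (q n) = q (n - i.+1%:Z) *+ 2.
Proof.
elim: i n => [|i IHi] n; rewrite skew_q.
  have -> : 1%N%:Z - 1 = 0 by [].
  by rewrite skew0 mulr0 mulr1 add0r mulr2n.
have -> : i.+2%:Z - 1 = i.+1%:Z by lia.
rewrite IHi /= !mulr0 !addr0; have -> // : n - 1 - i.+1%:Z = n - i.+2%:Z by lia.
Qed.

(** Beyond the constant coefficient [skew i] q_a is 2 q_(a-i), so that for b < 0 the
    sum defining B_b q_a is a part of the relation q(u) q(-u) = 1. *)
Lemma Bv_q_neg a b : b < 0 -> Bv b (q a) = 1 *~ clif a b.
Proof.
move=> b0; case: (ltrP a 0) => a0.
  by rewrite sk_q_lt0 // raddf0 /clif; case: eqP => //; lia.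
case: a a0 => // a _.
have bnd : forall k : int, a.+1%:Z <= k -> skew k (q a) = 0.
  case=> [[|k]|k] ak //; rewrite skew_qS sk_q_lt0 ?mul0rn //; lia.
rewrite (BvE _ bnd).
have E (i : nat) : (-1) ^+ i * q (b + i%:Z) * skew i (q a) = ((-1) ^+ i * q (b + i%:Z) * q (a%:Z - i%:Z)) *+ 2.
  case: i => [|i]; first by rewrite addr0 sk_q_lt0 // !mulr0 !mul0r mul0rn.
  by rewrite skew_qS mulrnAr.
under eq_bigr => i _ do rewrite E.
rewrite sumrMnl.
case: (ltrP (a%:Z + b) 0) => ab.
  rewrite big1 ?mul0rn => [|i _]; last by rewrite sk_q_lt0 ?mulr0 ?mul0r //; move: (ltn_ord i); lia.
  by rewrite /clif; case: eqP => //; lia.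
pose c := absz b; pose s := absz (a%:Z + b).
have as_ : a.+1 = (c + s.+1)%N by rewrite /c /s; lia.
rewrite as_ big_split_ord /= big1 ?add0r => [|i _]; last first.
  by rewrite sk_q_lt0 ?mulr0 ?mul0r //; move: (ltn_ord i); rewrite /c; lia.
have F : \sum_(i < s.+1) q (s - i)%N * ((-1) ^+ i * q i) = (s == 0%N)%:R := sk_q_rel G s.
have -> : \sum_(i < s.+1) (-1) ^+ (c + i) * q (b + (c + i)%N%:Z) * q (a%:Z - (c + i)%N%:Z) =
   (-1) ^+ c * (s == 0%N)%:R.
  rewrite -F mulr_sumr; apply: eq_bigr => i _; rewrite exprD.
  have -> : b + (c + i)%N%:Z = i%:Z by rewrite /c; lia.
  have -> : a%:Z - (c + i)%N%:Z = (s - i)%N%:Z by move: (ltn_ord i); rewrite /c /s; lia.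
  by ring.
rewrite /clif; have -> : (a%:Z + b == 0) = (s == 0%N) by rewrite /s; lia.
case: (s =P 0%N) => [s0|_]; last by rewrite mulr0 mul0rn mulr0z.
have -> : isign int a = (-1) ^+ c by have <- : - b = a by [rewrite /s in s0; lia]; rewrite isignN.
rewrite mulr1 -[in LHS]signr_odd -[in RHS]signr_odd; case: (odd c); rewrite ?expr0 ?expr1 //.
by rewrite !mulNrn mulrNz.
Qed.

(** The exchange relation for m = 1 says that the anticommutators of B_a, B_b and of
    B_(a+1), B_(b-1) are opposite; so for each value of a + b the case b < 0 suffices. *)
Lemma cliff_extend f : (forall a b, b < 0 -> Bv a (Bv b f) + Bv b (Bv a f) = f *~ clif a b) ->
  forall a b, Bv a (Bv b f) + Bv b (Bv a f) = f *~ clif a b.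
Proof.
move=> H a b; elim/int_strong_ind: b a => [b b0|b IHb] a; first exact: H.
have b1 : b - 1 < b by lia.
have := vop_Bv std_pair a b f; rewrite -!/(Bv _) => E.
have := IHb _ b1 (a + 1); rewrite clif_shift mulrNz => E'.
apply/eqP; rewrite -subr_eq0 -[f *~ _]opprK -E' -[X in _ == X]E.
by apply/eqP; rewrite opprK; ring.
Qed.

(** On 1 the value is known for b < 0.  For q_k f the exchange relations express the
    anticommutator by those on f, on q_(k-1) f and on q_(k-2) f. *)
Lemma cliff a b f : Bv a (Bv b f) + Bv b (Bv a f) = f *~ clif a b.
Proof.
elim/sk_ind: f a b => [|f g IHf IHg|k f IHf] a b.
- apply: cliff_extend => {}a {}b b0.
  by rewrite !Bv_1 (sk_q_lt0 b0) raddf0 add0r Bv_q_neg.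
- by rewrite !raddfB /= mulrzBl -IHf -IHg; ring.
elim/int_strong_ind: k a b => [k k0|k IHk] a b.
  by rewrite sk_q_lt0 // mul0r !raddf0 addr0 mul0rz.
have X c d : Bv c (Bv d (q k * f)) = - Bv c (Bv (d + 1) (q (k - 1) * f))
   - Bv (c + 1) (Bv d (q (k - 1) * f)) - Bv (c + 1) (Bv (d + 1) (q (k - 1 - 1) * f))
   + (q k * Bv c (Bv d f) - q (k - 1) * Bv (c + 1) (Bv d f)
      - q (k - 1) * Bv c (Bv (d + 1) f) + q (k - 1 - 1) * Bv (c + 1) (Bv (d + 1) f)).
  rewrite (Bv_qM d k) raddfD raddfN raddfB /= (Bv_qM c k) (Bv_qM c (k - 1)).
  have E := congr1 (Bv (c + 1)) (Bv_qM d (k - 1) f); rewrite raddfD raddfN raddfB /= in E.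
  have {}E : Bv (c + 1) (q (k - 1) * Bv d f) = Bv (c + 1) (Bv d (q (k - 1) * f))
    + Bv (c + 1) (Bv (d + 1) (q (k - 1 - 1) * f)) + Bv (c + 1) (q (k - 1 - 1) * Bv (d + 1) f).
    by rewrite E; ring.
  by rewrite E; ring.
have k2 : k - 1 - 1 < k by lia.
have k1 : k - 1 < k by lia.
have cs : clif (a + 1) b = - clif a (b + 1) by rewrite -clif_shift addrK.
have cs2 : clif (a + 1) (b + 1) = clif (a + 1) (b + 1) by [].
have X1 := X a b; have X2 := X b a.
have H0 := IHk _ k2 (a + 1) (b + 1); have H1 := IHk _ k1 a (b + 1).
have H2 := IHk _ k1 (a + 1) b; have H3 := IHf a b; have H4 := IHf (a + 1) b.
have H5 := IHf a (b + 1); have H6 := IHf (a + 1) (b + 1).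
rewrite -mulrzr cs rmorphN /= in H2; rewrite -mulrzr in H0; rewrite -mulrzr in H1.
rewrite -mulrzr cs rmorphN /= in H4; rewrite -mulrzr in H3; rewrite -mulrzr in H5.
rewrite -mulrzr in H6; rewrite -mulrzr.
move: X1 X2 H0 H1 H2 H3 H4 H5 H6; clear.
(* with the values of the operators generalised, only a linear identity over G is left *)
repeat match goal with |- context [Bv ?c ?x] => generalize (Bv c x); intro end.
move: (clif _ _)%:~R (clif _ _)%:~R (clif _ _)%:~R => c1 c2 c3.
have solve_r (x y r : G) : x + y = r -> y = r - x by move=> <-; ring.
move=> -> -> /solve_r -> /solve_r -> /solve_r -> /solve_r -> /solve_r -> /solve_r -> /solve_r ->.
by ring.
Qed.

End VertexOperators.
Arguments Bv {G} n f.
Arguments std_pair {G}.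

(** * Words in the B_n and Pfaffians *)

Section Laplace.
Variable R : comNzRingType.
Implicit Types (F : int -> R) (g h : seq int -> R) (L M : seq int) (n : int).

(** Expansion along a row: the alternating sum of F x * g (L without x) over the
    entries x of L, first sign +. *)
Fixpoint lap F g L : R :=
  if L is x :: L' then F x * g L' - lap F (fun M => g (x :: M)) L' else 0.

(** The action on g of a derivation which lowers the index of each letter by n. *)
Fixpoint shiftsum n g L : R :=
  if L is x :: L' then g (x - n :: L') + shiftsum n (fun M => g (x :: M)) L' else 0.

Lemma eq_lap F F' g h L : (forall x, F x = F' x) -> (forall M, g M = h M) -> lap F g L = lap F' h L.
Proof.
by move=> EF; elim: L g h => //= x L IHL g h Eg; rewrite EF Eg (IHL _ (fun M => h (x :: M))).
Qed.

Lemma lap0 F g L : (forall x, F x = 0) -> lap F g L = 0.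
Proof. by move=> F0; elim: L g => //= x L IHL g; rewrite F0 mul0r IHL subr0. Qed.

Lemma lapDl F F' g L : lap (fun x => F x + F' x) g L = lap F g L + lap F' g L.
Proof. by elim: L g => [|x L IHL] g /=; rewrite ?addr0 // IHL; ring. Qed.

Lemma lapDr F g h L : lap F (fun M => g M + h M) L = lap F g L + lap F h L.
Proof. by elim: L g h => [|x L IHL] g h /=; rewrite ?addr0 // IHL; ring. Qed.

Lemma lapMnl F g L k : lap (fun x => F x *+ k) g L = lap F g L *+ k.
Proof. by elim: L g => [|x L IHL] g /=; rewrite ?mul0rn // IHL mulrnBl mulrnAl. Qed.

Lemma lapMnr F g L k : lap F (fun M => g M *+ k) L = lap F g L *+ k.
Proof. by elim: L g => [|x L IHL] g /=; rewrite ?mul0rn // IHL mulrnBl mulrnAr. Qed.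

Lemma lap_sum F g L : lap F g L =
  \sum_(j < size L) (-1) ^+ j * F (nth 0 L j) * g (take j L ++ drop j.+1 L).
Proof.
elim: L g => [|x L IHL] g /=; first by rewrite big_ord0.
rewrite big_ord_recl /= expr0 mul1r drop0 IHL -sumrN; congr (_ + _).
by apply: eq_bigr => j _; rewrite /bump /= add1n exprS; ring.
Qed.

Lemma eq_shiftsum n g h L :
  (forall M, size M = size L -> \sum_(x <- M) x = \sum_(x <- L) x - n -> g M = h M) ->
  shiftsum n g L = shiftsum n h L.
Proof.
elim: L g h => //= x L IHL g h E; rewrite E //=; last by rewrite !big_cons; lia.
congr (_ + _); apply: IHL => M sM eM; apply: E; first by rewrite /= sM.
by rewrite !big_cons eM addrA.
Qed.

Lemma shiftsumN n g L : shiftsum n (fun M => - g M) L = - shiftsum n g L.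
Proof. by elim: L g => [|x L IHL] g /=; rewrite ?oppr0 // IHL opprD. Qed.

Lemma shiftsumD n g h L : shiftsum n (fun M => g M + h M) L = shiftsum n g L + shiftsum n h L.
Proof. by elim: L g h => [|x L IHL] g h /=; rewrite ?addr0 // IHL; ring. Qed.

Lemma shiftsumM n a g L : shiftsum n (fun M => a * g M) L = a * shiftsum n g L.
Proof. by elim: L g => [|x L IHL] g /=; rewrite ?mulr0 // IHL mulrDr. Qed.

Lemma shiftsum_lap n F g L : shiftsum n (lap F g) L =
  lap (fun x => F (x - n)) g L + lap F (shiftsum n g) L.
Proof.
elim: L g => [|x L IHL] g /=; first by rewrite addr0.
by rewrite shiftsumD shiftsumN shiftsumM IHL lapDr /=; ring.
Qed.

End Laplace.

Lemma rmorph_lap (R S : comNzRingType) (phi : {rmorphism R -> S}) F g L :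
  phi (lap F g L) = lap (fun x => phi (F x)) (fun M => phi (g M)) L.
Proof.
by elim: L g => [|x L IHL] g /=; rewrite ?rmorph0 // rmorphB rmorphM IHL.
Qed.

Section Words.
Variable G : skewRing.
Implicit Types (f g : G) (K L M : seq int).
Local Notation q := (sk_q : int -> G).
Local Notation chi := (sk_chi G).

Definition Xw L : G := foldr Bv 1 L.

(** Homogeneity, with negative indices allowed, so that 0 is the only element of
    negative degree. *)
Inductive hdeg : int -> G -> Prop :=
| hdeg_zero d : hdeg d 0
| hdeg_one : hdeg 0 1
| hdeg_sub d f g : hdeg d f -> hdeg d g -> hdeg d (f - g)
| hdeg_mulq d n f : hdeg d f -> hdeg (d + n) (q n * f).

Lemma hdeg_eq d d' f : hdeg d f -> d = d' -> hdeg d' f.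
Proof. by move=> ? <-. Qed.

Lemma hdeg_lt0 d f : hdeg d f -> d < 0 -> f = 0.
Proof.
elim=> // {d f} => [d f g _ IHf _ IHg d0|d n f _ IHf dn]; first by rewrite IHf ?IHg ?subr0.
case: (ltrP n 0) => n0; first by rewrite sk_q_lt0 ?mul0r.
by rewrite IHf ?mulr0 //; lia.
Qed.

Lemma hdeg_opp d f : hdeg d f -> hdeg d (- f).
Proof. by rewrite -sub0r => ?; apply: hdeg_sub => //; exact: hdeg_zero. Qed.

Lemma hdeg_add d f g : hdeg d f -> hdeg d g -> hdeg d (f + g).
Proof. by move=> ? ?; rewrite -[g]opprK; apply: hdeg_sub => //; exact: hdeg_opp. Qed.

Lemma hdeg_sign d f k : hdeg d f -> hdeg d ((-1) ^+ k * f).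
Proof.
move=> df; rewrite -signr_odd; case: (odd k); rewrite ?expr1 ?expr0 ?mul1r ?mulN1r //.
exact: hdeg_opp.
Qed.

Lemma hdegM a b f g : hdeg a f -> hdeg b g -> hdeg (a + b) (f * g).
Proof.
move=> af bg; elim: af => {a f} [d||d f h _ IHf _ IHh|d n f _ IHf].
- by rewrite mul0r; exact: hdeg_zero.
- by rewrite mul1r add0r.
- by rewrite mulrBl; apply: hdeg_sub.
- by rewrite -mulrA addrAC; apply: hdeg_mulq.
Qed.

Lemma hdeg_skew d f i : hdeg d f -> hdeg (d - i) (skew i f).
Proof.
move=> df; elim: df i => {d f} [d||d f g _ IHf _ IHg|d n f _ IHf] i.
- by rewrite raddf0; exact: hdeg_zero.
- rewrite skew_1; case: eqP => [->|_]; last exact: hdeg_zero.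
  by rewrite subr0; exact: hdeg_one.
- by rewrite raddfB; apply: hdeg_sub.
elim/int_strong_ind: n i => [n n0|n IHn] i.
  by rewrite sk_q_lt0 // mul0r raddf0; exact: hdeg_zero.
rewrite skew_qM; apply: hdeg_add; last apply: hdeg_add.
- by apply: hdeg_eq (IHn (n - 1) _ (i - 1)) _; lia.
- by apply: hdeg_eq (hdeg_mulq n (IHf i)) _; lia.
- by apply: hdeg_eq (hdeg_mulq (n - 1) (IHf (i - 1))) _; lia.
Qed.

Lemma hdeg_Bv d n f : hdeg d f -> hdeg (d + n) (Bv n f).
Proof.
move=> df; have [N fN] := skew_bound f; rewrite (BvE _ fN).
elim/big_ind: _ => [||i _]; [exact: hdeg_zero | exact: hdeg_add |].
rewrite -mulrA; apply: hdeg_sign.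
by apply: hdeg_eq (hdeg_mulq (n + i%:Z) (hdeg_skew i df)) _; lia.
Qed.

Lemma hdeg_Xw L : hdeg (\sum_(x <- L) x) (Xw L).
Proof.
elim: L => [|x L IHL] /=; first by rewrite big_nil; exact: hdeg_one.
by rewrite big_cons addrC; apply: hdeg_Bv.
Qed.

Lemma hdeg_lap a b (F : int -> G) (g : seq int -> G) L :
  (forall x, hdeg (a + x) (F x)) -> (forall M, hdeg (b + \sum_(x <- M) x) (g M)) ->
  hdeg (a + b + \sum_(x <- L) x) (lap F g L).
Proof.
move=> aF; elim: L b g => [|x L IHL] b g bg /=; first exact: hdeg_zero.
rewrite big_cons; apply: hdeg_sub.
  by apply: hdeg_eq (hdegM (aF x) (bg L)) _; ring.
apply: hdeg_eq (IHL (b + x) _ _) _; last by ring.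
by move=> M; apply: hdeg_eq (bg (x :: M)) _; rewrite big_cons; ring.
Qed.

Lemma pder_sign k j f : pder k ((-1) ^+ j * f) = (-1) ^+ j * pder k f.
Proof.
by rewrite -signr_odd; case: (odd j); rewrite ?expr1 ?expr0 ?mul1r ?mulN1r ?raddfN.
Qed.

Lemma pder_1 k : pder k (1 : G) = 0.
Proof.
by have := pderM k (1 : G) 1; rewrite !mulr1 mul1r => E; apply: (addrI (pder k 1)); rewrite -E addr0.
Qed.

Lemma pder_Bv k n f :
  pder k (Bv n f) = Bv n (pder k f) + Bv (n - k.+1%:Z) f *+ (~~ odd k).*2.
Proof.
have [N fN] := skew_bound f.
have fN' : forall i : int, N%:Z <= i -> skew i (pder k f) = 0.
  by move=> i Ni; rewrite -pder_skewC fN ?raddf0.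
rewrite !(BvE _ fN) (BvE _ fN') raddf_sum -sumrMnl -big_split; apply: eq_bigr => i _ /=.
rewrite -!mulrA pder_sign pderM pder_q pder_skewC.
have -> : n + i%:Z - k.+1%:Z = n - k.+1%:Z + i%:Z by lia.
by rewrite mulrDr addrC mulrnAl mulrnAr.
Qed.

Lemma pder_Xw k L : pder k (Xw L) = shiftsum k.+1%:Z Xw L *+ (~~ odd k).*2.
Proof.
elim: L => [|x L IHL] /=; first by rewrite mul0rn pder_1.
rewrite pder_Bv IHL raddfMn addrC -mulrnDl; congr ((_ + _) *+ _).
have gen (g : seq int -> G) M : Bv x (shiftsum k.+1%:Z g M) = shiftsum k.+1%:Z (fun M => Bv x (g M)) M.
  by elim: M g => [|y M IHM] g /=; rewrite ?raddf0 // raddfD /= IHM.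
exact: gen.
Qed.

Lemma pder_lap k (F : int -> G) (g : seq int -> G) L : pder k (lap F g L) =
  lap (fun x => pder k (F x)) g L + lap F (fun M => pder k (g M)) L.
Proof.
elim: L g => [|x L IHL] g /=; first by rewrite raddf0 addr0.
by rewrite raddfB /= pderM IHL; ring.
Qed.

Lemma Bv_word k L f : Bv k (foldr Bv f L) =
  lap (fun x => (clif k x)%:~R) (fun M => foldr Bv f M) L + (-1) ^+ size L * foldr Bv (Bv k f) L.
Proof.
have lapB x M (g : seq int -> G) : Bv x (lap (fun x => (clif k x)%:~R) g M) =
    lap (fun x => (clif k x)%:~R) (fun M => Bv x (g M)) M.
  elim: M g => [|y M IHM] g /=; first by rewrite raddf0.
  by rewrite raddfB /= IHM !mulrzl raddfMz.
have sgB x j h : Bv x ((-1) ^+ j * h) = (-1) ^+ j * Bv x h.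
  by rewrite -signr_odd; case: (odd j); rewrite ?expr0 ?expr1 ?mulN1r ?mul1r ?raddfN.
elim: L => [|x L IHL] /=; first by rewrite expr0 mul1r add0r.
have := cliff k x (foldr Bv f L); rewrite IHL raddfD /= lapB sgB -mulrzl => <-.
by rewrite exprS; ring.
Qed.

Lemma foldr_Bv0 L : foldr Bv (0 : G) L = 0.
Proof. by elim: L => //= x L ->; rewrite raddf0. Qed.

(** The expansion of a Pfaffian.  The derivations [pder] shift the letters of both sides
    in the same way and lower the degree, so that by induction on the degree they kill
    the difference, which is therefore constant; the constant terms are compared by
    moving B_k to the right. *)
Lemma Xw_lap k L : odd (size L) -> Xw (k :: L) = lap (fun x => Xw [:: k; x]) Xw L.
Proof.
have [d] : exists d : nat, k + \sum_(x <- L) x < d%:Z.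
  by exists (absz (k + \sum_(x <- L) x)).+1; lia.
elim: d k L => [|d IHd] k L kL oL; set F := fun x => Xw [:: k; x].
all: have Fh x : hdeg (k + x) (F x) by apply: hdeg_eq (hdeg_Xw _) _; rewrite !big_cons big_nil addr0.
all: have lh : hdeg (k + \sum_(x <- L) x) (lap F Xw L)
  by apply: hdeg_eq (hdeg_lap (b := 0) L Fh _) _; [move=> M; apply: hdeg_eq (hdeg_Xw M) _; rewrite add0r | rewrite addr0].
  by rewrite (hdeg_lt0 lh kL) (hdeg_lt0 (hdeg_Xw (k :: L))) // big_cons.
apply/eqP; rewrite -subr_eq0; apply/eqP; rewrite [LHS]pder_const => [|j].
  suff -> : chi (Xw (k :: L) - lap F Xw L) = 0 by [].
  apply/eqP; rewrite rmorphB subr_eq0 rmorph_lap; apply/eqP.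
  case: (ltrgtP k 0) => k0.
  - rewrite /Xw /= Bv_word Bv_1 sk_q_lt0 // foldr_Bv0 mulr0 addr0 rmorph_lap.
    apply: eq_lap => // x; by rewrite /F /Xw /= Bv_1 Bv_q_neg // clifC.
  - rewrite lap0 => [|x]; first by rewrite /Xw /= chi_Bv ?ltW // gt_eqF.
    by rewrite /F /Xw /= chi_Bv ?ltW // gt_eqF.
  (* for k = 0 the constant term of B_0 f is that of f, and moving B_0 through the odd
     word L changes its sign: twice the expansion equals twice the constant term *)
  - subst k; rewrite /Xw /= chi_Bv // eqxx.
    have E1 : chi (Bv 0 (foldr Bv 1 L)) = chi (foldr Bv 1 L) by rewrite chi_Bv.
    have E2 x : chi (F x) = (x == 0)%:R by rewrite /F /Xw /= chi_Bv // eqxx Bv_1 sk_chi_q.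
    have E3 x : chi (clif 0 x)%:~R = (x == 0)%:R *+ 2.
      by rewrite rmorph_int /= /clif add0r; case: eqP.
    move: E1; rewrite Bv_word Bv_1 sk_q0 rmorphD rmorph_lap (eq_lap L E3 (fun=> erefl)) lapMnl.
    rewrite -signr_odd oL expr1 mulN1r rmorphN (eq_lap L E2 (fun=> erefl)).
    by move: (lap _ _ _) (chi _) => /=; lia.
have -> : pder j (Xw (k :: L) - lap F Xw L) = pder j (Xw (k :: L)) - pder j (lap F Xw L) by exact: raddfB.
rewrite pder_Xw pder_lap [shiftsum _ _ (k :: L)]/=.
rewrite (eq_lap (F' := fun x => (Xw [:: k - j.+1%:Z; x] + Xw [:: k; x - j.+1%:Z]) *+ (~~ odd j).*2) (h := Xw)) //; last first.
  by move=> x; rewrite /F pder_Xw /= addr0.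
rewrite [X in _ - (_ + X)](eq_lap (F' := F) (h := fun M => shiftsum j.+1%:Z Xw M *+ (~~ odd j).*2)) //; last by move=> M; exact: pder_Xw.
rewrite lapMnl lapMnr -mulrnDl -mulrnBl lapDl.
rewrite (@eq_shiftsum _ _ _ (lap F Xw)) => [|M sM eM].
  rewrite shiftsum_lap /= -(IHd (k - j.+1%:Z)) //; last by lia.
  by rewrite /= [X in X *+ _](_ : _ = 0) ?mul0rn //; ring.
by apply: IHd; [rewrite eM; lia | rewrite sM].
Qed.

Lemma Bv_q_nat a (b : nat) : Bv a (q b) =
  q a * q b + 2%:R * \sum_(1 <= i < b.+1) (-1) ^+ i * q (a + i%:Z) * q (b - i)%N.
Proof.
have bnd : forall k : int, b.+1%:Z <= k -> skew k (q b) = 0.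
  case=> [[|k]|k] ak //; rewrite skew_qS sk_q_lt0 ?mul0rn //; lia.
rewrite (BvE _ bnd) big_ord_recl expr0 mul1r addr0 skew0; congr (_ + _).
rewrite big_add1 /= big_mkord mulr_sumr; apply: eq_bigr => i _.
rewrite /bump leq0n add1n skew_qS; have -> : b%:Z - i.+1%:Z = (b - i.+1)%N by move: (ltn_ord i); lia.
by ring.
Qed.

Lemma Xw_pfaffian (x0 : nat) (a : nat -> nat -> G) k s :
  (forall i j, a i j = Xw [:: i%:Z; j%:Z]) -> size s = k.*2 ->
  pfaffian x0 a k s = Xw (map Posz s).
Proof.
move=> aE; elim: k s => [|k IHk] [|x s] // [ss].
rewrite [pfaffian _ _ _ _]/= [map _ _]/= Xw_lap; last by rewrite size_map ss /= odd_double.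
rewrite lap_sum size_map; apply: eq_bigr => j _.
rewrite aE (nth_map x0) // -map_take -map_drop -map_cat -IHk //.
by rewrite size_cat size_take size_drop ltn_ord; move: (ltn_ord j) ss; lia.
Qed.

End Words.
Arguments Xw {G} L.

(** * The inner product *)

Section LaplaceRev.
Variable R : comNzRingType.
Implicit Types (F : int -> R) (g h : seq int -> R) (L M : seq int).

(** Equality of the terms is needed only for letters and remaining words which have
    together the size and the sum of L. *)
Lemma eq_lap_sum F F' g h L :
  (forall x M, size L = (size M).+1 -> x + \sum_(y <- M) y = \sum_(y <- L) y ->
    F x * g M = F' x * h M) ->
  lap F g L = lap F' h L.
Proof.
elim: L g h => //= x L IHL g h E; congr (_ - _); first by apply: E; rewrite ?big_cons.
apply: IHL => y M sM eM; apply: E; first by rewrite /= sM.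
by rewrite !big_cons -eM; ring.
Qed.

Lemma lap_rcons F g L x :
  lap F g (rcons L x) = lap F (fun M => g (rcons M x)) L + (-1) ^+ size L * (F x * g L).
Proof.
elim: L g => [|y L IHL] g /=; first by rewrite expr0 mul1r subr0 add0r.
by rewrite IHL exprS; ring.
Qed.

Lemma lap_rev F g L : lap F g (rev L) = - (-1) ^+ size L * lap F (fun M => g (rev M)) L.
Proof.
elim: L g => [|x L IHL] g /=; first by rewrite mulr0.
rewrite rev_cons lap_rcons IHL size_rev exprS.
have -> : lap F (fun M => g (rev (x :: M))) L = lap F (fun M => g (rcons (rev M) x)) L.
  by apply: eq_lap => // M; rewrite rev_cons.
by ring.
Qed.

Lemma lap_map F g L (s : int -> int) :
  lap F g (map s L) = lap (fun x => F (s x)) (fun M => g (map s M)) L.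
Proof. by elim: L g => //= x L IHL g; rewrite IHL. Qed.

End LaplaceRev.

Section Form.
Variable G : skewRing.
Implicit Types (f g h : G) (K L M : seq int) (la mu : seq nat).
Local Notation q := (sk_q : int -> G).
Local Notation chi := (sk_chi G).
Local Notation omega L := (chi (Xw L)).

Definition negz (x : int) : int := - x.
Definition adjw L : seq int := rev (map negz L).

Lemma adjwK L : adjw (adjw L) = L.
Proof.
rewrite /adjw map_rev revK -map_comp -[RHS]map_id; apply: eq_map => x /=; exact: opprK.
Qed.

Lemma adjw_cat K L : adjw (K ++ L) = adjw L ++ adjw K.
Proof. by rewrite /adjw map_cat rev_cat. Qed.

Lemma sum_adjw L : \sum_(x <- adjw L) x = - \sum_(x <- L) x.
Proof.
by rewrite /adjw (perm_big (map negz L)) ?perm_rev //= big_map sumrN.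
Qed.

Lemma Xw_rcons L x : Xw (rcons L x) = foldr Bv (q x) L :> G.
Proof. by rewrite /Xw -cats1 foldr_cat /= Bv_1. Qed.

(** The constant term of a word is invariant under the anti-involution sending B_n to
    (-1)^n B_(-n).  For k < 0 both B_k on the left and B_(-k) on the right contract with
    the other letters only: B_k kills 1, and nothing in the image of B_(-k) has a
    constant term.  Both expansions have the same contractions. *)
Lemma omega_adjw L : omega (adjw L) = isign int (\sum_(x <- L) x) * omega L.
Proof.
have [n] := ubnP (size L); elim: n L => // n IHn [|k L] /= sL.
  by rewrite big_nil mul1r.
have adj_cons : adjw (k :: L) = rcons (adjw L) (- k) by rewrite /adjw /= rev_cons.
have {}sL : (size L < n)%N by [].
rewrite adj_cons big_cons; case: (ltrgtP k 0) => k0.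
- have p0 : 0 < - k by lia.
  have Wr := Bv_word (- k) (adjw L) (1 : G).
  have := congr1 chi Wr; rewrite chi_Bv ?ltW // gt_eqF // rmorphD rmorphM rmorphXn rmorphN1 /=.
  rewrite Bv_1 -Xw_rcons => E1.
  rewrite /Xw [foldr _ _ _]/= Bv_word Bv_1 sk_q_lt0 // foldr_Bv0 mulr0 addr0.
  set T := lap _ _ _ in E1.
  have E2 : chi T = - (-1) ^+ size L *
      (isign int (k + \sum_(x <- L) x) * chi (lap (fun x => (clif k x)%:~R) (fun M => foldr Bv 1 M) L)).
    rewrite /T /adjw lap_rev lap_map size_map rmorphM rmorphN rmorphXn rmorphN1; congr (_ * _).
    rewrite !rmorph_lap.
    have -> : forall a F (gg : seq int -> int), a * lap F gg L = lap (fun x => F x) (fun M => a * gg M) L.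
      move=> a F; elim: (L) => [|y M IHM] gg /=; first by rewrite mulr0.
      by rewrite mulrBr IHM mulrCA.
    apply: eq_lap_sum => x M sM eM; rewrite !rmorph_int /=.
    have -> : clif (- k) (negz x) = clif k x.
      by rewrite /clif /negz -opprD oppr_eq0 isignN.
    rewrite {1 2}/clif; case: eqP => [kx|_]; last by rewrite !mul0r.
    congr (_ * _); rewrite -/(adjw M) -/(Xw _) -/(Xw _) IHn ?mulr1; last by rewrite -ltnS -sM ltnW.
    by congr (isign int _ * _); rewrite -eM; lia.
  have sz : size (adjw L) = size L by rewrite /adjw size_rev size_map.
  move: E1; rewrite E2 sz; move: (chi (Xw _)) (isign _ _ * _) => a b.
  by rewrite -signr_odd; case: (odd _); rewrite ?expr0 ?expr1; lia.
- by rewrite Xw_rcons sk_q_lt0 ?foldr_Bv0 ?raddf0 /Xw /= ?chi_Bv ?ltW ?gt_eqF ?mulr0 //; lia.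
- by subst k; rewrite oppr0 Xw_rcons sk_q0 add0r IHn // {2}/Xw /= chi_Bv.
Qed.

(** The product of f with B_(l_1) ... B_(l_r) 1, computed by moving the word to the
    other side. *)
Definition phiw L f : int := isign int (\sum_(x <- L) x) * chi (foldr Bv f (adjw L)).

Lemma phiwB L f g : phiw L (f - g) = phiw L f - phiw L g.
Proof.
rewrite /phiw; have -> : foldr Bv (f - g) (adjw L) = foldr Bv f (adjw L) - foldr Bv g (adjw L).
  by elim: (adjw L) => //= x M ->; rewrite raddfB.
by rewrite rmorphB mulrBr.
Qed.

Lemma phiw_cons k L f : phiw (k :: L) f = isign int k * phiw L (Bv (- k) f).
Proof.
rewrite /phiw big_cons isignD -mulrA; congr (_ * (_ * chi _)).
by rewrite /adjw /= rev_cons -cats1 foldr_cat.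
Qed.

Lemma phiw_nil f : phiw [::] f = chi f.
Proof. by rewrite /phiw big_nil mul1r. Qed.

Lemma phiwC K L : phiw K (Xw L) = phiw L (Xw K).
Proof.
have E J M : foldr Bv (Xw M) J = Xw (J ++ M) :> G by rewrite /Xw foldr_cat.
rewrite /phiw !E; have -> : adjw L ++ K = adjw (adjw K ++ L) by rewrite adjw_cat adjwK.
rewrite omega_adjw mulrA -isignD; congr (_ * _); rewrite big_cat sum_adjw /=.
have -> : \sum_(x <- L) x + (- \sum_(x <- K) x + \sum_(x <- L) x) =
  (\sum_(x <- L) x + \sum_(x <- L) x) - \sum_(x <- K) x by ring.
by rewrite isignB isignD isign_sq mul1r.
Qed.

Definition Qw la : G := Xw (map Posz la).

Lemma Bv_sq (k : int) f : k != 0 -> Bv k (Bv k f) = 0.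
Proof.
move=> k0; apply: (@sk_torsion G 1); rewrite mulr2n cliff /clif.
by case: eqP => //; lia.
Qed.

Lemma Bv_neg_word (a : nat) L : all (fun x => x != a%:Z) L -> (0 < a)%N -> Bv (- a%:Z) (Xw L) = 0 :> G.
Proof.
move=> La a0; elim: L La => [|x L IHL] /= => [_|/andP[xa La]].
  by rewrite /Xw /= Bv_1 sk_q_lt0 //; lia.
have := cliff (- a%:Z) x (Xw L : G); rewrite IHL // raddf0 addr0 => ->.
by rewrite /clif; case: eqP => //; lia.
Qed.

(** The larger of the two first parts is absent from the other partition, so its adjoint
    B_(-a) kills the other word; if the first parts agree, the pair B_(-a) B_a
    contributes a factor 2. *)
Lemma phiw_strict la mu : strict_partition la -> strict_partition mu ->
  phiw (map Posz la) (Qw mu) = if la == mu then 2%:R ^+ size la else 0.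
Proof.
elim: la mu => [|a la IHla] [|b mu].
- by rewrite phiw_nil /Qw /Xw /= rmorph1.
- move=> _ /andP[_]; rewrite inE negb_or => /andP[b0 _]; rewrite phiw_nil /Qw /Xw /= chi_Bv //.
  by case: eqP => //; lia.
- move=> /andP[_]; rewrite inE negb_or => /andP[a0 _] _.
  by rewrite phiwC phiw_nil /Xw /= chi_Bv //; case: eqP => //; lia.
have wlog_ a' b' s t : (b' < a')%N -> strict_partition (a' :: s) -> strict_partition (b' :: t) ->
    phiw (map Posz (a' :: s)) (Qw (b' :: t)) = 0.
  move=> ba _ /andP[st _] /=; rewrite phiw_cons Bv_neg_word.
  - by rewrite -(subrr 0) phiwB subrr mulr0.
  - rewrite all_map /=; apply/andP; split; first by apply/eqP; lia.
    move: st; rewrite /= (path_sortedE (rev_trans ltn_trans)) => /andP[bt _].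
    by apply: sub_all bt => x /=; lia.
  - by lia.
move=> sa sb; have [sab|sab|ab] := ltngtP a b.
- rewrite phiwC (wlog_ b a) //; by case: eqP => // -[]; lia.
- rewrite (wlog_ a b) //; by case: eqP => // -[]; lia.
subst b; rewrite eqseq_cons eqxx /= phiw_cons.
have [/= sa1 sa0] := andP sa; have [/= sb1 sb0] := andP sb.
move: sa1 sa0 sb1 sb0; rewrite !inE !negb_or !(path_sortedE (rev_trans ltn_trans)).
move=> /andP[_ la1] /andP[a0 la0] /andP[amu mu1] /andP[_ mu0].
have := cliff (- a%:Z) a (Qw mu); rewrite /Qw Bv_neg_word ?raddf0 ?addr0; first last.
- by lia.
- by rewrite all_map; apply: sub_all amu => x /=; lia.
rewrite -/(Qw _) => E; have -> : Xw (Posz a :: map Posz mu) = Bv a (Qw mu) by [].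
rewrite E /clif addNr eqxx isignN.
have phMz c : phiw (map Posz la) (Qw mu *~ c) = phiw (map Posz la) (Qw mu) * c.
  pose phi f := phiw (map Posz la) f.
  have padd : zmod_morphism phi by exact: phiwB.
  pose phiM := GRing.isZmodMorphism.Build G int phi padd.
  pose phiA : {additive G -> int} := HB.pack phi phiM.
  by rewrite -[LHS]/(phiA _) raddfMz /= -mulrzr intz.
rewrite phMz IHla; [| by apply/andP; split | by apply/andP; split].
have si := isign_sq int a%:Z.
case: eqP => _; last by rewrite mul0r mulr0.
by rewrite exprS !mulrnAr mulrCA si mulr1 mulr_natl.
Qed.

(** The span of the Q_la with all parts below N.  It is stable under the B_k with k < N
    and B_N maps it to the next one, which proves that the Q_la span. *)
Inductive sspan (N : nat) : G -> Prop :=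
| sspan_gen la : strict_partition la -> all (fun x => x < N)%N la -> sspan N (Qw la)
| sspan_sub f g : sspan N f -> sspan N g -> sspan N (f - g).

Lemma sspan_zero N : sspan N 0.
Proof. by rewrite -(subrr (Qw [::])); apply: sspan_sub; exact: sspan_gen. Qed.

Lemma sspan_opp N f : sspan N f -> sspan N (- f).
Proof. by rewrite -sub0r => ?; apply: sspan_sub => //; exact: sspan_zero. Qed.

Lemma sspan_add N f g : sspan N f -> sspan N g -> sspan N (f + g).
Proof. by move=> ? ?; rewrite -[g]opprK; apply: sspan_sub => //; exact: sspan_opp. Qed.

Lemma sspan_mulz N f (c : int) : sspan N f -> sspan N (f *~ c).
Proof.
move=> Nf; have Nn n : sspan N (f *+ n).
  by elim: n => [|n IHn]; [rewrite mulr0n; exact: sspan_zero | rewrite mulrS; exact: sspan_add].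
by case: c => n; [exact: Nn | rewrite NegzE mulrNz; apply: sspan_opp; exact: Nn].
Qed.

Lemma sspan_le N N' f : (N <= N')%N -> sspan N f -> sspan N' f.
Proof.
move=> NN'; elim=> [la sla laN|g h _ IHg _ IHh]; last exact: sspan_sub.
by apply: sspan_gen => //; apply: sub_all laN => x /leq_trans; apply.
Qed.

Lemma strict_cons (a : nat) la : (0 < a)%N -> strict_partition la ->
  all (fun x => x < a)%N la -> strict_partition (a :: la).
Proof.
move=> a0 /andP[sla la0] laa; rewrite /strict_partition /= (path_sortedE (rev_trans ltn_trans)) laa sla /=.
by rewrite inE negb_or la0 andbT; lia.
Qed.

Lemma sspan_cons N f : (0 < N)%N -> sspan N f -> sspan N.+1 (Bv N f).
Proof.
move=> N0; elim=> [la sla laN|g h _ IHg _ IHh]; last by rewrite raddfB; exact: sspan_sub.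
apply: (@sspan_gen _ (N :: la)); first exact: strict_cons.
by rewrite /= ltnSn; apply: sub_all laN => x /= /ltnW.
Qed.

(** B_k with k below the first part x moves past B_x, after which the parts below x
    remain and induction on N applies. *)
Lemma sspan_Bv N f (k : int) : sspan N f -> k < N%:Z -> sspan N (Bv k f).
Proof.
have [n] := ubnP N; elim: n N f k => // n IHn N f k Nn Nf kN.
elim: Nf => {f} [la sla laN|g h _ IHg _ IHh]; last by rewrite raddfB; exact: sspan_sub.
have posk (P : G -> Prop) : (forall p : nat, (0 < p < N)%N -> k = p -> P (Bv k (Qw la))) -> 0 < k -> P (Bv k (Qw la)).
  by move=> H; case: k kN H => // p pN H p0; apply: (H p) => //; lia.
case: la sla laN posk => [|x la] sla laN posk.
  case: (ltrgtP k 0) => k0.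
  - by rewrite /Qw /Xw /= Bv_1 sk_q_lt0 //; exact: sspan_zero.
  - apply: posk => // p /andP[p0 pN] ->; apply: (@sspan_gen _ [:: p]); last by rewrite /= pN.
    exact: strict_cons.
  - by rewrite k0 /Qw /Xw /= Bv_1 sk_q0; apply: (@sspan_gen _ [::]).
have [/= xla] := andP sla; rewrite inE negb_or => /andP[x0 la0].
move: xla; rewrite (path_sortedE (rev_trans ltn_trans)) => /andP[lax slal].
have sl : strict_partition la by apply/andP; split.
have {}x0 : (0 < x)%N by lia.
have /andP[xN lN] := laN.
case: (ltrgtP k x) => kx.
- have -> : Bv k (Qw (x :: la)) = Qw la *~ clif k x - Bv x (Bv k (Qw la)).
    by rewrite -(cliff k x (Qw la)) addrK.
  apply: sspan_sub; first by apply: sspan_mulz; apply: sspan_gen.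
  apply: (sspan_le (N := x.+1)) => //; apply: sspan_cons => //.
  by apply: IHn => //; [lia | apply: sspan_gen].
- apply: posk => [p /andP[p0 pN] kp|]; last by lia.
  rewrite kp; apply: (@sspan_gen _ (p :: x :: la)); last by rewrite /= pN.
  apply: strict_cons => //; have xp : (x < p)%N by lia.
  by rewrite /= xp; apply: sub_all lax => y /= yx; apply: ltn_trans yx xp.
- by rewrite kx Bv_sq; [exact: sspan_zero | lia].
Qed.

Lemma strict_ind (P : G -> Prop) :
  (forall la, strict_partition la -> P (Qw la)) -> (forall f g, P f -> P g -> P (f - g)) ->
  forall f, P f.
Proof.
move=> PQ PB f; suff [N] : exists N, sspan N f by elim=> // *; auto.
elim/Bv_ind: f => [|f g [N Nf] [M Mg]|n f [N Nf]].
- by exists 0%N; apply: (@sspan_gen _ [::]).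
- exists (maxn N M); apply: sspan_sub; [apply: sspan_le Nf | apply: sspan_le Mg].
  + exact: leq_maxl.
  + exact: leq_maxr.
- exists (maxn N (absz n).+1); apply: sspan_Bv; last by lia.
  by apply: sspan_le Nf; exact: leq_maxl.
Qed.

Lemma form_ex f : exists T : G -> int,
  (forall g h, T (g - h) = T g - T h) /\
  forall la, strict_partition la -> T (Qw la) = phiw (map Posz la) f.
Proof.
elim/strict_ind: f => [mu smu|f g [T [TB TQ]] [T' [TB' TQ']]].
  exists (phiw (map Posz mu)); split=> [g h|la sla]; first exact: phiwB.
  by rewrite /Qw phiwC.
exists (fun h => T h - T' h); split=> [h h'|la sla]; first by rewrite TB TB'; ring.
by rewrite TQ // TQ' // phiwB.
Qed.

(** A form with prescribed products with the Q_la; choosing it for each f separately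
    avoids proving that the Q_la are linearly independent. *)
Definition ip f : G -> int := projT1 (cid (form_ex f)).

Lemma ipBr f g h : ip f (g - h) = ip f g - ip f h.
Proof. by rewrite /ip; case: cid => T /= [TB _]; exact: TB. Qed.

Lemma ip_Qr f la : strict_partition la -> ip f (Qw la) = phiw (map Posz la) f.
Proof. by rewrite /ip; case: cid => T /= [_ TQ]; exact: TQ. Qed.

Lemma ipBl f g h : ip (f - g) h = ip f h - ip g h.
Proof.
elim/strict_ind: h => [la sla|h h' IHh IHh']; first by rewrite !ip_Qr // phiwB.
by rewrite !ipBr IHh IHh'; ring.
Qed.

Lemma ip_Xl K f : ip (Xw K) f = phiw K f.
Proof.
elim/strict_ind: f => [la sla|f g IHf IHg]; first by rewrite ip_Qr // /Qw phiwC.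
by rewrite ipBr phiwB IHf IHg.
Qed.

Lemma ip_strict la mu : strict_partition la -> strict_partition mu ->
  ip (Qw la) (Qw mu) = if la == mu then 2%:R ^+ size la else 0.
Proof. by move=> sla smu; rewrite ip_Xl phiw_strict. Qed.

Lemma ip_uniq (ip' : G -> G -> int) :
  (forall f g h, ip' (f - g) h = ip' f h - ip' g h) ->
  (forall f g h, ip' f (g - h) = ip' f g - ip' f h) ->
  (forall la mu, strict_partition la -> strict_partition mu ->
    ip' (Qw la) (Qw mu) = if la == mu then 2%:R ^+ size la else 0) ->
  forall f g, ip' f g = ip f g.
Proof.
move=> Bl Br Q f g; elim/strict_ind: f => [la sla|f f' IHf IHf']; last by rewrite Bl ipBl IHf IHf'.
elim/strict_ind: g => [mu smu|g g' IHg IHg']; last by rewrite Br ipBr IHg IHg'.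
by rewrite Q // ip_strict.
Qed.

Lemma ip0l g : ip 0 g = 0.
Proof. by rewrite -(subrr (0 : G)) ipBl subrr. Qed.

Lemma ip0r g : ip g 0 = 0.
Proof. by rewrite -(subrr (0 : G)) ipBr subrr. Qed.

Lemma ipNl f g : ip (- f) g = - ip f g.
Proof. by rewrite -sub0r ipBl ip0l sub0r. Qed.

Lemma ipDl f g h : ip (f + g) h = ip f h + ip g h.
Proof. by rewrite -{1}(opprK g) ipBl ipNl opprK. Qed.

Lemma ipDr f g h : ip f (g + h) = ip f g + ip f h.
Proof. by rewrite -{1}(opprK h) ipBr -(sub0r h) ipBr ip0r sub0r opprK. Qed.

Lemma ip_1l f : ip 1 f = chi f.
Proof. by rewrite -phiw_nil -ip_Xl. Qed.

Lemma ip_1r f : ip f 1 = chi f.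
Proof. by have := ip_Qr (la := [::]) f isT; rewrite phiw_nil. Qed.

Lemma ip_Bv k f g : ip (Bv k f) g = isign int k * ip f (Bv (- k) g).
Proof.
elim/strict_ind: f => [la sla|f h IHf IHh]; last by rewrite raddfB !ipBl IHf IHh mulrBr.
by rewrite -[Bv k _]/(Xw (k :: map Posz la)) !ip_Xl phiw_cons.
Qed.

(** On words: B_k has the adjoint (-1)^k B_(-k), under which the exchange relation of
    [skew n] with the B_k becomes that of the multiplication by q_n. *)
Lemma ip_skew n f g : ip (skew n f) g = ip f (q n * g).
Proof.
elim/Bv_ind: f n g => [|f h IHf IHh|k f IHf] n g.
- rewrite skew_1 ip_1l rmorphM sk_chi_q /=.
  by case: eqP => _; rewrite ?ip_1l ?ip0l ?mul1r ?mul0r.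
- by rewrite raddfB !ipBl IHf IHh.
elim/int_strong_ind: n k => [n n0|n IHn] k; first by rewrite skew_lt0 // sk_q_lt0 // mul0r ip0l ip0r.
have n1 : n - 1 < n by lia.
rewrite skew_Bv !ipDl IHn // !ip_Bv !IHf isignB isign1 mulrN1.
have -> : - (k - 1) = - k + 1 by lia.
have -> : q n * Bv (- k) g = Bv (- k) (q n * g) + Bv (- k + 1) (q (n - 1) * g) + q (n - 1) * Bv (- k + 1) g.
  by rewrite (Bv_qM (- k)); ring.
by rewrite !ipDr; ring.
Qed.

Lemma ip_nondeg f : (forall h, ip f h = 0) -> f = 0.
Proof.
move=> f0; apply: (sk_eq0 (P := fun f => forall h, ip f h = 0)) => // {f f0} [f k f0 h|f f0].
  by rewrite -skewE ip_skew.
by rewrite -ip_1r.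
Qed.

Lemma ip_injl f g : (forall h, ip f h = ip g h) -> f = g.
Proof.
move=> E; apply/eqP; rewrite -subr_eq0; apply/eqP/ip_nondeg => h.
by rewrite ipBl E subrr.
Qed.

Lemma adj_ex f : exists T : G -> G, forall g h, ip (T g) h = ip g (f * h).
Proof.
elim/sk_ring_ind: f => [|f g [T HT] [S HS]|f g [T HT] [S HS]|n].
- by exists id => g h; rewrite mul1r.
- by exists (fun h => T h - S h) => h h'; rewrite ipBl HT HS mulrBl ipBr.
- by exists (T \o S) => h h' /=; rewrite HT HS mulrCA mulrA.
- by exists (skew n) => g h; exact: ip_skew.
Qed.

Definition adj f : G -> G := projT1 (cid (adj_ex f)).

Lemma adjP f g h : ip (adj f g) h = ip g (f * h).
Proof. by rewrite /adj; case: cid => T /= ->. Qed.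

Lemma adj_uniq f (T : G -> G) : (forall g h, ip (T g) h = ip g (f * h)) -> T =1 adj f.
Proof. by move=> HT g; apply: ip_injl => h; rewrite HT adjP. Qed.

Lemma adj_zmod f : zmod_morphism (adj f).
Proof. by move=> g h; apply: ip_injl => k; rewrite ipBl !adjP ipBl. Qed.
HB.instance Definition _ f := GRing.isZmodMorphism.Build G G (adj f) (adj_zmod f).

Lemma adj_q n : skew n =1 adj (q n).
Proof. by apply: adj_uniq => g h; exact: ip_skew. Qed.

Lemma adj0 h : adj 0 h = 0.
Proof. by apply: ip_injl => k; rewrite adjP mul0r ip0l ip0r. Qed.

Lemma adjC f g h : adj f (adj g h) = adj g (adj f h).
Proof. by apply: ip_injl => k; rewrite !adjP mulrCA. Qed.

Lemma adj_1 f : adj f 1 = (chi f)%:~R.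
Proof.
have ip_int c h : ip (c%:~R) h = c * chi h.
  pose phi (c : int) := ip (c%:~R) h.
  have padd : zmod_morphism phi by move=> a b; rewrite /phi rmorphB ipBl.
  pose phiM := GRing.isZmodMorphism.Build int int phi padd.
  pose phiA : {additive int -> int} := HB.pack phi phiM.
  by rewrite -[LHS]/(phiA c) -[c in LHS]intz raddfMz /= /phi ip_1l -mulrzl intz.
by apply: ip_injl => h; rewrite adjP ip_1l rmorphM ip_int.
Qed.

End Form.
Arguments ip {G} f g.
Arguments adj {G} f g.
Arguments Qw {G} la.

(** * Products of normally ordered sums in a Clifford algebra *)

Section CliffordBox.
Variables (V : zmodType) (psi : int -> {additive V -> V}).
Hypothesis psi_cliff : forall a b x, psi a (psi b x) + psi b (psi a x) = x *~ clif a b.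
Hypothesis V_torsion : forall x : V, x *+ 2 = 0 -> x = 0.
Variables (m N : nat).
Implicit Types (x y z v : V) (i j k n c : int) (s : seq nat).

Lemma sumr_mulz (I : Type) (r : seq I) (F : I -> V) c :
  \sum_(i <- r) F i *~ c = (\sum_(i <- r) F i) *~ c.
Proof.
apply/esym; apply: (big_morph (fun x : V => x *~ c)); last exact: mul0rz.
by move=> x y; rewrite mulrzDl.
Qed.

Definition box : seq int := [seq i%:Z - N%:Z | i : nat <- iota 0 N.*2.+1].
Definition cls c : seq int := [seq k <- box | (m %| k - c)%Z].

Lemma mem_box k : (k \in box) = (- N%:Z <= k <= N%:Z).
Proof.
apply/mapP/idP => [[i]|kN]; first by rewrite mem_iota => iN ->; lia.
by exists (absz (k + N%:Z)); [rewrite mem_iota; lia | lia].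
Qed.

Lemma box_uniq : uniq box.
Proof. by rewrite map_inj_uniq ?iota_uniq // => i j; lia. Qed.

Lemma mem_cls c k : (k \in cls c) = (m %| k - c)%Z && (- N%:Z <= k <= N%:Z).
Proof. by rewrite mem_filter mem_box. Qed.

Lemma cls_uniq c : uniq (cls c).
Proof. exact: filter_uniq box_uniq. Qed.

Lemma eq_cls c c' : (m %| c - c')%Z -> cls c = cls c'.
Proof.
move=> cc; apply: eq_filter => k; have -> : k - c' = (k - c) + (c - c') by ring.
by rewrite (rpredDr _ cc).
Qed.

Lemma dvdz_opp_cls c k : (m %| - k - c)%Z = (m %| k + c)%Z.
Proof. by rewrite -opprD rpredN. Qed.

Definition nord i j x : V :=
  if j < i then psi i (psi j x) else if i < j then - psi j (psi i x) else 0.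

Lemma nordB i j x y : nord i j (x - y) = nord i j x - nord i j y.
Proof. by rewrite /nord; do 2?case: ifP => _; rewrite ?subr0 // !raddfB ?opprB /= ?opprK // addrC. Qed.

Lemma psi_anti i j x : i + j != 0 -> psi i (psi j x) = - psi j (psi i x).
Proof.
move=> ij; have := psi_cliff i j x; rewrite /clif (negbTE ij) mulr0z => /eqP.
by rewrite addr_eq0 => /eqP.
Qed.

(** Normal ordering changes psi_i psi_j only by a scalar, so it has the commutators of
    psi_i psi_j. *)
Lemma nord_comm i j k x : nord i j (psi k x) - psi k (nord i j x) =
  psi i x *~ clif j k - psi j x *~ clif i k.
Proof.
have E a b : psi a (psi b (psi k x)) - psi k (psi a (psi b x)) = psi a x *~ clif b k - psi b x *~ clif a k.
  have H1 := congr1 (psi a) (psi_cliff b k x); have H2 := psi_cliff a k (psi b x).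
  rewrite raddfD raddfMz /= in H1; rewrite -H1 -H2.
  by rewrite opprD addrA addrK.
rewrite /nord; case: (ltrgtP j i) => ij; first exact: E.
- by rewrite raddfN opprK -[LHS]opprK opprD opprK E opprB.
- by rewrite ij raddf0 subr0 subrr.
Qed.

(** The sum of the operators B_(i,j) of one factor, for indices in [-N, N]. *)
Definition pairsum (a : nat) x : V := \sum_(i <- cls (- a%:Z)) \sum_(j <- cls a%:Z) nord i j x.

Lemma pairsum_zmod a : zmod_morphism (pairsum a).
Proof.
move=> x y; rewrite /pairsum -sumrB; apply: eq_bigr => i _; rewrite -sumrB; apply: eq_bigr => j _.
exact: nordB.
Qed.
HB.instance Definition _ a := GRing.isZmodMorphism.Build V V (pairsum a) (pairsum_zmod a).

Lemma sum_cls_clif r k (y : int -> V) : - N%:Z <= k <= N%:Z ->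
  \sum_(i <- cls r) y i *~ clif i k = if (m %| k + r)%Z then y (- k) *~ (isign int k *+ 2) else 0.
Proof.
move=> kN; case: ifP => [kr|kr].
  have kc : - k \in cls r by rewrite mem_cls dvdz_opp_cls kr; lia.
  rewrite (bigD1_seq _ kc (cls_uniq r)) /= big1 => [|i ik]; last first.
    by rewrite /clif; case: eqP => [ki|]; [case/eqP: ik; lia | rewrite mulr0z].
  by rewrite addr0 /clif addNr eqxx isignN.
rewrite big_seq big1 // => i; rewrite mem_cls => /andP[ir _].
rewrite /clif; case: eqP => [ik|]; last by rewrite mulr0z.
by move: kr; have -> : k + r = - (i - r) by [lia]; rewrite rpredN ir.
Qed.

Lemma pairsum_comm a k x : - N%:Z <= k <= N%:Z -> pairsum a (psi k x) - psi k (pairsum a x) =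
  (\sum_(i <- cls (- a%:Z)) psi i x) *~ (isign int k *+ ((m %| k + a%:Z)%Z).*2)
  - (\sum_(j <- cls a%:Z) psi j x) *~ (isign int k *+ ((m %| k - a%:Z)%Z).*2).
Proof.
move=> kN; rewrite /pairsum raddf_sum -sumrB.
rewrite (eq_bigr (fun i => (if (m %| k + a%:Z)%Z then psi i x *~ (isign int k *+ 2) else 0)
   - \sum_(j <- cls a%:Z) psi j x *~ clif i k)); last first.
  move=> i _; rewrite raddf_sum -sumrB; under eq_bigr => j _ do rewrite nord_comm.
  by rewrite sumrB (@sum_cls_clif a%:Z k (fun=> psi i x) kN).
rewrite sumrB; congr (_ - _).
  by case: (m %| k + a%:Z)%Z; [rewrite sumr_mulz | rewrite big1].
rewrite exchange_big /=.
rewrite (eq_bigr (fun j => if (m %| k - a%:Z)%Z then psi j x *~ (isign int k *+ 2) else 0)); last first.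
  by move=> j _; rewrite (@sum_cls_clif (- a%:Z) k (fun=> psi j x) kN).
by case: (m %| k - a%:Z)%Z; [rewrite sumr_mulz | rewrite big1].
Qed.

(** The product of the factors 1 + [pairsum a] for a in s and of the last factor, which
    acts first. *)
Fixpoint boxprod s x : V :=
  if s is a :: s' then boxprod s' x + pairsum a (boxprod s' x) else \sum_(k <- cls 0) psi k x.

Lemma boxprod_zmod s : zmod_morphism (boxprod s).
Proof.
elim: s => [|a s IHs] x y /=; last by rewrite IHs raddfB /= addrACA opprD.
by rewrite -sumrB; apply: eq_bigr => k _; rewrite raddfB.
Qed.
HB.instance Definition _ s := GRing.isZmodMorphism.Build V V (boxprod s) (boxprod_zmod s).

(** The condition under which psi_k anticommutes with the whole product over s. *)
Definition avoid s k : bool :=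
  ~~ (m %| k)%Z && all (fun a : nat => ~~ (m %| k - a%:Z)%Z && ~~ (m %| k + a%:Z)%Z) s.

(** No two of the classes 0, a, -a for a in s coincide, except possibly a and -a. *)
Fixpoint sep s : bool :=
  if s is a :: s' then avoid s' a%:Z && sep s' else true.

Lemma avoid_congr s k l : (m %| k - l)%Z -> avoid s k = avoid s l.
Proof.
move=> kl; have E c : (m %| k + c)%Z = (m %| l + c)%Z.
  by have -> : k + c = l + c + (k - l) by [ring]; rewrite (rpredDr _ kl).
rewrite /avoid; have := E 0; rewrite !addr0 => ->; congr (_ && _); apply: eq_all => a.
by rewrite !E.
Qed.

Lemma avoidN s k : avoid s (- k) = avoid s k.
Proof.
rewrite /avoid rpredN; congr (_ && _); apply: eq_all => a.
have -> : - k + a%:Z = - (k - a%:Z) by ring.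
by rewrite -opprD !rpredN andbC.
Qed.

Lemma psi_pairsum a k x : ~~ (m %| k - a%:Z)%Z -> ~~ (m %| k + a%:Z)%Z ->
  psi k (pairsum a x) = pairsum a (psi k x).
Proof.
move=> ka1 ka2; rewrite /pairsum raddf_sum; apply: eq_big_seq => i ia; rewrite raddf_sum.
apply: eq_big_seq => j ja; apply/esym/eqP; rewrite -subr_eq0 /=; apply/eqP.
rewrite nord_comm /clif.
move: ia ja; rewrite !mem_cls opprK => /andP[ia _] /andP[ja _].
case: eqP => [jk|_]; first by case/negP: ka2; rewrite -rpredN; have -> : - (k + a%:Z) = j - a%:Z by lia.
case: eqP => [ik|_]; first by case/negP: ka1; rewrite -rpredN; have -> : - (k - a%:Z) = i + a%:Z by lia.
by rewrite mulr0z subrr.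
Qed.

Lemma psi_boxprod s k x : avoid s k -> psi k (boxprod s x) = - boxprod s (psi k x).
Proof.
elim: s => [|a s IHs] /=.
  move=> /andP[k0 _]; rewrite raddf_sum -sumrN; apply: eq_big_seq => i; rewrite mem_cls subr0 => /andP[i0 _].
  apply: psi_anti; apply/eqP => ki; case/negP: k0; have -> : k = - i by lia.
  by rewrite rpredN.
move=> /andP[k0 /andP[/andP[ka1 ka2] ks]].
have ak : avoid s k by apply/andP.
by rewrite raddfD /= psi_pairsum // IHs // raddfN opprD.
Qed.

Lemma class_dichotomy a k s : sep (a :: s) -> (m %| k - a%:Z)%Z || (m %| k + a%:Z)%Z -> avoid s k.
Proof.
move=> /= /andP[sa _] /orP[ka|ka]; first by rewrite (avoid_congr _ ka).
have {}ka : (m %| k - - a%:Z)%Z by rewrite opprK.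
by rewrite (avoid_congr _ ka) avoidN.
Qed.

(** The anticommutator with the last factor is 2 for k divisible by m and 0 otherwise,
    and the commutator with each other factor depends, up to (-1)^k, on the class of k:
    [pairsum_comm]. *)
Lemma boxprod_anticomm s k l x : sep s -> (m %| k - l)%Z ->
  - N%:Z <= k <= N%:Z -> - N%:Z <= l <= N%:Z ->
  (boxprod s (psi k x) + psi k (boxprod s x)) *~ isign int k =
  (boxprod s (psi l x) + psi l (boxprod s x)) *~ isign int l.
Proof.
move=> + kl kN lN; have E c : (m %| k + c)%Z = (m %| l + c)%Z.
  by have -> : k + c = l + c + (k - l) by [ring]; rewrite (rpredDr _ kl).
have sgz2 (b : bool) n : (isign int n *+ b.*2) * isign int n = b.*2%:Z.
  by rewrite mulrnAl isign_sq -mulr_natr mul1r natz.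
elim: s => [_|a s IHs] /=.
  have base n : - N%:Z <= n <= N%:Z ->
     (\sum_(c <- cls 0) psi c (psi n x) + psi n (\sum_(c <- cls 0) psi c x)) *~ isign int n =
     if (m %| n + 0)%Z then x *~ 2 else 0.
    move=> nN; rewrite raddf_sum -big_split /=.
    under eq_bigr => c _ do rewrite psi_cliff.
    rewrite (@sum_cls_clif 0 n (fun=> x) nN); case: ifP => _; last by rewrite mul0rz.
    by rewrite -mulrzA; congr (_ *~ _); exact: (sgz2 true n).
  by rewrite !base // E.
move=> /andP[sa ss]; have IH := IHs ss.
have step n : - N%:Z <= n <= N%:Z ->
    (boxprod s (psi n x) + pairsum a (boxprod s (psi n x)) + psi n (boxprod s x + pairsum a (boxprod s x))) =
    (boxprod s (psi n x) + psi n (boxprod s x)) + pairsum a (boxprod s (psi n x) + psi n (boxprod s x))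
    - (pairsum a (psi n (boxprod s x)) - psi n (pairsum a (boxprod s x))).
  have aux (r A p C B : V) : r + A + (p + C) = (r + p) + (A + B) - (B - C).
    by rewrite addrACA opprB -[in RHS]addrA; congr (_ + _); rewrite addrACA subrr addr0.
  move=> nN; rewrite [psi n (_ + _)]raddfD [pairsum a (_ + _)]raddfD /=; exact: aux.
have dist (u w d : V) c : (u + w - d) *~ c = (u *~ c + w *~ c) - d *~ c.
  by rewrite mulrzBl mulrzDl.
rewrite !step // !dist.
rewrite -!raddfMz /= IH; congr (_ - _).
rewrite !pairsum_comm // !mulrzBl -!mulrzA !sgz2.
have Ek := E (a%:Z); have Ek' := E (- a%:Z).
by rewrite Ek Ek'.
Qed.

Lemma dvdz_small c : (m %| c)%Z -> 0 < c -> m%:Z <= c.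
Proof. by move=> /dvdzP[e ->] c0; have : 0 < e by [nia]; nia. Qed.

Lemma dvdz_small0 c : (m %| c)%Z -> - m%:Z < c < m%:Z -> c = 0.
Proof.
move=> mc cm; case: (ltrgtP c 0) => // c0.
- have mc' : (m %| - c)%Z by rewrite rpredN.
  by have := dvdz_small mc'; lia.
- by have := dvdz_small mc; lia.
Qed.

Hypothesis m_odd : odd m.

(** The sum of the signs (-1)^n that remains of Z_k when each psi_n with n < 0 in the
    class of -k sends z to a fixed vector up to the sign (-1)^n. *)
Definition ssum k : int :=
  isign int k + (\sum_(n <- cls (- k) | - k < n < 0) isign int n) *+ 2.

(** Signs alternate along a class because m is odd, so the sum telescopes to the sign of
    the representative of k in (0, m]. *)
Lemma ssumE k (a : nat) : 0 < k <= N%:Z -> (0 < a <= m)%N -> (m %| k - a%:Z)%Z ->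
  ssum k = isign int a%:Z.
Proof.
elim/int_strong_ind: k => [k k0|k IHk] kN am ka; first by lia.
rewrite /ssum; case: (lerP k m%:Z) => km.
  have -> : k = a%:Z by apply/eqP; rewrite -subr_eq0; apply/eqP/(dvdz_small0 ka); lia.
  rewrite big_seq_cond big1 ?mul0rn ?addr0 // => n; rewrite mem_cls opprK => /andP[/andP[nk _] n0].
  by have := dvdz_small nk; lia.
have ck : cls (- k) = cls (- (k - m%:Z)).
  by apply: eq_cls; have -> : - k - - (k - m%:Z) = - m%:Z by [ring]; rewrite rpredN dvdzz.
have k'm : - (k - m%:Z) \in cls (- (k - m%:Z)).
  by rewrite mem_cls subrr dvdz0; lia.
rewrite ck big_mkcond (bigD1_seq _ k'm (cls_uniq _)) /= -big_mkcondr.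
have -> : (- k < - (k - m%:Z) < 0) = true by lia.
rewrite -[RHS](IHk (k - m%:Z)) /ssum //; [|lia|lia|]; last first.
  by have -> : k - m%:Z - a%:Z = k - a%:Z - m%:Z by [ring]; rewrite rpredB // dvdzz.
have -> : \sum_(i <- cls (- (k - m%:Z)) | (i != - (k - m%:Z)) && (- k < i < 0)) isign int i =
   \sum_(n <- cls (- (k - m%:Z)) | - (k - m%:Z) < n < 0) isign int n.
  rewrite big_seq_cond [RHS]big_seq_cond; apply: eq_bigl => n.
  case nc: (n \in _) => //=; move: nc; rewrite mem_cls => /andP[nk _].
  apply/idP/idP => [/andP[nk' nb]|]; last by lia.
  case: (ltrP (n - - (k - m%:Z)) 0) => nlt; last by move/eqP: nk'; lia.
  by have := dvdz_small0 nk; lia.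
rewrite isignN isignB (isign_odd _ m_odd).
by move: (isign int k) (\sum_(n <- _ | _) _) => e S; ring.
Qed.

(** The part of the class of c made of creation operators. *)
Definition possum c z : V := \sum_(i <- cls c | 0 < i) psi i z.

Lemma possum_zmod c : zmod_morphism (possum c).
Proof. by move=> x y; rewrite /possum -sumrB; apply: eq_bigr => i _; rewrite raddfB. Qed.
HB.instance Definition _ c := GRing.isZmodMorphism.Build V V (possum c) (possum_zmod c).

Lemma possum_congr c c' z : (m %| c - c')%Z -> possum c z = possum c' z.
Proof. by move=> cc; rewrite /possum (eq_cls cc). Qed.

Lemma possumC c d z : possum c (possum d z) = - possum d (possum c z).
Proof.
rewrite /possum -sumrN; under eq_bigr => i _ do rewrite raddf_sum.
rewrite exchange_big; apply: eq_bigr => j j0; rewrite raddf_sum -sumrN.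
by apply: eq_bigr => i i0 /=; apply: psi_anti; lia.
Qed.

Lemma possum_sq c z : possum c (possum c z) = 0.
Proof. by apply: V_torsion; rewrite mulr2n {1}possumC addNr. Qed.

Lemma psi_possum n c z : n < 0 -> - N%:Z <= n ->
  psi n (possum c z) = (if (m %| n + c)%Z then z *~ (isign int n *+ 2) else 0) - possum c (psi n z).
Proof.
move=> n0 nN; have nN' : - N%:Z <= n <= N%:Z by lia.
rewrite -(@sum_cls_clif c n (fun=> z) nN') /possum raddf_sum big_mkcond /=.
rewrite (big_mkcond (fun i => 0 < i)) -sumrB; apply: eq_bigr => i _.
case: ifP => i0; first by rewrite -(psi_cliff i n z) addrC addKr.
by rewrite /clif; case: (i + n =P 0) => [|_]; [lia | rewrite mulr0z subrr].
Qed.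

(** The annihilators of the product applied to the vacuum.  They are linear combinations
    of the psi_n in one class modulo m. *)
Definition Zop k z : V := psi (- k) z + (\sum_(n <- cls (- k) | - k < n) psi n z) *+ 2.

Lemma ZopE k z : 0 < k <= N%:Z -> Zop k z =
  psi (- k) z + (\sum_(n <- cls (- k) | - k < n < 0) psi n z) *+ 2
  + ((if (m %| k)%Z then psi 0 z else 0) + possum (- k) z) *+ 2.
Proof.
move=> kN; rewrite /Zop -addrA -mulrnDl; congr (_ + _ *+ _).
rewrite (bigID (fun n => n < 0)) /=; congr (_ + _).
rewrite (eq_bigl (fun n => (- k < n) && (0 <= n))); last by move=> n; lia.
have -> : (if (m %| k)%Z then psi 0 z else 0) = \sum_(n <- cls (- k) | n == 0) psi n z.
  case: ifP => mk.
    have c0 : 0 \in cls (- k) by rewrite mem_cls opprK add0r mk; lia.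
    rewrite big_mkcond (bigD1_seq _ c0 (cls_uniq _)) //= big1 ?addr0 // => i i0.
    by rewrite (negbTE i0).
  rewrite big_seq_cond big1 // => i /andP[+ /eqP i0]; rewrite i0 mem_cls opprK add0r mk.
  by [].
rewrite [RHS]addrC (bigID (fun n => 0 < n)) /=; congr (_ + _).
all: by apply: eq_bigl => n; lia.
Qed.

Lemma Zop_scalar k z w (e : int) : 0 < k <= N%:Z ->
  (forall n, n < 0 -> n \in cls (- k) -> psi n z = w *~ (isign int n *+ 2 * e)) ->
  Zop k z = w *~ (ssum k *+ 2 * e) + ((if (m %| k)%Z then psi 0 z else 0) + possum (- k) z) *+ 2.
Proof.
move=> kN H; rewrite ZopE //; congr (_ + _); rewrite H; last 2 first.
- by lia.
- by rewrite mem_cls subrr dvdz0; lia.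
rewrite big_seq_cond (eq_bigr (fun n => w *~ (isign int n *+ 2 * e))) -?big_seq_cond; last first.
  by move=> n /andP[nk /andP[_ n0]]; exact: H.
rewrite -(big_morph (fun c => w *~ (c *+ 2 * e)) (op2 := +%R : int -> int -> int) (id2 := 0)); last 2 first.
- by move=> c d; rewrite mulrnDl mulrDl mulrzDr.
- by rewrite mul0rn mul0r mulr0z.
rewrite pmulrn -mulrzA -mulrzDr isignN /ssum; congr (_ *~ _).
by move: (isign int k) (\sum_(n <- _ | _) _) => a b; ring.
Qed.

Lemma dvdz_double c : (m %| c *+ 2)%Z = (m %| c)%Z.
Proof. by rewrite -mulr_natr mulrC Gauss_dvdzr // coprimezE [absz _]/= coprimen2. Qed.

(** On a vector killed by the annihilation operators of the classes a and -a, normal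
    ordering leaves the creation operators only. *)
Lemma psi_pairsum_pos a y : ~~ (m %| a%:Z)%Z ->
  (forall n, n < 0 -> (m %| n - a%:Z)%Z || (m %| n + a%:Z)%Z -> psi n y = 0) ->
  pairsum a y = possum (- a%:Z) (possum a%:Z y).
Proof.
move=> ma yk; rewrite /pairsum /possum big_seq_cond [RHS]big_seq_cond big_mkcond [RHS]big_mkcond.
apply: eq_bigr => i _ /=; case ic: (i \in _) => //=.
move: ic; rewrite mem_cls opprK => /andP[ia _].
have i0 : i != 0 by apply: contraNneq ma => i0; move: ia; rewrite i0 add0r.
rewrite raddf_sum; case: ifP => ipos.
  rewrite big_seq_cond [RHS]big_seq_cond big_mkcond [RHS]big_mkcond.
  apply: eq_bigr => j _ /=; case jc: (j \in _) => //=.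
  move: jc; rewrite mem_cls => /andP[ja _].
  have j0 : j != 0 by apply: contraNneq ma => j0; move: ja; rewrite j0 add0r rpredN.
  rewrite /nord; case: (ltrgtP 0 j) j0 => // jpos _.
    case: (ltrgtP j i) => // ij; first by rewrite -psi_anti // gt_eqF //; lia.
    subst j; case/negP: ma; rewrite -dvdz_double.
    by have -> : a%:Z *+ 2 = (i + a%:Z) - (i - a%:Z) by [ring]; rewrite rpredB.
  by have -> : j < i by [lia]; rewrite (yk j) ?ja // raddf0.
rewrite big_seq big1 // => j; rewrite mem_cls => /andP[ja _].
rewrite /nord; case: (ltrgtP j i) => // ij.
  by rewrite (yk j) ?raddf0 ?ja //; lia.
by rewrite (yk i) ?raddf0 ?oppr0 ?ia ?orbT //; lia.
Qed.

(** Let v = (1 + P_(-a) P_a) y, where P_c sums the creation operators of the class c.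
    For n < 0 in the class of -a, psi_n v is a multiple of P_(-a) y, hence of P_(-a) v
    as P_(-a) squares to 0; in the class of a the same holds with P_a and the opposite
    sign.  The total coefficient is the sign of the representative of k, which is a or
    m - a.  The choice of a even makes both cases cancel. *)
Lemma Zop_pair k a y : 0 < k <= N%:Z -> (0 < a < m)%N -> ~~ odd a ->
  (m %| k - a%:Z)%Z || (m %| k + a%:Z)%Z ->
  (forall n, n < 0 -> (m %| n - a%:Z)%Z || (m %| n + a%:Z)%Z -> psi n y = 0) ->
  Zop k (y + pairsum a y) = 0.
Proof.
move=> kN am aev ka yk.
have ma : ~~ (m %| a%:Z)%Z.
  by apply/negP => ma; have := dvdz_small ma; lia.
have ma2 n : (m %| n - a%:Z)%Z -> (m %| n + a%:Z)%Z = false.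
  move=> na; apply/negP => na'; case/negP: ma; rewrite -dvdz_double.
  by have -> : a%:Z *+ 2 = (n + a%:Z) - (n - a%:Z) by [ring]; rewrite rpredB.
have ma2' n : (m %| n + a%:Z)%Z -> (m %| n - a%:Z)%Z = false.
  by move=> na; apply/negP => /ma2; rewrite na.
have mk : (m %| k)%Z = false.
  apply/negP => mk; case/negP: ma; case/orP: ka => ka.
    by have -> : a%:Z = k - (k - a%:Z) by [ring]; rewrite rpredB.
  by have -> : a%:Z = (k + a%:Z) - k by [ring]; rewrite rpredB.
rewrite psi_pairsum_pos //; set v := y + _.
have nP n : n < 0 -> n \in cls (- k) -> [/\ - N%:Z <= n, (m %| n - a%:Z)%Z = (m %| k + a%:Z)%Z & (m %| n + a%:Z)%Z = (m %| k - a%:Z)%Z].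
  rewrite mem_cls opprK => n0 /andP[nk nN]; split; first by lia.
    have -> : n - a%:Z = - (k + a%:Z) + (n + k) by ring.
    by rewrite (rpredDr _ nk) rpredN.
  have -> : n + a%:Z = - (k - a%:Z) + (n + k) by ring.
  by rewrite (rpredDr _ nk) rpredN.
case/orP: ka => ka.
  have ka' := ma2 _ ka.
  rewrite (@Zop_scalar k v (possum (- a%:Z) y) (-1)) // => [|n n0 nc]; last first.
    have [nN n1 n2] := nP _ n0 nc; rewrite ka' in n1; rewrite ka in n2.
    rewrite /v raddfD /= yk ?n2 ?orbT // add0r !psi_possum // n1 n2 yk ?n2 ?orbT // raddf0 subr0 sub0r.
    by rewrite raddfMz /= mulrN1 mulrNz.
  rewrite mk add0r (@possum_congr (- k) (- a%:Z)); last first.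
    by have -> : - k - - a%:Z = - (k - a%:Z) by [ring]; rewrite rpredN.
  rewrite /v raddfD /= possum_sq addr0 (ssumE (a := a)) //; last by move: am; clear; lia.
  rewrite isignE absz_nat (negbTE aev) pmulrn -mulrzDr.
  by rewrite mulr2n mulrN1 addNr mulr0z.
have ka' := ma2' _ ka.
rewrite (@Zop_scalar k v (possum a%:Z y) 1) // => [|n n0 nc]; last first.
  have [nN n1 n2] := nP _ n0 nc; rewrite ka in n1; rewrite ka' in n2.
  rewrite /v raddfD /= yk ?n1 // add0r !psi_possum // n1 n2 yk ?n1 // raddf0 subr0 raddf0 subr0.
  by rewrite mulr1.
rewrite mk add0r (@possum_congr (- k) a%:Z); last first.
  by have -> : - k - a%:Z = - (k + a%:Z) by [ring]; rewrite rpredN.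
rewrite /v raddfD /= possumC possum_sq raddf0 oppr0 addr0 (ssumE (a := (m - a)%N)) //; first last.
- have -> : k - (m - a)%N%:Z = k + a%:Z - m%:Z by move: am; clear; lia.
  by rewrite rpredB // dvdzz.
- by move: am; clear; lia.
rewrite isignE absz_nat oddB ?m_odd ?(negbTE aev) /=; last by move: am; clear; lia.
by rewrite pmulrn -mulrzDr mulr0z.
Qed.

Variable x0 : V.
Hypothesis psi_x0_neg : forall n, n < 0 -> psi n x0 = 0.
Hypothesis psi_x0_0 : psi 0 x0 = x0.

Lemma sum_cls0_x0 : \sum_(c <- cls 0) psi c x0 = x0 + possum 0 x0.
Proof.
have c0 : 0 \in cls 0 by rewrite mem_cls subrr dvdz0; lia.
rewrite (bigD1_seq _ c0 (cls_uniq _)) /= psi_x0_0; congr (_ + _).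
rewrite big_mkcond /possum [RHS]big_mkcond; apply: eq_bigr => i _.
by case: (ltrgtP i 0) => // i0; rewrite psi_x0_neg.
Qed.

Lemma Zop_zero k : 0 < k <= N%:Z -> (m %| k)%Z -> Zop k (boxprod [::] x0) = 0.
Proof.
move=> kN mk; rewrite /= sum_cls0_x0; set v := _ + _.
rewrite (@Zop_scalar k v x0 1) // => [|n n0]; last first.
  rewrite mem_cls opprK => /andP[nk nN].
  have mn : (m %| n)%Z by rewrite -(rpredDr _ mk).
  rewrite /v raddfD /= psi_x0_neg // add0r psi_possum //; last by lia.
  by rewrite addr0 mn psi_x0_neg // raddf0 subr0 mulr1.
rewrite mk (@possum_congr (- k) 0); last by rewrite subr0 rpredN.
have p0 : psi 0 (possum 0 x0) = - possum 0 x0.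
  rewrite /possum raddf_sum -sumrN; apply: eq_bigr => i i0 /=.
  by rewrite psi_anti ?psi_x0_0 // add0r gt_eqF.
rewrite /v !raddfD /= p0 psi_x0_0 possum_sq addr0 addrNK (ssumE (a := m)) //; first last.
- by rewrite rpredB // dvdzz.
- by case: (m) m_odd => //= m' _; rewrite leqnn.
by rewrite isign_odd // pmulrn -[x0 in X in _ + X]mulr1z -mulrzA -mulrzDr mulr0z.
Qed.

Lemma psi_boxprod_x0 s n : n < 0 -> avoid s n -> psi n (boxprod s x0) = 0.
Proof. by move=> n0 an; rewrite psi_boxprod // psi_x0_neg // raddf0 oppr0. Qed.

Definition admissible s := sep s /\ forall a, a \in s -> (0 < a < m)%N /\ ~~ odd a.

Lemma admissible_cons a s : admissible (a :: s) -> admissible s.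
Proof.
move=> [/= /andP[_ ss] sa]; split=> // b bs; apply: sa; by rewrite inE bs orbT.
Qed.

(** The operator Z_k commutes with all the factors except the one whose classes contain
    k, and that factor is treated by [Zop_pair] or, for the class 0, by [Zop_zero]. *)
Lemma Zop_boxprod s k : admissible s -> 0 < k <= N%:Z ->
  (m %| k)%Z || has (fun a : nat => (m %| k - a%:Z)%Z || (m %| k + a%:Z)%Z) s ->
  Zop k (boxprod s x0) = 0.
Proof.
move=> + kN; elim: s => [_|a s IHs]; first by rewrite orbF; exact: Zop_zero.
move=> adm; have [/= sep_s sa] := adm.
have [am aev] := sa a (mem_head _ _).
have ma : ~~ (m %| a%:Z)%Z by apply/negP => ma; have := dvdz_small ma; lia.
case: (boolP ((m %| k - a%:Z)%Z || (m %| k + a%:Z)%Z)) => [ka _|ka mks].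
  apply: (Zop_pair kN am aev ka) => n n0 na; apply: psi_boxprod_x0 => //.
  exact: class_dichotomy na.
have {}mks : (m %| k)%Z || has (fun a : nat => (m %| k - a%:Z)%Z || (m %| k + a%:Z)%Z) s.
  by move: mks ka; rewrite /=; do 3!case: (_ \in _) => //=.
have IH := IHs (admissible_cons adm) mks.
move: ka; rewrite negb_or => /andP[ka1 ka2].
have comm n : (m %| n + k)%Z -> psi n (pairsum a (boxprod s x0)) = pairsum a (psi n (boxprod s x0)).
  move=> nk; apply: psi_pairsum.
    apply: contra ka2 => na; have -> : k + a%:Z = (n + k) - (n - a%:Z) by ring.
    by rewrite rpredB.
  apply: contra ka1 => na; have -> : k - a%:Z = (n + k) - (n + a%:Z) by ring.
  by rewrite rpredB.
have ZW : Zop k (pairsum a (boxprod s x0)) = pairsum a (Zop k (boxprod s x0)).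
  have -> : pairsum a (Zop k (boxprod s x0)) = pairsum a (psi (- k) (boxprod s x0))
      + (\sum_(n <- cls (- k) | - k < n) pairsum a (psi n (boxprod s x0))) *+ 2.
    by rewrite /Zop [LHS]raddfD raddfMn raddf_sum.
  rewrite /Zop comm ?addNr ?dvdz0 //; congr (_ + _ *+ _).
  rewrite big_seq_cond [RHS]big_seq_cond; apply: eq_bigr => n /andP[nk _]; apply: comm.
  by move: nk; rewrite mem_cls opprK => /andP[].
have -> : Zop k (boxprod s x0 + pairsum a (boxprod s x0)) = Zop k (boxprod s x0) + Zop k (pairsum a (boxprod s x0)).
  rewrite /Zop [psi (- k) (_ + _)]raddfD /= [RHS]addrACA -mulrnDl -big_split; congr (_ + _ *+ _).
  by apply: eq_bigr => n _; rewrite [LHS]raddfD.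
by rewrite ZW IH raddf0 addr0.
Qed.

(** Applied to the vacuum, every factor acts by 1 plus products of creation operators,
    on whose images e vanishes. *)
Lemma expect_boxprod s (U : zmodType) (e : {additive V -> U}) :
  (forall n z, 0 < n -> e (psi n z) = 0) -> admissible s -> e (boxprod s x0) = e x0.
Proof.
move=> en; have eP c z : e (possum c z) = 0.
  by rewrite /possum raddf_sum big1 // => i i0 /=; apply: en.
elim: s => [_|a s IHs adm] /=; first by rewrite sum_cls0_x0 raddfD /= eP addr0.
have [sep_s sa] := adm; have [am _] := sa a (mem_head _ _).
rewrite raddfD /= psi_pairsum_pos ?eP ?addr0; first exact: IHs (admissible_cons adm).
  by apply/negP => ma; have := dvdz_small ma; lia.
by move=> n n0 na; apply: psi_boxprod_x0 => //; exact: class_dichotomy na.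
Qed.

End CliffordBox.

(** * The product as a vertex operator *)

Section LimitProduct.
Variables (G : skewRing) (m : nat).
Hypothesis m_odd : odd m.
Implicit Types (f g h : G) (d k n : int).
Local Notation q := (sk_q : int -> G).
Local Notation chi := (sk_chi G).
Local Notation V := (int -> G).

Lemma m_gt0 : (0 < m)%N.
Proof. by case: m m_odd. Qed.

(** B_k u^k on two-sided series in u over G; thus the degree in u is carried by the
    vectors and the Clifford computations apply unchanged. *)
Definition opu (k : int) (phi : V) : V := fun d => Bv k (phi (d - k)).

Lemma opu_zmod k : zmod_morphism (opu k).
Proof. by move=> phi psi; apply: functional_extensionality_dep => d; exact: (raddfB (Bv k)). Qed.
HB.instance Definition _ k := GRing.isZmodMorphism.Build V V (opu k) (opu_zmod k).

Lemma V_mulz (phi : V) (c : int) d : (phi *~ c) d = phi d *~ c.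
Proof.
have E (n : nat) : (phi *+ n) d = phi d *+ n by elim: n => // n IHn; rewrite !mulrS -IHn.
case: c => n; first exact: E.
by change (- ((phi *+ n.+1) d) = - (phi d *+ n.+1)); rewrite E.
Qed.

Lemma V_sum (I : Type) (r : seq I) (P : pred I) (F : I -> V) d :
  (\sum_(i <- r | P i) F i) d = \sum_(i <- r | P i) F i d.
Proof. by apply: (big_morph (fun phi : V => phi d)). Qed.

Definition opuA k : {additive V -> V} := opu k.

Lemma opu_cliff a b (phi : V) : opuA a (opuA b phi) + opuA b (opuA a phi) = phi *~ clif a b.
Proof.
apply: functional_extensionality_dep => d; rewrite V_mulz.
rewrite -[LHS]/(Bv a (Bv b (phi (d - a - b))) + Bv b (Bv a (phi (d - b - a)))).
have -> : d - b - a = d - a - b by ring.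
rewrite cliff /clif; case: eqP => [ab|_]; last by rewrite !mulr0z.
by have -> : d - a - b = d by lia.
Qed.

Lemma V_torsion (phi : V) : phi *+ 2 = 0 -> phi = 0.
Proof.
move=> E; apply: functional_extensionality_dep => d; apply: (@sk_torsion G 1).
by have := congr1 (fun f : V => f d) E; rewrite -[phi *+ 2]/(phi *~ 2) V_mulz.
Qed.

Definition delta g : V := fun d => if d == 0 then g else 0.
Definition shift (k : int) (phi : V) : V := fun d => phi (d - k).

Lemma opu_delta k g : opuA k (delta g) = shift k (delta (Bv k g)).
Proof.
apply: functional_extensionality_dep => d; rewrite /opuA /= /opu /shift /delta.
by case: eqP => // _; rewrite raddf0.
Qed.

Lemma opu_shift k l (phi : V) : opuA k (shift l phi) = shift l (opuA k phi).
Proof.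
apply: functional_extensionality_dep => d; rewrite /opuA /= /opu /shift.
by have -> : d - k - l = d - l - k by ring.
Qed.

Lemma nord_shift i j l phi : nord opuA i j (shift l phi) = shift l (nord opuA i j phi).
Proof.
by rewrite /nord; case: ifP => _; last case: ifP => _; rewrite ?opu_shift.
Qed.

Lemma shift_sum (I : Type) (r : seq I) (F : I -> V) l :
  shift l (\sum_(i <- r) F i) = \sum_(i <- r) shift l (F i).
Proof. by apply: functional_extensionality_dep => d; rewrite /shift !V_sum. Qed.

Lemma boxprod_shift N s l phi : boxprod opuA m N s (shift l phi) = shift l (boxprod opuA m N s phi).
Proof.
elim: s => [|a s IHs] /=.
  by rewrite shift_sum; apply: eq_bigr => k _; exact: opu_shift.
rewrite IHs; set psi := boxprod _ _ _ _ _.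
have -> : pairsum opuA m N a (shift l psi) = shift l (pairsum opuA m N a psi).
  rewrite /pairsum shift_sum; apply: eq_bigr => i _; rewrite shift_sum.
  by apply: eq_bigr => j _; exact: nord_shift.
by [].
Qed.

Lemma boxprod_hdeg N s phi : (forall d, hdeg d (phi d)) -> forall d, hdeg d (boxprod opuA m N s phi d).
Proof.
have opu_h k (psi : V) : (forall d, hdeg d (psi d)) -> forall d, hdeg d (opuA k psi d).
  by move=> H d; apply: hdeg_eq (hdeg_Bv k (H (d - k))) _; rewrite subrK.
have sum_h (I : Type) (r : seq I) (F : I -> V) : (forall i d, hdeg d (F i d)) ->
    forall d, hdeg d ((\sum_(i <- r) F i) d).
  move=> H d; rewrite V_sum; elim/big_ind: _ => *; [exact: hdeg_zero | exact: hdeg_add | exact: H].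
move=> H; elim: s => [|a s IHs] /=; first by apply: sum_h => k; exact: opu_h.
move=> d; apply: hdeg_add; first exact: IHs.
apply: (sum_h) => i; apply: sum_h => j; rewrite /nord.
case: ifP => _; first exact: (opu_h i _ (opu_h j _ IHs)).
case: ifP => _ e; last exact: hdeg_zero.
by apply: hdeg_opp; exact: (opu_h j _ (opu_h i _ IHs)).
Qed.

Definition evens : seq nat := [seq (2 * t)%N | t <- iota 1 m.-1./2].

Lemma mem_evens a : (a \in evens) = (0 < a < m)%N && ~~ odd a.
Proof.
have m1 := m_odd.
apply/mapP/idP => [[t]|am]; first by rewrite mem_iota => tm ->; lia.
by exists a./2; [rewrite mem_iota; lia | lia].
Qed.

Lemma admissible_evens : admissible m evens.
Proof.
split; last by move=> a; rewrite mem_evens => /andP[].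
have noz (c : int) : (m %| c)%Z -> - m%:Z < c < m%:Z -> c = 0 by exact: dvdz_small0.
suff H s : uniq s -> {subset s <= evens} -> sep m s.
  by apply: H => //; rewrite map_inj_uniq ?iota_uniq // => i j; lia.
elim: s => //= a s IHs /andP[as_ us] sub; rewrite IHs ?andbT //; last first.
  by move=> b bs; apply: sub; rewrite inE bs orbT.
have := sub a (mem_head _ _); rewrite mem_evens => /andP[am ae].
rewrite /avoid; apply/andP; split.
  by apply/negP => /noz; lia.
apply/allP => b bs; have := sub b; rewrite inE bs orbT mem_evens => /(_ isT) /andP[bm be].
have ab : a <> b by move=> E; rewrite E bs in as_.
apply/andP; split; first by apply/negP => /noz; lia.
apply/negP => ab0; have mm : (m %| a%:Z + b%:Z - m%:Z)%Z by rewrite rpredB // dvdzz.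
by have := noz _ mm; lia.
Qed.

Lemma evens_cover k :
  (m %| k)%Z || has (fun a : nat => (m %| k - a%:Z)%Z || (m %| k + a%:Z)%Z) evens.
Proof.
have m0 := m_gt0; have m1 := m_odd.
have km : (m %| k - (k %% m)%Z)%Z by rewrite {1}(divz_eq k m) addrK dvdz_mull.
have r0 : 0 <= (k %% m)%Z by apply: modz_ge0; lia.
have rm : (k %% m)%Z < m%:Z by apply: ltz_pmod; lia.
move: (k %% m)%Z km r0 rm => [] // r km _ rm.
case: (posnP r) => r0; first by subst r; move: km; rewrite subr0 => ->.
apply/orP; right; apply/hasP; case: (boolP (odd r)) => ro.
  exists (m - r)%N; first by rewrite mem_evens; lia.
  apply/orP; right; have -> : k + (m - r)%N%:Z = (k - r%:Z) + m%:Z by lia.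
  by rewrite rpredD // dvdzz.
by exists r; [rewrite mem_evens; lia | rewrite km].
Qed.

Variable limprod : int -> G -> G.
Hypothesis limprodP : forall d g, exists N0 : nat, forall N : nat, (N0 <= N)%N ->
  boxprod opuA m N evens (delta g) d = limprod d g.

Lemma limprod_zmod d : zmod_morphism (limprod d).
Proof.
move=> f g; have [N1 H1] := limprodP d f; have [N2 H2] := limprodP d g.
have [N3 H3] := limprodP d (f - g); pose N := (N1 + N2 + N3)%N.
rewrite -(H1 N) -?(H2 N) -?(H3 N); [|rewrite /N; lia..].
have -> : delta (f - g) = delta f - delta g.
  by apply: functional_extensionality_dep => e; rewrite /delta; case: ifP => // eE;
    rewrite -[RHS]/(delta f e - delta g e) /delta eE ?subr0.
by rewrite raddfB.
Qed.
HB.instance Definition _ d := GRing.isZmodMorphism.Build G G (limprod d) (limprod_zmod d).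

(** For k and k - m in place of k and l, whose signs differ, [boxprod_anticomm] passes to
    the limit. *)
Lemma limprod_anticomm d k g :
  limprod (d - k) (Bv k g) + Bv k (limprod (d - k) g)
  + (limprod (d - (k - m%:Z)) (Bv (k - m%:Z) g) + Bv (k - m%:Z) (limprod (d - (k - m%:Z)) g)) = 0.
Proof.
have [N1 H1] := limprodP (d - k) (Bv k g); have [N2 H2] := limprodP (d - k) g.
have [N3 H3] := limprodP (d - (k - m%:Z)) (Bv (k - m%:Z) g); have [N4 H4] := limprodP (d - (k - m%:Z)) g.
pose N := (N1 + N2 + N3 + N4 + absz k + m)%N.
rewrite -(H1 N) -?(H2 N) -?(H3 N) -?(H4 N); [|rewrite /N; lia..].
have kl : (m %| k - (k - m%:Z))%Z by rewrite opprB addrC subrK dvdzz.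
have := @boxprod_anticomm _ opuA opu_cliff m N evens k (k - m%:Z) (delta g) (proj1 admissible_evens) kl.
move=> /(_ ltac:(rewrite /N; lia) ltac:(rewrite /N; lia)).
rewrite !opu_delta !boxprod_shift isignB (isign_odd _ m_odd) mulrN1 mulrNz => E.
have {}E := congr1 (fun phi : V => phi d) E; move: E.
set X := shift k _ + _; set Y := shift _ _ + _ => E.
have Xd : X d = boxprod opuA m N evens (delta (Bv k g)) (d - k) + Bv k (boxprod opuA m N evens (delta g) (d - k)) by [].
have Yd : Y d = boxprod opuA m N evens (delta (Bv (k - m%:Z) g)) (d - (k - m%:Z))
  + Bv (k - m%:Z) (boxprod opuA m N evens (delta g) (d - (k - m%:Z))) by [].
rewrite -Xd -Yd; move: E.
rewrite -[(- (Y *~ _)) d]/(- ((Y *~ isign int k) d)) !V_mulz isignE.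
by case: (odd _); rewrite ?mulr1z ?mulrN1z; [move=> /oppr_inj -> | move=> ->]; rewrite addNr.
Qed.

Definition vacprod d : G := limprod d 1.

Lemma delta1_hdeg d : hdeg d (delta 1 d).
Proof. by rewrite /delta; case: eqP => [->|_]; [exact: hdeg_one | exact: hdeg_zero]. Qed.

Lemma vacprod_lt0 d : d < 0 -> vacprod d = 0.
Proof.
move=> d0; have [N HN] := limprodP d 1; rewrite /vacprod -(HN N) //.
exact: hdeg_lt0 (boxprod_hdeg N evens delta1_hdeg d) d0.
Qed.

Lemma vacprod_box (e : int) : exists N0 : nat, forall N : nat, (N0 <= N)%N ->
  forall d, d <= e -> boxprod opuA m N evens (delta 1) d = vacprod d.
Proof.
have neg N d : d < 0 -> boxprod opuA m N evens (delta 1) d = vacprod d.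
  by move=> d0; rewrite vacprod_lt0 //; exact: hdeg_lt0 (boxprod_hdeg N evens delta1_hdeg d) d0.
case: e => e; last by exists 0%N => N _ d de; apply: neg; lia.
elim: e => [|e [N1 H1]].
  have [N0 H0] := limprodP 0 1; exists N0 => N NN d d0.
  by case: (ltrP d 0) => dn; [exact: neg | have -> : d = 0 by [lia]; exact: H0].
have [N0 H0] := limprodP e.+1 1; exists (maxn N0 N1) => N NN d de.
case: (lerP d e%:Z) => dn; first by apply: H1 => //; lia.
by have -> : d = e.+1 by [lia]; apply: H0; lia.
Qed.

Lemma delta1_neg n : n < 0 -> opuA n (delta 1) = 0.
Proof.
move=> n0; rewrite opu_delta Bv_1 sk_q_lt0 //; apply: functional_extensionality_dep => d.
by rewrite /shift /delta; case: ifP.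
Qed.

Lemma delta1_0 : opuA 0 (delta 1) = delta 1.
Proof.
rewrite opu_delta Bv_1 sk_q0; apply: functional_extensionality_dep => d.
by rewrite /shift subr0.
Qed.

Lemma chi_vacprod d : chi (vacprod d) = (d == 0)%:R.
Proof.
have [N HN] := limprodP d 1; rewrite /vacprod -(HN N) //.
pose e (phi : V) := chi (phi d).
have ez : zmod_morphism e by move=> phi psi; rewrite /e -rmorphB.
pose eM := GRing.isZmodMorphism.Build V int e ez.
pose eA : {additive V -> int} := HB.pack e eM.
have en n z : 0 < n -> eA (opuA n z) = 0.
  by move=> n0; rewrite /= /e /opuA /= /opu chi_Bv ?ltW // gt_eqF.
have := @expect_boxprod _ opuA opu_cliff m N m_odd (delta 1) delta1_neg delta1_0 evens _ eA en admissible_evens.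
rewrite /= /e => ->; rewrite /delta; case: eqP => _; by rewrite ?rmorph1 ?rmorph0.
Qed.

(** A class modulo m above -k is the progression m - k, 2m - k, ...; beyond e the
    terms vanish. *)
Lemma cls_progression N k (F : int -> G) (T : nat) (e : int) : 0 < k <= N%:Z -> e <= N%:Z ->
  e < m%:Z * T.+1%:Z - k ->
  (forall n, e < n -> F n = 0) ->
  \sum_(n <- cls m N (- k) | - k < n) F n = \sum_(t < T) F (m%:Z * t.+1%:Z - k).
Proof.
move=> /andP[k0 kN] eN eT F0; have m0 := m_gt0.
rewrite -(big_mkord xpredT (fun t => F (m%:Z * t.+1%:Z - k))).
rewrite -(big_map (fun t : nat => m%:Z * t.+1%:Z - k) xpredT F) -big_filter.
rewrite (bigID (fun n => n <= e)) [RHS](bigID (fun n => n <= e)) /=.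
rewrite [X in _ + X = _]big1 => [|n]; last by move=> ne; apply: F0; move: ne; clear; lia.
rewrite [X in _ = _ + X]big1 => [|n]; last by move=> ne; apply: F0; move: ne; clear; lia.
rewrite !addr0 -big_filter -[RHS]big_filter; apply: perm_big; apply: uniq_perm.
- by apply: filter_uniq; exact: cls_uniq.
- have inj : injective (fun t : nat => m%:Z * t.+1%:Z - k) by move=> t t'; move: m0; clear; nia.
  have um : uniq [seq m%:Z * t.+1%:Z - k | t : nat <- index_iota 0 T].
    by rewrite (map_inj_uniq inj); exact: iota_uniq.
  exact: filter_uniq (filter_uniq _ um).
move=> n; rewrite mem_filter mem_cls opprK !mem_filter; apply/idP/idP.
  move=> /andP[/andP[kn ne] /andP[/dvdzP[c nc] _]]; rewrite ne /=; apply/mapP.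
  have c0 : 0 < c by move: m0 kn nc; clear; nia.
  exists (absz c).-1; first by rewrite mem_index_iota; move: m0 kn nc c0 eT ne; clear; nia.
  have -> : ((absz c).-1.+1)%:Z = c by move: c0; clear; lia.
  by move: nc; clear; lia.
move=> /and3P[ne _ /mapP[t]]; rewrite mem_index_iota => /andP[_ tT] nE; rewrite ne andbT.
have mt0 : 0 < m%:Z * t.+1%:Z by rewrite mulr_gt0 // ltz_nat.
apply/andP; split; first by rewrite nE ltrBrDl subrr.
rewrite nE subrK dvdz_mulr ?dvdzz //= -nE.
by move: ne eN nE mt0 k0 kN; move: (m%:Z * _) => mt; clear; lia.
Qed.

(** [Zop_boxprod] in degree d - k. *)
Lemma vacprod_rel k d (T : nat) : 0 < k -> d < m%:Z * T.+1%:Z ->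
  Bv (- k) (vacprod d) + (\sum_(t < T) Bv (m%:Z * t.+1%:Z - k) (vacprod (d - m%:Z * t.+1%:Z))) *+ 2 = 0.
Proof.
move=> k0 dT; have [N0 HN0] := vacprod_box d; pose N := (N0 + absz d + absz k)%N.
have HN e : e <= d -> boxprod opuA m N evens (delta 1) e = vacprod e by apply: HN0; rewrite /N; lia.
have kN : 0 < k <= N%:Z by rewrite /N; lia.
have := @Zop_boxprod _ opuA opu_cliff V_torsion m N m_odd (delta 1) delta1_neg delta1_0 evens k
  admissible_evens kN (evens_cover k).
move=> /(congr1 (fun phi : V => phi (d - k))); rewrite /Zop.
set S := \sum_(n <- _ | _) _; set A := opuA _ _ => E.
have {}E : A (d - k) + (S (d - k)) *+ 2 = 0 by exact: E.
move: E; rewrite /S V_sum.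
have -> : A (d - k) = Bv (- k) (vacprod d).
  by rewrite /A /opuA /= /opu opprK subrK HN.
have opE n : - k < n -> opuA n (boxprod opuA m N evens (delta 1)) (d - k) = Bv n (vacprod (d - k - n)).
  by move=> nk; rewrite /opuA /= /opu HN //; lia.
rewrite (eq_bigr _ opE) (@cls_progression N k (fun n => Bv n (vacprod (d - k - n))) T (d - k)) //; first last.
- by move=> n nd; rewrite vacprod_lt0 ?raddf0 //; lia.
- by lia.
- by rewrite /N; lia.
move=> E; rewrite -[RHS]E; congr (_ + _ *+ _); apply: eq_bigr => t _.
by congr (Bv _ (vacprod _)); ring.
Qed.

Lemma sk_q_rel_int (t : int) (A : nat) : t < A%:Z ->
  \sum_(a < A) (-1) ^+ a * q a * q (t - a%:Z) = (t == 0)%:R.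
Proof.
case: t => t tA; last first.
  rewrite big1 // => a _; rewrite (sk_q_lt0 (n := Negz t - a%:Z)) ?mulr0 //; lia.
have -> : A = (t.+1 + (A - t.+1))%N by lia.
rewrite big_split_ord /= [X in _ + X]big1 ?addr0 => [|a _]; last first.
  by rewrite (sk_q_lt0 (n := _ - _)) ?mulr0 //; lia.
rewrite eqz_nat -sk_q_rel; apply: eq_bigr => a _.
have -> : t%:Z - a%:Z = (t - a)%N%:Z by move: (ltn_ord a); clear; lia.
by ring.
Qed.

Definition sk_size f : nat := size (sk_addvar G f).

(** The relation q(v) q(-v) = 1 inverts B(v) = q(v) q(-1/v)^perp. *)
Lemma skew_from_Bv f (j : int) (A : nat) : (sk_size f + absz j <= A)%N ->
  \sum_(a < A) (-1) ^+ a * q a * Bv (- j - a%:Z) f = isign G j * skew j f.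
Proof.
move=> fA; have bnd : forall k : int, (sk_size f)%:Z <= k -> skew k f = 0 by exact: skew_ge.
under eq_bigr => a _ do rewrite (BvE _ bnd) mulr_sumr.
rewrite exchange_big /=.
rewrite (eq_bigr (fun i : 'I_(sk_size f) => (-1) ^+ i * (i%:Z - j == 0)%:R * skew i f)); last first.
  move=> i _; rewrite -(@sk_q_rel_int (i%:Z - j) A); last by move: (ltn_ord i) fA; clear; lia.
  rewrite mulr_sumr mulr_suml; apply: eq_bigr => a _.
  have -> : - j - a%:Z + i%:Z = i%:Z - j - a%:Z by ring.
  by ring.
case: (boolP (0 <= j < (sk_size f)%:Z)) => [jf|jf].
  case: j jf fA => // j jf fA; have {}jf : (j < sk_size f)%N by lia.
  rewrite (bigD1 (Ordinal jf)) //= subrr eqxx mulr1 isign_nat big1 ?addr0 // => i.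
  rewrite -val_eqE /= => ij; have -> : (i%:Z - j%:Z == 0) = false by move: ij; clear; lia.
  by rewrite mulr0 mul0r.
rewrite big1 => [|i _]; last first.
  have -> : (i%:Z - j == 0) = false by move: jf (ltn_ord i); clear; lia.
  by rewrite mulr0 mul0r.
case: (ltrP j 0) => j0; first by rewrite skew_lt0 // mulr0.
by rewrite bnd ?mulr0 //; move: jf j0; clear; lia.
Qed.

(** The combination of the [vacprod_rel] with k = j + a and coefficients (-1)^a q_a. *)
Lemma skew_vacprod_rel j d (T : nat) : 0 < j -> d < m%:Z * T.+1%:Z ->
  skew j (vacprod d) + (\sum_(t < T) (-1) ^+ t.+1 * skew (j - m%:Z * t.+1%:Z) (vacprod (d - m%:Z * t.+1%:Z))) *+ 2 = 0.
Proof.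
move=> j0 dT; pose w (t : nat) := vacprod (d - m%:Z * t.+1%:Z).
pose b (t : nat) := (sk_size (w t) + absz (j - m%:Z * t.+1%:Z)%R)%N.
pose A := (sk_size (vacprod d) + absz j + \max_(t < T) b t)%N.
have : \sum_(a < A) (-1) ^+ a * q a * Bv (- (j + a%:Z)) (vacprod d) +
    (\sum_(t < T) \sum_(a < A) (-1) ^+ a * q a * Bv (m%:Z * t.+1%:Z - (j + a%:Z)) (w t)) *+ 2 = 0.
  rewrite exchange_big -sumrMnl -big_split big1 // => a _ /=.
  have Y := @vacprod_rel (j + a%:Z) d T _ dT.
  by rewrite -mulr_sumr -mulrnAr -mulrDr Y ?mulr0 //; move: j0; clear; lia.
rewrite (eq_bigr (fun a : 'I_A => (-1) ^+ a * q a * Bv (- j - a%:Z) (vacprod d))); last by move=> a _; rewrite opprD.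
rewrite skew_from_Bv; last by rewrite /A; lia.
rewrite (eq_bigr (fun t : 'I_T => isign G (j - m%:Z * t.+1%:Z) * skew (j - m%:Z * t.+1%:Z) (w t))); last first.
  move=> t _; rewrite -(@skew_from_Bv _ _ A); last first.
    have := leq_bigmax (F := fun t : 'I_T => b t) t; rewrite -/(b t) /A.
    by move: (b t) (\max_(i < T) _)%N => b' M' bM; move: bM; clear; lia.
  apply: eq_bigr => a _.
  have -> : m%:Z * t.+1%:Z - (j + a%:Z) = - (j - m%:Z * t.+1%:Z) - a%:Z by rewrite opprB opprD addrA.
  by [].
move=> E; have {}E := congr1 ( *%R (isign G j)) E; move: E.
rewrite mulr0 mulrDr mulrA isign_sq mul1r mulrnAr mulr_sumr => E.
rewrite -[RHS]E; congr (_ + _ *+ _); apply: eq_bigr => t _.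
rewrite mulrA isignB mulrA isign_sq mul1r; congr (_ * _).
by rewrite /isign abszM absz_nat exprM -[(-1) ^+ m]signr_odd m_odd.
Qed.

(** A new variable w multiplies the image of 1 by (1 + (uw)^m) / (1 - (uw)^m): the sum
    of the relations [skew_vacprod_rel] for j and for j - m has only two terms. *)
Lemma skew_vacprod j d : skew j (vacprod d) =
  skew (j - m%:Z) (vacprod (d - m%:Z)) + (vacprod d *+ (j == 0) + vacprod (d - m%:Z) *+ (j == m%:Z)).
Proof.
have m0 := m_gt0.
case: (ltrgtP j 0) => j0.
- rewrite !skew_lt0 //; [|by lia]; rewrite add0r mulr0n add0r.
  by case: eqP => [|_]; [lia|].
- rewrite mulr0n add0r; pose T := absz d.
  have dT : d < m%:Z * T.+2%:Z by rewrite /T; move: m0; clear; nia.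
  have := skew_vacprod_rel j0 dT; rewrite big_ord_recl /= expr1 mulN1r mulr1.
  case: (ltrgtP j m%:Z) => jm.
  + rewrite (skew_lt0 (i := j - m%:Z)) ?subr_lt0 // oppr0 big1 => [|t _].
      by rewrite ?addr0 ?mul0rn ?addr0 => ->; rewrite ?mulr0n ?addr0.
    rewrite skew_lt0 ?mulr0 //; move: jm m0; rewrite /bump /=; clear; nia.
  + have jm0 : 0 < j - m%:Z by rewrite subr_gt0.
    have dT' : d - m%:Z < m%:Z * T.+1%:Z by rewrite /T; move: m0; clear; nia.
    have := skew_vacprod_rel jm0 dT'.
    set S := \sum_(t < T) _; set S' := \sum_(t < T) _ => E E'.
    have SS : S' = - S.
      rewrite /S' /S -sumrN; apply: eq_bigr => t _; rewrite /bump /= add1n.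
      have -> : j - m%:Z * t.+2%:Z = j - m%:Z - m%:Z * t.+1%:Z by rewrite -!natz; ring.
      have -> : d - m%:Z * t.+2%:Z = d - m%:Z - m%:Z * t.+1%:Z by rewrite -!natz; ring.
      by rewrite [(-1) ^+ t.+2]exprS mulN1r mulNr.
    rewrite mulr0n !addr0; move: E E'; rewrite SS; clear.
    move: (skew j _) (skew _ _) S => x a S E E'; apply/eqP; rewrite -subr_eq0.
    have -> : x - a = (x + (- a + - S) *+ 2) + (a + S *+ 2) by ring.
    by rewrite E E' addr0.
  + rewrite jm subrr skew0 big1 => [|t _].
      rewrite addr0 mulr1n mulNrn => /eqP; rewrite subr_eq0 => /eqP ->.
      by rewrite mulr2n.
    rewrite skew_lt0 ?mulr0 //; move: m0; rewrite /bump /=; clear; nia.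
- subst j; rewrite skew0 mulr1n (skew_lt0 (i := 0 - m%:Z)); last by lia.
  by rewrite add0r; case: eqP => [|_]; [lia | rewrite addr0].
Qed.

Lemma addvar_two_term (u w : G) :
  (forall k, skew k u = skew (k - m%:Z) w + (u *+ (k == 0) + w *+ (k == m%:Z))) ->
  sk_addvar G u = 'X^m * sk_addvar G w + (u%:P + 'X^m * w%:P).
Proof.
move=> E; have m0 := m_gt0.
apply/polyP => k; rewrite !coefD !coefXnM !coefC -skewE E; congr (_ + (_ + _)).
- case: ltnP => km; first by rewrite skew_lt0 //; lia.
  by rewrite -skewE subzn.
- by rewrite eqz_nat; case: eqP.
- rewrite eqz_nat; case: (ltngtP k m) => km; rewrite ?mulr0n //; last by rewrite km subnn.
  by rewrite subn_eq0 leqNgt km.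
Qed.

Lemma skew_two_term (u w : G) :
  (forall k, skew k u = skew (k - m%:Z) w + (u *+ (k == 0) + w *+ (k == m%:Z))) ->
  forall k f, skew k (u * f) = skew (k - m%:Z) (w * f) + (u * skew k f + w * skew (k - m%:Z) f).
Proof.
move=> /addvar_two_term pE; have m0 := m_gt0.
case=> k f; last by rewrite !skew_lt0 ?mulr0 ?addr0 //; lia.
rewrite !skewE rmorphM pE !mulrDl -!mulrA !coefD !coefXnM coefCM.
case: ltnP => km; first by rewrite !(skew_lt0 (i := k%:Z - m%:Z)) ?mulr0 ?addr0 //; lia.
by rewrite subzn // !skewE rmorphM coefCM.
Qed.

Definition powvac n : G := vacprod (m%:Z * n).

Lemma powvac_lt0 n : n < 0 -> powvac n = 0.
Proof. by move=> n0; apply: vacprod_lt0; move: m_gt0; nia. Qed.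

Lemma skew_powvacM k n f : skew k (powvac n * f) =
  skew (k - m%:Z) (powvac (n - 1) * f) + (powvac n * skew k f + powvac (n - 1) * skew (k - m%:Z) f).
Proof.
apply: skew_two_term => {}k; rewrite /powvac skew_vacprod.
by have -> : m%:Z * n - m%:Z = m%:Z * (n - 1) by ring.
Qed.

Lemma ipC f g : ip f g = ip g f.
Proof.
elim/strict_ind: f => [la sla|f f' IHf IHf']; last by rewrite ipBl ipBr IHf IHf'.
by rewrite ip_Qr // ip_Xl.
Qed.

(** The adjoint of [skew_powvacM]. *)
Lemma adj_powvacM i k f : adj (powvac i) (q k * f) =
  adj (powvac (i - 1)) (q (k - m%:Z) * f) + (q k * adj (powvac i) f + q (k - m%:Z) * adj (powvac (i - 1)) f).
Proof.
have ipq j g h : ip (q j * g) h = ip g (skew j h) by rewrite ipC -ip_skew ipC.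
apply: ip_injl => h; rewrite !ipDl !adjP !ipq !adjP skew_powvacM !ipDr.
by [].
Qed.

Lemma adj_powvac_bound f : exists N : nat, forall n : int, N%:Z <= n -> adj (powvac n) f = 0.
Proof.
have m0 := m_gt0.
elim/sk_ind: f => [|f g [N HN] [M HM]|k f [N HN]].
- exists 1%N => n n1; rewrite adj_1 chi_vacprod.
  by case: eqP => // E; move: m0 E n1; clear; nia.
- by exists (maxn N M) => n nNM; rewrite raddfB /= HN ?HM ?subr0 //; lia.
elim/int_strong_ind: k => [k k0|k IHk].
  by exists 0%N => n _; rewrite sk_q_lt0 // mul0r raddf0.
have [M HM] := IHk (k - m%:Z) ltac:(lia).
exists (maxn N M).+1 => n nNM.
by rewrite adj_powvacM HM ?HN ?(HN (n - 1)) ?mulr0 ?addr0 //; lia.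
Qed.

Definition zpair : vertexPair G :=
  @VertexPair G m powvac (fun n => adj (powvac n) : {additive G -> G}) m_odd powvac_lt0
    (fun n f neg => etrans (congr1 (fun h => adj h f) (powvac_lt0 neg)) (adj0 f))
    adj_powvac_bound
    (fun i j f => etrans (congr1 (adj (powvac i)) (adj_q j f)) (etrans (adjC (powvac i) (q j) f) (esym (adj_q j _))))
    adj_powvacM skew_powvacM.

Definition powvop d g : G := if (m %| d)%Z then vop zpair (d %/ m)%Z g else 0.

Lemma powvop_zmod d : zmod_morphism (powvop d).
Proof. by move=> f g; rewrite /powvop; case: ifP => _; rewrite ?subr0 // raddfB. Qed.
HB.instance Definition _ d := GRing.isZmodMorphism.Build G G (powvop d) (powvop_zmod d).

Lemma powvop_anticomm d k g :
  powvop (d - k) (Bv k g) + Bv k (powvop (d - k) g)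
  + (powvop (d - (k - m%:Z)) (Bv (k - m%:Z) g) + Bv (k - m%:Z) (powvop (d - (k - m%:Z)) g)) = 0.
Proof.
have dk : d - (k - m%:Z) = d - k + m%:Z by ring.
rewrite /powvop dk (rpredDr _ (dvdzz m)); case: ifP => mdk; last by rewrite !raddf0 !addr0.
have -> : ((d - k + m%:Z) %/ m)%Z = ((d - k) %/ m)%Z + 1.
  by rewrite divzDr ?dvdzz // divzz; have := m_gt0; case: (m).
have := vop_Bv zpair ((d - k) %/ m)%Z k g; rewrite /= => E; rewrite -[RHS]E.
by rewrite addrACA.
Qed.

(** By [skew_vacprod], taking coefficients of new variables changes d by multiples of m
    only, and the constant term is concentrated in degree 0. *)
Lemma vacprod_ndvd d : ~~ (m %| d)%Z -> vacprod d = 0.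
Proof.
move=> md; pose P f := exists e c, ~~ (m %| e)%Z /\ f = vacprod e *+ c.
apply: (sk_eq0 (P := P)); last by exists d, 1%N.
  move=> f k [e [c [me ->]]]; rewrite -skewE.
  have [c' [e' [me' E]]] : exists c' e', ~~ (m %| e')%Z /\ skew k (vacprod e) = vacprod e' *+ c'.
    have m0 := m_gt0; have Em x : (m %| x - m%:Z)%Z = (m %| x)%Z by rewrite (rpredBr _ (dvdzz m)).
    elim/int_strong_ind: (k%:Z) e me => [j j0|j IHj] e me.
      by exists 0%N, e; rewrite skew_lt0.
    have me' : ~~ (m %| e - m%:Z)%Z by rewrite Em.
    rewrite skew_vacprod; case: (j =P 0) => [j0|j0].
      exists 1%N, e; split=> //; rewrite skew_lt0; last by lia.
      by case: eqP => [|_]; [lia | rewrite add0r addr0].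
    case: (j =P m%:Z) => [->|jm].
      by exists 2%N, (e - m%:Z); split=> //; rewrite subrr skew0 mulr0n add0r mulr1n mulr2n.
    have [c' [e' [me'' E]]] := IHj (j - m%:Z) ltac:(lia) _ me'.
    by exists c', e'; split=> //; rewrite E !mulr0n !addr0.
  exists e', (c' * c)%N; split=> //; by rewrite raddfMn /= E mulrnA.
move=> f [e [c [me ->]]]; rewrite raddfMn /= chi_vacprod.
by case: eqP => [e0|_]; [move: me; rewrite e0 dvdz0 | rewrite mul0rn].
Qed.

Lemma powvop_1 d : powvop d 1 = vacprod d.
Proof.
rewrite /powvop; case: ifP => md; last by rewrite vacprod_ndvd ?md.
have chi_powvac n : chi (powvac n) = (n == 0)%:R.
  by rewrite chi_vacprod; congr ((_ : bool)%:R); move: m_gt0; clear; nia.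
rewrite (@vopE _ _ _ _ 1) => [|k k1] /=; last first.
  by rewrite adj_1 chi_powvac; case: eqP => //; lia.
rewrite big_ord1 expr0 mul1r addr0 /= adj_1 chi_powvac eqxx mulr1 /powvac mulrC divzK //.
Qed.

(** The difference of both sides satisfies the same exchange relation and kills 1.  If it
    kills f, it takes on B_k f the same value up to sign as on B_(k - mn) f, which is 0 for
    n large. *)
Lemma limprod_powvop d g : limprod d g = powvop d g.
Proof.
pose D e f := limprod e f - powvop e f.
suff : forall d, D d g = 0 by move=> /(_ d) /eqP; rewrite subr_eq0 => /eqP.
have Danti e k f : D (e - k) (Bv k f) + Bv k (D (e - k) f)
  + (D (e - (k - m%:Z)) (Bv (k - m%:Z) f) + Bv (k - m%:Z) (D (e - (k - m%:Z)) f)) = 0.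
  rewrite /D ![Bv _ (_ - _)]raddfB /= -[RHS](subrr 0) -{1}(limprod_anticomm e k f) -{1}(powvop_anticomm e k f).
  by ring.
elim/Bv_ind: g => {d} [|f g Df Dg|k f Df] d.
- by rewrite /D powvop_1 subrr.
- by rewrite /D !raddfB /= -[RHS](subrr 0) -{1}(Df d) -(Dg d) /D; ring.
have m0 := m_gt0; have [e He] := Bv_low f.
have step (n : nat) k' : D (d + k - k') (Bv k' f) = (-1) ^+ n * D (d + k - (k' - m%:Z * n%:Z)) (Bv (k' - m%:Z * n%:Z) f).
  elim: n k' => [|n IHn] k'; first by rewrite expr0 mul1r mulr0 !subr0.
  have := Danti (d + k) k' f; rewrite !Df !raddf0 !addr0 => /eqP; rewrite addr_eq0 => /eqP ->.
  rewrite (IHn (k' - m%:Z)) exprS mulN1r mulNr.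
  have -> : k' - m%:Z - m%:Z * n%:Z = k' - m%:Z * n.+1%:Z by rewrite -!natz; ring.
  by [].
have -> : d = d + k - k by ring.
rewrite (step (absz k + e).+1) He; first by rewrite /D !raddf0 addr0 mulr0.
have N0 : (absz k + e).+1%:Z <= m%:Z * (absz k + e).+1%:Z.
  by move: (absz k + e).+1 m0 => N m0; clear -m0; nia.
by move: (m%:Z * _) N0 => x; clear; lia.
Qed.

End LimitProduct.

(** * The inner product and the operators of the statement *)

Section Identification.

Lemma schurQ2E a b : schurQ2 a b = Xw [:: a%:Z; b%:Z] :> Gamma_skewRing.
Proof. by rewrite /Xw /= Bv_1 Bv_q_nat. Qed.

Lemma schurQE la : schurQ la = Qw la :> Gamma_skewRing.
Proof.
rewrite /schurQ /Qw; case: ifP => sla.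
  rewrite (@Xw_pfaffian Gamma_skewRing _ _ _ _ schurQ2E); last first.
    by rewrite size_rcons -[in LHS](odd_double_half (size la)) sla uphalf_half sla /=; lia.
  by rewrite map_rcons Xw_rcons sk_q0.
rewrite (@Xw_pfaffian Gamma_skewRing _ _ _ _ schurQ2E) //.
by rewrite uphalf_half sla add0n -[LHS]odd_double_half sla.
Qed.

Lemma gamma_formE (f g : Gamma_skewRing) : gamma_form f g = ip f g.
Proof.
have : is_gamma_form gamma_form.
  apply: (xgetPex (fun _ _ => 0)); exists (@ip Gamma_skewRing); split.
  - exact: (@ipDl Gamma_skewRing).
  - exact: (@ipDr Gamma_skewRing).
  - by move=> la mu sla smu; rewrite !schurQE; exact: (@ip_strict Gamma_skewRing).
move=> [Dl Dr Q]; apply: (@ip_uniq Gamma_skewRing).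
- by move=> u v w; apply/eqP; rewrite eq_sym subr_eq; apply/eqP; rewrite -Dl subrK.
- by move=> u v w; apply/eqP; rewrite eq_sym subr_eq; apply/eqP; rewrite -Dr subrK.
- by move=> la mu sla smu; rewrite -!schurQE Q.
Qed.

Lemma perpE (f : Gamma_skewRing) : perp f =1 adj f.
Proof.
suff H : forall g h, gamma_form (perp f g) h = gamma_form g (f * h).
  by apply: (@adj_uniq Gamma_skewRing) => g h; rewrite -!gamma_formE H.
apply: (xgetPex (fun _ => 0) (P := [set T : Gamma -> Gamma | forall g h, gamma_form (T g) h = gamma_form g (f * h)])).
by exists (adj f) => g h; rewrite !gamma_formE; exact: (@adjP Gamma_skewRing).
Qed.

Lemma BopE n (g : Gamma_skewRing) : Bop n g = Bv n g.
Proof.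
apply: eq_fsbigr => i _; congr (_ * _).
by rewrite perpE /= (@adj_q Gamma_skewRing).
Qed.

End Identification.

(** * The substitution of the m-th powers of the variables *)

Section PowerSubstitution.
Variable m : nat.

Definition powt N : N.-tuple {mpoly int[N]} := [tuple 'X_i ^+ m | i < N].

Lemma comp_pow_mwiden N (p : {mpoly int[N]}) :
  (mwiden p) \mPo (powt N.+1) = mwiden (p \mPo (powt N)).
Proof.
elim/mpolyind: p => [|c k p _ _ IHp]; first by rewrite mwiden0 !comp_mpoly0 mwiden0.
rewrite !(mwidenD, mwidenZ, comp_mpolyD, comp_mpolyZ) IHp; congr (_ *: _ + _).
rewrite mwidenX !comp_mpolyX rmorph_prod big_ord_recr /= mnmwiden_ordmax expr0 mulr1.
apply: eq_bigr => i _; rewrite mnmwiden_widen !tnth_mktuple !rmorphXn /=.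
by rewrite mwidenX mnmwiden1.
Qed.

Lemma evalN_q_rec N (n : int) : evalN N.+1 (qfun n) =
  'X_ord_max * evalN N.+1 (qfun (n - 1)) + (mwiden (evalN N (qfun n)) + 'X_ord_max * mwiden (evalN N (qfun (n - 1)))).
Proof.
apply: muni_inj; rewrite !(muniD, muniM) muni_Xmax !muni_mwiden !addvarP.
have := addvar_q n => /eqP; rewrite subr_eq => /eqP ->.
by rewrite !rmorphD !rmorphM /= map_polyX !map_polyC addrC.
Qed.

Definition qpow N (n : int) : {mpoly int[N]} := evalN N (qfun n) \mPo powt N.

Lemma muni_qpow N (n : int) : muni (qpow N.+1 n) =
  'X^m * muni (qpow N.+1 (n - 1)) + ((qpow N n)%:P + 'X^m * (qpow N (n - 1))%:P).
Proof.
rewrite {1}/qpow evalN_q_rec !rmorphD !rmorphM /= !comp_pow_mwiden.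
rewrite comp_mpolyXU -tnth_nth tnth_mktuple.
by rewrite rmorphXn /= muni_Xmax !muni_mwiden.
Qed.

Lemma qpow_lt0 N n : n < 0 -> qpow N n = 0.
Proof. by move=> n0; rewrite /qpow qfun_lt0 // !raddf0. Qed.

Lemma qpow0 n : qpow 0 n = ((n == 0)%:R)%:MP.
Proof.
rewrite /qpow [evalN 0 _]mpoly0E comp_mpolyC; congr (_%:MP).
by rewrite -chi_q chi.unlock.
Qed.

(** The q_n(X^m) satisfy the recursion assumed of z in each number of variables, so they
    agree with z by induction on the number of variables and on n; in particular they
    belong to Gamma. *)
Lemma qfun_pow_uniq (z : int -> Gamma_skewRing) :
  (forall n, n < 0 -> z n = 0) -> (forall n, chi (z n) = (n == 0)%:R) ->
  (forall n, addvar (z n) = 'X^m * addvar (z (n - 1)) + ((z n)%:P + 'X^m * (z (n - 1))%:P)) ->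
  forall n, qfun_pow m n = z n.
Proof.
move=> z0 zc zX n.
have zE N k : evalN N (z k) = qpow N k.
  elim: N k => [|N IHN] k.
    by rewrite [LHS]mpoly0E qpow0 -zc; congr (_%:MP); rewrite chi.unlock.
  elim/int_strong_ind: k => [k k0|k IHk]; first by rewrite z0 // qpow_lt0 // raddf0.
  apply: muni_inj; rewrite muni_qpow addvarP zX.
  rewrite !rmorphD !rmorphM /= map_polyXn !map_polyC /= -addvarP.
  by rewrite !IHN (IHk (k - 1)) //; lia.
rewrite /qfun_pow.
have -> : pow_vars m (qfun n) = sf_val (gamma_val (z n)).
  apply: functional_extensionality_dep => N; have := zE N n.
  by rewrite /qpow evalN.unlock.
by rewrite !valKd.
Qed.

End PowerSubstitution.

(** * The expanded product *)

Section OperatorSeries.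
Variable m : nat.
Implicit Types (d k i j : int) (s : seq nat) (g : Gamma).
Local Open Scope classical_set_scope.

Definition tailS : opseries :=
  @OpSeries int [set k : int | (k = 0 %[mod m])%Z] (fun k => k) Bop.

Definition pairS (a : nat) : opseries :=
  @OpSeries (int * int)%type
    [set ij : int * int |
       (ij.1 = - a%:Z %[mod m])%Z /\ (ij.2 = a%:Z %[mod m])%Z]
    (fun ij => ij.1 + ij.2) (fun ij => Bop2 ij.1 ij.2).

Fixpoint prodS s : opseries :=
  if s is a :: s' then os_mul (os_add os_one (pairS a)) (prodS s') else tailS.

Lemma prodSE s : foldr os_mul tailS [seq os_add os_one (pairS a) | a <- s] = prodS s.
Proof. by elim: s => //= a s ->. Qed.

Definition pair_terms (N a : nat) : seq (unit + int * int) :=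
  inl tt :: [seq inr ij | ij <- [seq (i, j) | i <- cls m N (- a%:Z), j <- cls m N a%:Z]].

Fixpoint terms (N : nat) s : seq (os_idx (prodS s)) :=
  if s is a :: s' then [seq (x, t) | x <- pair_terms N a, t <- terms N s'] else cls m N 0.

Lemma mem_terms_cons N a s x (t : os_idx (prodS s)) :
  x \in pair_terms N a -> t \in terms N s -> ((x, t) : os_idx (prodS (a :: s))) \in terms N (a :: s).
Proof. exact: (allpairs_f (fun x t => (x, t))). Qed.

Lemma terms_uniq N s : uniq (terms N s).
Proof.
elim: s => [|a s IHs] /=; first exact: cls_uniq.
rewrite -[map _ _ ++ _]/([seq (x, t) | x <- pair_terms N a, t <- terms N s]).
apply: allpairs_uniq => //; last by move=> [? ?] [? ?] _ _ [-> ->].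
rewrite /pair_terms cons_uniq map_inj_uniq; last by move=> ? ? [].
apply/andP; split; first by apply/mapP => -[].
by apply: allpairs_uniq; rewrite ?cls_uniq // => -[? ?] [? ?] _ _ [-> ->].
Qed.

Lemma modzE k c : (k = c %[mod m])%Z <-> (m %| k - c)%Z.
Proof. by rewrite -eqz_mod_dvd; apply: (rwP eqP). Qed.

Lemma terms_dom N s t : t \in terms N s -> os_dom t.
Proof.
elim: s t => [|a s IHs] /= t.
  by rewrite mem_cls => /andP[/modzE].
move=> /(@allpairsP _ _ _ (fun x t => (x, t)) (pair_terms N a) (terms N s)) [[x t'] [/= xP tP ->]].
split=> /=; last exact: IHs.
move: xP; rewrite inE => /orP[/eqP -> //|/mapP[_ /allpairsP[[i j] [/= iP jP ->]] ->]] /=.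
by move: iP jP; rewrite !mem_cls => /andP[/modzE ? _] /andP[/modzE ? _].
Qed.

Definition BvA k : {additive Gamma_skewRing -> Gamma_skewRing} := Bv k.

Lemma Bop2E i j (g : Gamma_skewRing) : Bop2 i j g = nord BvA i j g.
Proof. by rewrite /Bop2 /nord !BopE. Qed.

Lemma op_zmod s (t : os_idx (prodS s)) : zmod_morphism (os_op t).
Proof.
elim: s t => [|a s IHs] /= => [t f g|[x t] f g /=].
  by rewrite !BopE raddfB.
rewrite IHs; case: x => [[]|[i j]] //=.
by rewrite !Bop2E nordB.
Qed.

Lemma op0 s (t : os_idx (prodS s)) : os_op t 0 = 0.
Proof. by have := op_zmod t 0 0; rewrite !subrr. Qed.

Lemma nord_sum (V : zmodType) (psi : int -> {additive V -> V}) i j (I : Type) (r : seq I) (F : I -> V) :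
  nord psi i j (\sum_(x <- r) F x) = \sum_(x <- r) nord psi i j (F x).
Proof.
rewrite /nord; case: ifP => _; first by rewrite !raddf_sum.
by case: ifP => _; rewrite ?big1_eq // !raddf_sum.
Qed.

(** The terms with indices in [-N, N] add up to the truncated product, acting on series
    in u. *)
Lemma sum_terms N s (phi : int -> Gamma_skewRing) d :
  \sum_(t <- terms N s) os_op t (phi (d - os_deg t)) =
  boxprod (opuA Gamma_skewRing) m N s phi d.
Proof.
elim: s d => [|a s IHs] d /=.
  by rewrite (@V_sum Gamma_skewRing); apply: eq_bigr => k _; rewrite BopE.
set psi := boxprod _ _ _ _ _ in IHs *.
rewrite -[map _ _ ++ _]/([seq (x, t) | x <- pair_terms N a, t <- terms N s]).
rewrite big_allpairs /=.
rewrite big_cons; congr (_ + _).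
  by rewrite -IHs; apply: eq_bigr => t _; rewrite add0r.
rewrite big_map big_allpairs /pairsum (@V_sum Gamma_skewRing); apply: eq_bigr => i _.
rewrite (@V_sum Gamma_skewRing); apply: eq_bigr => j _ /=.
have -> : nord (opuA Gamma_skewRing) i j psi d = Bop2 i j (psi (d - (i + j))).
  rewrite Bop2E /nord; case: ifP => _; last case: ifP => _ //.
    by rewrite opprD addrA.
  by rewrite opprD [- i - j]addrC addrA.
rewrite -IHs !Bop2E; apply/esym.
rewrite nord_sum; apply: eq_bigr => t _; rewrite -Bop2E.
by rewrite -addrA -opprD.
Qed.

(** In each factor the indices avoid the class of -k, so B_k commutes with the pairs and
    anticommutes with the last letter. *)
Lemma psi_op s k (t : os_idx (prodS s)) (g : Gamma_skewRing) : avoid m s k -> os_dom t ->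
  Bv k (os_op t g : Gamma_skewRing) = - os_op t (Bv k g).
Proof.
elim: s t => [|a s IHs] /=.
  move=> l /andP[k0 _] /modzE l0; rewrite !BopE.
  apply: (psi_anti (psi := BvA) (@cliff Gamma_skewRing)); apply/eqP => kl.
  case/negP: k0; have -> : k = - (l - 0) by lia.
  by rewrite rpredN.
move=> [x t] /= /andP[k0 /andP[/andP[ka1 ka2] ks]] [xD tD].
have {}IHs := IHs t; have ak : avoid m s k by apply/andP.
case: x xD => [[] _|[i j] /= [/modzE ia /modzE ja]] /=; first exact: IHs.
rewrite !Bop2E.
have opN f : nord BvA i j (- f) = - nord BvA i j f.
  by rewrite /nord; case: ifP => _; [|case: ifP => _]; rewrite ?oppr0 ?raddfN //= raddfN.
rewrite -opN -IHs //; apply/eqP; rewrite eq_sym -subr_eq0; apply/eqP.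
rewrite (nord_comm (psi := BvA) (@cliff Gamma_skewRing)) /clif.
case: eqP => [jk|_].
  by case/negP: ka2; rewrite -rpredN; have -> : - (k + a%:Z) = j - a%:Z by move: jk; clear; lia.
case: eqP => [ik|_]; last by rewrite !mulr0z subrr.
by case/negP: ka1; rewrite -rpredN; have -> : - (k - a%:Z) = i - - a%:Z by move: ik; clear; lia.
Qed.

(** Suppose that B_k g = 0 for k < -e.  The smaller index of a pair acts first and, by
    [psi_op], anticommutes past all the later letters, so it is at least -e unless the
    term kills g.  As there are at most 2 |s| + 1 indices, all at least -e, none
    exceeds the degree by more than (2 |s| + 1) e. *)
Lemma term_bound s (t : os_idx (prodS s)) (g : Gamma_skewRing) (e : nat) :
  sep m s -> (forall k, k < - e%:Z -> Bv k g = 0) -> os_dom t -> os_op t g != 0 ->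
  - ((size s).*2.+1 * e)%N%:Z <= os_deg t /\
  forall N : nat, (e <= N)%N -> os_deg t + ((size s).*2.+1 * e)%N%:Z <= N%:Z -> t \in terms N s.
Proof.
move=> + ge; elim: s t => [|a s IHs] /=.
  move=> k _ /modzE k0; rewrite BopE => kg.
  have ke : - e%:Z <= k by rewrite leNgt; apply/negP => /ge kz; rewrite kz eqxx in kg.
  by rewrite mul1n; split=> // N eN kN; rewrite mem_cls k0; lia.
move=> [x t] /= sep_as [xD tD]; rewrite doubleS.
have -> : ((size s).*2.+2.+1 * e = e + e + (size s).*2.+1 * e)%N by lia.
set b := ((size s).*2.+1 * e)%N in IHs *; have /andP[sa ss] := sep_as.
case: x xD => [[] _|[i j] /= [/modzE ia /modzE ja]] /= tg.
  have [tlow tin] := IHs t ss tD tg; rewrite add0r; split; first by lia.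
  move=> N eN tN; apply: (@mem_terms_cons N a s (inl tt)) => //.
  by apply: tin; lia.
have tg0 : os_op t g != 0.
  apply: contraNneq tg => ->; rewrite Bop2E; apply/eqP.
  by rewrite /nord; case: ifP => _; [|case: ifP => _]; rewrite ?raddf0 ?oppr0.
have [tlow tin] := IHs t ss tD tg0.
have low k : (m %| k - a%:Z)%Z || (m %| k + a%:Z)%Z -> k < - e%:Z -> BvA k (os_op t g) = 0.
  by move=> ka ke; rewrite [LHS]psi_op ?ge ?op0 ?oppr0 //; exact: class_dichotomy sep_as ka.
have [ie je] : - e%:Z <= i /\ - e%:Z <= j.
  move: tg; rewrite Bop2E /nord; rewrite opprK in ia.
  case: (ltrgtP j i) => ij tg; [| |by rewrite eqxx in tg].
    suff : - e%:Z <= j by lia.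
    by rewrite leNgt; apply/negP => je; rewrite low ?ja // raddf0 eqxx in tg.
  suff : - e%:Z <= i by lia.
  by rewrite leNgt; apply/negP => ie; rewrite low ?ia ?orbT // raddf0 oppr0 eqxx in tg.
split; first by lia.
move=> N eN tN; apply: (@mem_terms_cons N a s (inr (i, j))); last by apply: tin; lia.
rewrite inE; apply/orP; right; rewrite map_f //.
by apply/allpairsP; exists (i, j); split=> //=; rewrite mem_cls ?ia ?ja; lia.
Qed.

Lemma prodS_fin s d (g : Gamma_skewRing) : sep m s -> exists N0 : nat, forall N : nat, (N0 <= N)%N ->
  forall t, os_terms (prodS s) d t -> os_op t g != 0 -> t \in terms N s.
Proof.
move=> ss; have [e ge] := Bv_low g; exists (absz d + (size s).*2.+1 * e + e)%N => N N0 t [tD td] tg.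
by have [_] := term_bound ss ge tD tg; apply; rewrite ?td; lia.
Qed.

Lemma prodS_summable s : sep m s -> os_summable (prodS s).
Proof.
move=> ss d g; have [N HN] := prodS_fin d g ss.
apply: sub_finite_set (finite_seq (terms N s)) => t [td /= tg]; exact: HN (leqnn N) t td tg.
Qed.

Lemma prodS_coef s d (g : Gamma_skewRing) : sep m s -> exists N0 : nat, forall N : nat, (N0 <= N)%N ->
  boxprod (opuA Gamma_skewRing) m N s (delta g) d = os_coef (prodS s) d g.
Proof.
move=> ss; have [N0 HN] := prodS_fin d g ss; exists N0 => N /HN tP.
rewrite -sum_terms /os_coef (fsbigE [seq t <- terms N s | os_deg t == d]) /=; first last.
- move=> t td; rewrite mem_filter; have [_ ->] := td; rewrite eqxx /= => tN.
  by apply/eqP; apply: contraNT tN; exact: tP.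
- by move=> t /=; rewrite mem_filter => /andP[/eqP td tN]; split=> //; exact: terms_dom tN.
- exact: filter_uniq (terms_uniq N s).
rewrite big_filter_cond big_seq_cond [RHS]big_seq_cond big_mkcond [RHS]big_mkcond.
apply: eq_bigr => t _; case tN: (t \in _) => //=.
rewrite /delta subr_eq0 eq_sym; case: eqP => [td|_]; last by rewrite op0.
by rewrite mem_set //; split=> //; exact: terms_dom tN.
Qed.

End OperatorSeries.

(** * The formula *)

Section PowerVertexOperator.
Variable m : nat.
Hypothesis m_odd : odd m.
Implicit Types (d n : int) (g : Gamma_skewRing).

Definition prod_coef : int -> Gamma_skewRing -> Gamma_skewRing :=
  os_coef (prodS m (evens m)).

Lemma prodS_evens_coef d g : exists N0 : nat, forall N : nat, (N0 <= N)%N ->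
  boxprod (opuA Gamma_skewRing) m N (evens m) (delta g) d = prod_coef d g.
Proof. by apply: prodS_coef => //; have [] := admissible_evens m_odd. Qed.

Local Notation RP := prodS_evens_coef.

(** The image of 1 under the product is sum_n (q_n o p_m) u^(nm). *)
Lemma qfun_powE n : qfun_pow m n = powvac m prod_coef n.
Proof.
have m0 := m_gt0 m_odd; move: n; apply: qfun_pow_uniq => n.
- exact: (powvac_lt0 m_odd RP).
- by rewrite [LHS](chi_vacprod m_odd RP); congr ((_ : bool)%:R); move: m0; clear; nia.
apply: (@addvar_two_term Gamma_skewRing m m_odd) => k.
rewrite /powvac (skew_vacprod m_odd RP).
by have -> : m%:Z * n - m%:Z = m%:Z * (n - 1) by ring.
Qed.

Lemma PhiE n g : Phi m n g = vop (zpair m_odd RP) n g.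
Proof. by apply: eq_fsbigr => i _; rewrite perpE !qfun_powE. Qed.

Lemma Phi_coef d g : os_coef (@OpSeries int setT (fun n => n * m%:Z) (Phi m)) d g =
  if (m %| d)%Z then Phi m (d %/ m)%Z g else 0.
Proof.
have m0 : m%:Z != 0 by have := m_gt0 m_odd; lia.
rewrite /os_coef; case: ifP => md.
  have -> : os_terms (@OpSeries int setT (fun n => n * m%:Z) (Phi m)) d = [set (d %/ m)%Z]%classic.
    apply/seteqP; split=> n /=; first by move=> [_ <-]; rewrite mulzK.
    by move=> ->; split=> //=; rewrite divzK.
  by rewrite fsbig_set1.
have -> : os_terms (@OpSeries int setT (fun n => n * m%:Z) (Phi m)) d = set0.
  by apply/seteqP; split=> n //= [_ nd]; rewrite -nd dvdz_mull in md.
by rewrite fsbig_set0.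
Qed.

Lemma Phi_summable : os_summable (@OpSeries int setT (fun n => n * m%:Z) (Phi m)).
Proof.
have m0 : m%:Z != 0 by have := m_gt0 m_odd; lia.
move=> d g; apply: sub_finite_set (finite_set1 (d %/ m)%Z) => n /= [[_ <-] _].
by rewrite mulzK.
Qed.

End PowerVertexOperator.

Local Open Scope classical_set_scope.

Theorem theorem4p1 (m : nat) (hm : odd m) :
  os_eq
    (@OpSeries int [set: int] (fun n => n * m%:Z) (Phi m))
    (foldr os_mul
       (@OpSeries int [set k : int | (k = 0 %[mod m])%Z] (fun k => k) Bop)
       [seq os_add os_one
              (@OpSeries (int * int)%type
                 [set ij : int * int |
                    (ij.1 = - a%:Z %[mod m])%Z /\ (ij.2 = a%:Z %[mod m])%Z]
                 (fun ij => ij.1 + ij.2) (fun ij => Bop2 ij.1 ij.2))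
       | a <- [seq (2 * t)%N | t <- iota 1 m.-1./2]]).
Proof.
rewrite (prodSE m (evens m)); split.
- exact: Phi_summable.
- by apply: prodS_summable => //; have [] := admissible_evens hm.
move=> d g; rewrite Phi_coef // PhiE.
by rewrite -[RHS]/(prod_coef m d g) (limprod_powvop hm (prodS_evens_coef hm)).
Qed.
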